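(* Let $d\ge 2$ be a fixed integer and let $0\le j<d-1$. Define $S_j=\max\{s:\delta(G_s)\le j\}$ (the last time there is a vertex of degree at most $j$ in the random $d$-process). Then for each $t=t(n)>0$ we have $$\mathbf P(S_j<N-t)=e^{-\lambda}+o(1)\qquad(n\to\infty),$$ where $\lambda=f_j(d,t,n)=\dfrac{2[d-1]_{d-1-j}\,t}{\log^{d-1-j}n}$.
   Context: The $d$-process $\mathcal P(d,n)$ starts with the empty graph on $n$ vertices and at each step adds one edge chosen uniformly at random from all pairs of distinct vertices that are not yet edges and both of whose vertices currently have degree less than $d$; it stops when no such pair exists. $G_s$ denotes the graph when it has $s$ edges (for all $s$ up to the number of edges of the final graph), and $\delta(G)$ is the minimum degree of $G$. $N=\lfloor dn/2\rfloor$. $[x]_k=x(x-1)\cdots(x-k+1)$ is the falling factorial. Logarithms are natural. *)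

(* Defs.v *)
From HB Require Import structures.
From mathcomp Require Import reals exp.
From mathcomp Require Import all_boot all_order all_algebra.
Import Order.TTheory GRing.Theory Num.Theory.

Set Implicit Arguments.
Unset Strict Implicit.
Unset Printing Implicit Defensive.

(* A graph on the vertex set 'I_n is its set of edges, an edge being a
   two-element set of vertices. *)
Notation graph n := {set {set 'I_n}}.

Definition degree n (G : graph n) (v : 'I_n) : nat :=
  #|[set e in G | v \in e]|.

(* All degrees are at most n.-1, so the default value n plays no role as soon
   as 0 < n. *)
Definition min_degree n (G : graph n) : nat :=
  \big[minn/n]_(v : 'I_n) degree G v.

Definition available d n (G : graph n) : graph n :=
  [set e : {set 'I_n} |
    [&& #|e| == 2, e \notin G & [forall v in e, degree G v < d]]].

(* N = floor (d n / 2) *)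
Definition max_edges (d n : nat) : nat := (d * n) %/ 2.

(* Sample space of P(d,n): the edges in their order of insertion. Since
   degrees never exceed d, a run of the process has at most N edges. *)
Notation run d n := ((max_edges d n).-bseq {set 'I_n}).

(* G_s, the graph with s edges; meaningful for s <= size w. *)
Definition graph_at d n (w : run d n) (s : nat) : graph n :=
  [set e in take s w].

Definition complete_run d n (w : run d n) : bool :=
  [forall i : 'I_(size w),
     nth set0 w i \in available d (graph_at w i)] &&
  (available d (graph_at w (size w)) == set0).

Definition dprocess_prob (R : realType) d n (E : pred (run d n)) : R :=
  (\sum_(w : run d n | complete_run w && E w)
     \prod_(i < size w) (#|available d (graph_at w i)|%:R)^-1)%R.

(* S_j; the set of such s contains 0 when 0 < n. *)
Definition last_time_le d n (j : nat) (w : run d n) : nat :=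
  \max_(s < (size w).+1 | min_degree (graph_at w s) <= j) s.

Definition rate (R : realType) (d j : nat) (t : R) (n : nat) : R :=
  (2 * ((d - 1) ^_ (d - 1 - j))%:R * t / ln n%:R ^+ (d - 1 - j))%R.

(* Main.v *)
Require Import Defs.
From mathcomp Require Import all_classical all_reals all_analysis.
From mathcomp Require Import all_boot all_order all_algebra.
From mathcomp Require Import zify ring lra.
Import Order.TTheory GRing.Theory Num.Theory.
Import numFieldNormedType.Exports.

(** Let [u] be the number of open vertices, those of degree below [d], and let
    a clock advance by [2 / u] at each step. A step hits a given open vertex
    with probability [2 / u + O(1 / u^2)]: the edges already present forbid
    only [O(u)] of the [u^2 / 2] pairs of open vertices, and since the sum of
    [1 / u^2] over the steps is dominated by its last terms, this correction
    never accumulates. Measured by the clock, degrees therefore grow like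
    independent Poisson processes stopped at [d], and at time [T] the numbers
    of vertices of degree [q < d] are in the proportions [T^q / q!]. Close to
    the end the clock reads about [log n] and nearly all open vertices lack
    one edge, so with [m] missing edges there are about [2 m] open vertices,
    and about [2 m [d-1]_k / log^k n] of them have degree [j = d - 1 - k]. For
    [m] of order [log^k n] these are few vertices, hit almost independently,
    and the chance that none is left is [exp (- lambda)].

    Until about [log^(2d+7) n] edges are missing, the degree counts are
    concentrated. The balance [T N_(q-1) - q N_q] vanishes for Poisson
    proportions. In mean, one step shrinks it by a factor [1 - 2 / u] up to an
    influence of the balance of [q - 1], faster than the deficit (the number
    of missing edge ends, at least [u]) shrinks, while its jumps are [O(log
    n)]; so its second moment stays [O(log^2 n)] times the deficit, with no
    prior knowledge of the random clock ([balance_second_moment]). The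
    balances bound the number of vertices of degree below [d - 1] by the
    deficit over the clock, and this makes the clock agree with [log n] up to
    [O(sqrt (log n))] in mean square ([slack_second_moment]). Chaining the
    balances from degree [d - 1] downwards gives every degree count
    ([below_second_moment], [below_fraction]).

    From there to [m] missing edges, the number [x] of vertices of degree at
    most [j] falls to a random number that is bounded in mean. If each step
    hit one of the [M] missing edge slots uniformly, [(1 - m / M)^x] would
    almost be a martingale; [survival_step] shows that it almost is one for
    the process, up to errors caused by the vertices of degree below [j] and
    by pairs of vertices of low degree. The moments of both decay with [M], up
    to a small power of [M], which the sparsity of low degrees pays for
    ([load_decay], [load_product_decay]). When [M = m] the power is the
    indicator of [x = 0], and at the start of this second phase it is close to
    [exp (- lambda)]; this is [second_phase] and [low_degree_asymptotic].

    Since the probability in question decreases in [t], the range [c log^k n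
    <= t <= C log^k n] covered by this argument squeezes all other values of
    [t]. *)

Set Implicit Arguments.
Unset Strict Implicit.
Unset Printing Implicit Defensive.

Local Open Scope ring_scope.

(** * One step of the process *)

Definition open_vertices (d n : nat) (G : graph n) : {set 'I_n} :=
  [set v | (degree G v < d)%N].

Section OneStep.
Variables (R : realType) (d n : nat) (G : graph n).
Local Notation U := (open_vertices d G).
Local Notation u := #|U|.
Local Notation av := (available d G).

Definition step_mean (f : {set 'I_n} -> R) : R :=
  (#|av|%:R)^-1 * \sum_(e in av) f e.

Lemma available_vertex e v : e \in av -> v \in e -> v \in U.
Proof.
by rewrite !inE => /and3P[_ _ /forall_inP h] /h.
Qed.

Definition partners (v : 'I_n) : {set 'I_n} :=
  [set w in U :\ v | [set v; w] \notin G].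

Lemma available_at v : v \in U ->
  [set e in av | v \in e] = [set [set v; w] | w in partners v].
Proof.
move=> vU; apply/setP => e; apply/idP/imsetP.
  rewrite inE => /andP[eav ve].
  have := eav; rewrite inE => /and3P[/cards2P[x [y [xy ex]]] eG _].
  move: ve; rewrite {1}ex !inE => /orP[] /eqP vE.
    subst x; exists y => //; rewrite !inE -ex eG eq_sym xy /= andbT.
    by have /(_ y) := available_vertex eav; rewrite ex !inE eqxx orbT; apply.
  have eyx : e = [set y; x] by rewrite setUC.
  subst y; exists x => //; rewrite !inE -eyx eG xy /= andbT.
  by have /(_ x) := available_vertex eav; rewrite ex !inE eqxx; apply.
move=> [w + ->]; rewrite !inE eqxx /= andbT => /andP[/andP[wv wU] ->] /=.
rewrite cards2 (eq_sym v w) wv /=; apply/forall_inP => x; rewrite !inE.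
by move=> /orP[] /eqP -> //; move: vU; rewrite inE.
Qed.

Definition choices (v : 'I_n) : nat := #|[set e in av | v \in e]|.

Lemma set2_inj (v : 'I_n) (w1 w2 : 'I_n) : w1 != v ->
  [set v; w1] = [set v; w2] -> w1 = w2.
Proof.
move=> w1v /setP/(_ w1); rewrite !inE eqxx orbT (negbTE w1v) /=.
by move/esym/eqP.
Qed.

Lemma choicesE v : v \in U -> choices v = #|partners v|.
Proof.
move=> vU; rewrite /choices available_at // card_in_imset //.
by move=> w1 w2; rewrite !inE => /andP[/andP[h _] _] _; exact: set2_inj.
Qed.

Lemma choices_le v : v \in U -> (choices v <= u.-1)%N.
Proof.
move=> vU; rewrite choicesE // (cardsD1 v U) vU /=.
by apply: subset_leq_card; apply/subsetP => w; rewrite inE => /andP[].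
Qed.

Lemma choices_ge v : v \in U -> (u - d <= choices v)%N.
Proof.
move=> vU; rewrite choicesE //.
have dv : (degree G v < d)%N by move: vU; rewrite inE.
have : (#|(U :\ v) :\: partners v| <= degree G v)%N.
  rewrite /degree -(@card_in_imset _ _ (fun w => [set v; w])).
    apply: subset_leq_card; apply/subsetP => _ /imsetP[w /setDP[wU wP] ->].
    by rewrite !inE eqxx andbT; move: wP; rewrite inE wU negbK.
  by move=> w1 w2 /setDP[/setD1P[w1v _] _] _; exact: set2_inj.
have sub : partners v \subset U :\ v by apply/subsetP => w; rewrite inE => /andP[].
rewrite cardsD (setIidPr sub) => h.
have := cardsD1 v U; rewrite vU /= => ->; move: h dv; move: #|_| #|_| (degree _ _) => b c e; lia.
Qed.

Lemma sum_available (g : 'I_n -> R) :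
  \sum_(e in av) \sum_(v in e) g v = \sum_(v in U) (choices v)%:R * g v.
Proof.
rewrite (exchange_big_dep (mem U)) /=; last first.
  by move=> e v; exact: available_vertex.
apply: eq_bigr => v vU; rewrite sumr_const mulr_natl.
by rewrite /choices cardsE.
Qed.

Lemma sum_choices : (\sum_(v in U) choices v = 2 * #|av|)%N.
Proof.
apply/eqP; rewrite -(eqr_nat R) natr_sum.
have := sum_available (fun=> 1).
under [in RHS]eq_bigr do rewrite mulr1.
move=> <-; rewrite (eq_bigr (fun=> 2%:R)); last first.
  by move=> e; rewrite inE => /andP[/eqP e2 _]; rewrite sumr_const e2.
by rewrite sumr_const natrM mulr_natr.
Qed.

Lemma card_available_ge : (u * (u - d) <= 2 * #|av|)%N.
Proof.
rewrite -sum_choices -sum_nat_const; apply: leq_sum => v; exact: choices_ge.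
Qed.

Lemma card_available_le : (2 * #|av| <= u * u.-1)%N.
Proof.
rewrite -sum_choices -sum_nat_const; apply: leq_sum => v; exact: choices_le.
Qed.

Hypothesis d_gt0 : (0 < d)%N.
Hypothesis u_large : (2 * d <= u)%N.

Lemma card_available_gt0 : (0 < #|av|)%N.
Proof. by have := card_available_ge; nia. Qed.

Lemma card_available_quadratic : (u * u <= 4 * #|av|)%N.
Proof. have := card_available_ge; nia. Qed.

(** The number of available pairs at an open vertex is [u] up to an error
    [d], so one step hits it with probability [2/u + O(1/u^2)]. *)
Lemma choices_over_available v : v \in U ->
  `|(choices v)%:R / #|av|%:R - 2 / u%:R| <= 4 * d%:R / u%:R ^+ 2 :> R.
Proof.
move=> vU.
have c1 := choices_le vU; have c2 := choices_ge vU.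
have a1 := card_available_le; have a2 := card_available_ge.
have a3 := card_available_quadratic.
have u0 : (0 < u)%N by lia.
have A0 : (0 < #|av|)%N by exact: card_available_gt0.
set c := choices v in c1 c2 *.
have hU : (0 : R) < u%:R by rewrite ltr0n.
have hA : (0 : R) < #|av|%:R by rewrite ltr0n.
have -> : c%:R / #|av|%:R - 2 / u%:R
  = (c%:R * u%:R - 2 * #|av|%:R) / (#|av|%:R * u%:R) :> R.
  by field; rewrite !gt_eqF.
rewrite normrM normfV (gtr0_norm (mulr_gt0 hA hU)).
rewrite ler_pdivrMr ?mulr_gt0 //.
have num : `|c%:R * u%:R - 2 * #|av|%:R| <= (d * u)%:R :> R.
  rewrite ler_norml -lerBlDr opprK.
  have h1 : (c * u <= 2 * #|av| + d * u)%N by nia.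
  have h2 : (2 * #|av| <= c * u + d * u)%N by nia.
  move: h1 h2; rewrite -!(ler_nat R) !natrD !natrM => h1 h2.
  by apply/andP; split; lra.
apply: le_trans num _; rewrite natrM.
have -> : 4 * d%:R / u%:R ^+ 2 * (#|av|%:R * u%:R)
  = d%:R * (4 * #|av|%:R / u%:R) :> R by field; rewrite gt_eqF.
apply: ler_wpM2l => //; rewrite ler_pdivlMr //.
by move: a3; rewrite -(ler_nat R) !natrM.
Qed.

Lemma step_meanD f g : step_mean (f \+ g) = step_mean f + step_mean g.
Proof. by rewrite /step_mean big_split mulrDr. Qed.

Lemma step_mean_cst c : step_mean (fun=> c) = c.
Proof.
rewrite /step_mean sumr_const -[c *+ _]mulr_natl mulrA mulVf ?mul1r //.
by rewrite pnatr_eq0 -lt0n card_available_gt0.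
Qed.

Lemma step_mean_sum (g : 'I_n -> R) :
  step_mean (fun e => \sum_(v in e) g v)
  = \sum_(v in U) (choices v)%:R / #|av|%:R * g v.
Proof.
rewrite /step_mean sum_available big_distrr /=.
by apply: eq_bigr => v _; rewrite mulrA; congr (_ * _); rewrite mulrC.
Qed.

Lemma step_mean_sum_approx (g : 'I_n -> R) :
  `|step_mean (fun e => \sum_(v in e) g v) - 2 / u%:R * \sum_(v in U) g v|
   <= 4 * d%:R / u%:R ^+ 2 * \sum_(v in U) `|g v|.
Proof.
rewrite step_mean_sum !big_distrr /= -sumrB.
apply: le_trans (ler_norm_sum _ _ _) _; apply: ler_sum => v vU.
by rewrite -mulrBl normrM; apply: ler_wpM2r => //; exact: choices_over_available.
Qed.

End OneStep.

(** * Histories and their expectations *)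

Definition graph_of n (s : seq {set 'I_n}) : graph n := [set e in s].

Notation deg s v := (degree (graph_of s) v).
Notation opens d s := (open_vertices d (graph_of s)).
Notation moves d s := (available d (graph_of s)).

Inductive reachable (d n : nat) : seq {set 'I_n} -> Prop :=
| reach_nil : reachable d [::]
| reach_rcons s e : reachable d s -> e \in moves d s -> reachable d (rcons s e).

Lemma degree_rcons n (s : seq {set 'I_n}) e v : e \notin graph_of s ->
  deg (rcons s e) v = (deg s v + (v \in e))%N.
Proof.
move=> es; rewrite /degree addnC.
have ess : e \notin s by move: es; rewrite inE.
have -> : [set f in graph_of (rcons s e) | v \in f]
   = (if v \in e then e |: [set f in graph_of s | v \in f]
      else [set f in graph_of s | v \in f]).
  apply/setP => f; case: ifPn => ve; rewrite !inE mem_rcons inE.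
    by case: eqP => [->|]; rewrite ?ve.
  by case: eqP => [->|]; rewrite ?(negbTE ve) ?andbF.
by case: ifPn => // ve; rewrite cardsU1 !inE (negbTE ess).
Qed.

Section Reachable.
Variables (d n : nat).
Implicit Types (s : seq {set 'I_n}) (e : {set 'I_n}) (v : 'I_n).

Lemma moves_degree s e v : e \in moves d s ->
  deg (rcons s e) v = (deg s v + (v \in e))%N.
Proof. by rewrite inE => /and3P[_ es _]; exact: degree_rcons. Qed.

Lemma degree_nil v : deg [::] v = 0%N.
Proof. by apply/eqP; rewrite cards_eq0; apply/eqP/setP => e; rewrite !inE. Qed.

Lemma reachable_degree_le s v : reachable d s -> (deg s v <= d)%N.
Proof.
move=> r; elim: r v => [v|{}s e _ IH es v]; first by rewrite degree_nil.
rewrite (moves_degree _ es); have := @available_vertex _ _ _ _ v es.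
case: (v \in e) => [/(_ isT)|_]; last by rewrite addn0.
by rewrite addn1 inE.
Qed.

Lemma reachable_sum_degree s : reachable d s ->
  (\sum_v deg s v = 2 * size s)%N.
Proof.
elim=> [|{}s e _ IH es]; first by rewrite big1 // => v _; rewrite degree_nil.
under eq_bigr do rewrite (moves_degree _ es).
rewrite big_split /= IH size_rcons mulnS addnC; congr addn.
rewrite -big_mkcond /= sum1_card.
by move: es; rewrite inE => /andP[/eqP].
Qed.

Definition below (q : nat) s : nat := #|[set v | (deg s v < q)%N]|.

Lemma below0 s : below 0 s = 0%N.
Proof. by apply/eqP; rewrite cards_eq0; apply/eqP/setP => v; rewrite !inE. Qed.

Lemma below_full s : below d s = #|opens d s|.
Proof. by []. Qed.

Lemma leq_below p q s : (p <= q)%N -> (below p s <= below q s)%N.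
Proof.
move=> pq; apply/subset_leq_card/subsetP => v; rewrite !inE => h.
exact: leq_trans h pq.
Qed.

Lemma deficit_sum s : reachable d s ->
  (\sum_(v in opens d s) (d - deg s v) + 2 * size s = d * n)%N.
Proof.
move=> r; rewrite -(reachable_sum_degree r) big_mkcond -big_split /=.
rewrite (eq_bigr (fun=> d)) ?sum_nat_const ?card_ord 1?mulnC // => v _.
have := reachable_degree_le v r; rewrite inE; case: ltnP; lia.
Qed.

Lemma open_le_deficit s : reachable d s ->
  (#|opens d s| <= d * n - 2 * size s)%N.
Proof.
move=> r; have <- : (\sum_(v in opens d s) (d - deg s v) = d * n - 2 * size s)%N.
  by rewrite -(deficit_sum r) addnK.
by rewrite -sum1_card; apply: leq_sum => v; rewrite inE subn_gt0.
Qed.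

Lemma deficit_le_open s : reachable d s ->
  (d * n - 2 * size s <= d * #|opens d s|)%N.
Proof.
move=> r; have <- : (\sum_(v in opens d s) (d - deg s v) = d * n - 2 * size s)%N.
  by rewrite -(deficit_sum r) addnK.
by rewrite mulnC -sum_nat_const; apply: leq_sum => v _; rewrite leq_subr.
Qed.

(** Only a vertex of degree below [d - 1] lacks more than one edge. *)
Lemma deficit_le_below s : reachable d s ->
  (d * n - 2 * size s <= #|opens d s| + d * below d.-1 s)%N.
Proof.
move=> r; have <- : (\sum_(v in opens d s) (d - deg s v) = d * n - 2 * size s)%N.
  by rewrite -(deficit_sum r) addnK.
rewrite mulnC -sum_nat_const -sum1_card.
have -> : (\sum_(v in [set v | (deg s v < d.-1)%N]) d
   = \sum_(v in opens d s) (if (deg s v < d.-1)%N then d else 0))%N.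
  rewrite -big_mkcondr; apply: eq_bigl => v; rewrite !inE.
  by apply/idP/andP => [|[]//]; split => //; lia.
rewrite -big_split /=; apply: leq_sum => v; rewrite inE => vd.
by case: ltnP => h; lia.
Qed.

Variable R : realType.

Lemma eq_step_mean (G : graph n) (f g : {set 'I_n} -> R) :
  (forall e, e \in available d G -> f e = g e) ->
  step_mean d G f = step_mean d G g.
Proof. by move=> fg; rewrite /step_mean; congr (_ * _); apply: eq_bigr. Qed.

Lemma ler_step_mean (G : graph n) (f g : {set 'I_n} -> R) :
  (forall e, e \in available d G -> f e <= g e) ->
  step_mean d G f <= step_mean d G g.
Proof.
move=> fg; rewrite /step_mean; apply: ler_wpM2l; first by rewrite invr_ge0.
exact: ler_sum.
Qed.

Lemma step_meanZ (G : graph n) c (f : {set 'I_n} -> R) :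
  step_mean d G (fun e => c * f e) = c * step_mean d G f.
Proof. by rewrite /step_mean -big_distrr /= mulrCA. Qed.

Definition statistic (psi : nat -> R) s : R := \sum_v psi (deg s v).

Lemma statistic_rcons psi s e : e \in moves d s ->
  statistic psi (rcons s e)
  = statistic psi s + \sum_(v in e) (psi (deg s v).+1 - psi (deg s v)).
Proof.
move=> es; rewrite /statistic [X in _ + X]big_mkcond -big_split /=.
apply: eq_bigr => v _; rewrite (moves_degree _ es).
by case: ifP => _; rewrite ?addn1 ?addn0 ?addr0 // subrKC.
Qed.

(** The mean over no available pair is [0], so a branch on which the process
    stops before step [l] contributes nothing. *)
Fixpoint expect (l : nat) (F : seq {set 'I_n} -> R) : R :=
  if l is l'.+1 then
    expect l' (fun s => step_mean d (graph_of s) (fun e => F (rcons s e)))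
  else F [::].

Lemma ler_expect l F1 F2 :
  (forall s, reachable d s -> size s = l -> F1 s <= F2 s) ->
  expect l F1 <= expect l F2.
Proof.
elim: l F1 F2 => [|l IH] F1 F2 h; first by apply: h => //; exact: reach_nil.
apply: IH => s rs sl; apply: ler_step_mean => e es.
by apply: h; [exact: reach_rcons|rewrite size_rcons sl].
Qed.

Lemma eq_expect l F1 F2 :
  (forall s, reachable d s -> size s = l -> F1 s = F2 s) ->
  expect l F1 = expect l F2.
Proof.
by move=> h; apply/eqP; rewrite eq_le; apply/andP; split; apply: ler_expect
  => s rs sl; rewrite h.
Qed.

Lemma expectD l F1 F2 :
  expect l (fun s => F1 s + F2 s) = expect l F1 + expect l F2.
Proof.
elim: l F1 F2 => //= l IH F1 F2; rewrite -IH; apply: eq_expect => s _ _.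
by rewrite -step_meanD.
Qed.

Lemma expectZ l c F : expect l (fun s => c * F s) = c * expect l F.
Proof.
elim: l F => //= l IH F; rewrite -IH; apply: eq_expect => s _ _.
by rewrite -step_meanZ.
Qed.

Lemma expectN l F : expect l (fun s => - F s) = - expect l F.
Proof.
rewrite -mulN1r -expectZ; apply: eq_expect => s _ _; by rewrite mulN1r.
Qed.

Lemma expectB l F1 F2 :
  expect l (fun s => F1 s - F2 s) = expect l F1 - expect l F2.
Proof. by rewrite expectD expectN. Qed.

Lemma expect0 l : expect l (fun=> 0) = 0.
Proof.
by rewrite -[RHS](mul0r (expect l (fun=> 0))) -expectZ; apply: eq_expect => s _ _;
  rewrite mul0r.
Qed.

Lemma expect_ge0 l F :
  (forall s, reachable d s -> size s = l -> 0 <= F s) -> 0 <= expect l F.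
Proof. by move=> h; rewrite -(expect0 l); apply: ler_expect. Qed.

Lemma expect_sum l (I : Type) (r : seq I) (P : pred I) F :
  expect l (fun s => \sum_(i <- r | P i) F i s)
  = \sum_(i <- r | P i) expect l (F i).
Proof.
elim: r => [|i r IH].
  by rewrite big_nil -[RHS](expect0 l); apply: eq_expect => s _ _; rewrite big_nil.
rewrite big_cons -IH; case: ifP => Pi.
  by rewrite -expectD; apply: eq_expect => s _ _; rewrite big_cons Pi.
by apply: eq_expect => s _ _; rewrite big_cons Pi.
Qed.

Lemma expect_norm l F : `|expect l F| <= expect l (fun s => `|F s|).
Proof.
rewrite ler_norml -expectN; apply/andP; split; apply: ler_expect => s _ _.
  by rewrite lerNl -normrN ler_norm.
exact: ler_norm.
Qed.

Lemma expectS l F : expect l.+1 F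
  = expect l (fun s => step_mean d (graph_of s) (fun e => F (rcons s e))).
Proof. by []. Qed.

Lemma moves_gt0 s : (0 < d)%N -> reachable d s ->
  (2 * d ^ 2 <= d * n - 2 * size s)%N -> (0 < #|moves d s|)%N.
Proof.
move=> d0 rs h; apply: card_available_gt0 => //.
by have := deficit_le_open rs; nia.
Qed.

Lemma open_ge s : (0 < d)%N -> reachable d s ->
  (2 * d ^ 2 <= d * n - 2 * size s)%N -> (2 * d <= #|opens d s|)%N.
Proof. by move=> d0 rs h; have := deficit_le_open rs; nia. Qed.

Lemma expect_cst l c : (0 < d)%N -> (2 * d ^ 2 <= d * n - 2 * l)%N ->
  expect l (fun=> c) = c.
Proof.
move=> d0; elim: l => //= l IH h.
rewrite -[RHS]IH; last by apply: leq_trans h _; rewrite leq_sub2l // leq_mul2l leqnSn.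
apply: eq_expect => s rs sl; rewrite step_mean_cst //; apply: open_ge => //.
by rewrite sl; apply: leq_trans h _; rewrite leq_sub2l // leq_mul2l leqnSn.
Qed.

End Reachable.

(** * Probabilities of runs *)

Lemma sum_bseqS (R : realType) (T : finType) (x0 : T) k (F : seq T -> R) :
  \sum_(w : k.+1.-bseq T) F w
  = F [::] + \sum_(e : T) \sum_(w : k.-bseq T) F (e :: w).
Proof.
rewrite (bigD1 (nil_bseq k.+1 T)) //=; congr (_ + _).
rewrite pair_big /=.
rewrite (reindex_onto (fun p : T * k.-bseq T => cons_bseq p.1 p.2)
   (fun w : k.+1.-bseq T => (head x0 w, behead_bseq w))) /=; last first.
  by case=> [[|x w] hw] //= wn; apply: val_inj.
apply: eq_big => [[e w]|[e w] _] //=.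
by rewrite xpair_eqE eqxx /=; apply/eqP/val_inj.
Qed.

Section Runs.
Variables (R : realType) (d n : nat).
Hypothesis d_gt0 : (0 < d)%N.
Implicit Types (s w : seq {set 'I_n}) (e : {set 'I_n}).

(** Probability that the process, having inserted the edges [s], continues
    with exactly the edges [w] and then stops. *)
Fixpoint continuation s w : R :=
  if w is e :: w' then
    (e \in moves d s)%:R / #|moves d s|%:R * continuation (rcons s e) w'
  else (moves d s == finset.set0)%:R.

Lemma continuationE s w : continuation s w =
  (all (fun i => nth finset.set0 w i \in moves d (s ++ take i w)) (iota 0 (size w))
    && (moves d (s ++ w) == finset.set0))%:R
  * \prod_(i < size w) (#|moves d (s ++ take i w)|%:R)^-1.
Proof.
elim: w s => [|e w IH] s; first by rewrite /= big_ord0 mulr1 cats0.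
rewrite big_ord_recl /= cats0 IH cat_rcons -add1n iotaDl all_map.
rewrite (eq_bigr (fun i : 'I_(size w) => (#|moves d (s ++ e :: take i w)|%:R)^-1));
  last by move=> i _; rewrite cat_rcons.
rewrite (eq_all (a2 := preim (addn 1)
  (fun i => nth finset.set0 (e :: w) i \in moves d (s ++ take i (e :: w))))); last first.
  by move=> i /=; rewrite cat_rcons.
case: (e \in _); rewrite ?mul0r //= mul1r.
by rewrite mulrCA.
Qed.

Lemma dprocess_probE (E : pred (run d n)) :
  dprocess_prob R E = \sum_(w : run d n) continuation [::] w * (E w)%:R.
Proof.
rewrite /dprocess_prob [LHS]big_mkcond /=; apply: eq_bigr => w _.
rewrite continuationE /= /complete_run.
have -> : [forall i : 'I_(size w),
     nth finset.set0 w i \in available d (graph_at w i)] =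
   all (fun i => nth finset.set0 w i \in moves d (take i w)) (iota 0 (size w)).
  apply/forallP/allP => [h i|h i]; last by apply: h; rewrite mem_iota ltn_ord.
  by rewrite mem_iota add0n => /andP[_ iw]; exact: (h (Ordinal iw)).
rewrite {1}/graph_at take_size.
by case: (all _ _); case: (_ == _); case: (E w);
  rewrite /= ?mul0r ?mul1r ?mulr1 ?mulr0.
Qed.

Definition tail_mass k s (F : seq {set 'I_n} -> R) : R :=
  \sum_(w : k.-bseq {set 'I_n}) continuation s w * F (s ++ w).

Lemma tail_massS k s F : tail_mass k.+1 s F =
  (moves d s == finset.set0)%:R * F s
  + step_mean d (graph_of s) (fun e => tail_mass k (rcons s e) F).
Proof.
rewrite /tail_mass (sum_bseqS finset.set0 k (fun w => continuation s w * F (s ++ w))).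
rewrite /= cats0; congr (_ + _).
rewrite /step_mean big_distrr [RHS]big_mkcond /=; apply: eq_bigr => e _.
case: ifP => es; last by rewrite big1 // => w _; rewrite !mul0r.
rewrite big_distrr /=; apply: eq_bigr => w _.
by rewrite mul1r mulrA cat_rcons.
Qed.

Lemma moves_exhausted s : reachable d s -> (max_edges d n <= size s)%N ->
  moves d s = finset.set0.
Proof.
move=> rs h; apply/eqP; rewrite -cards_eq0 -leqn0.
have h1 := card_available_le R d (graph_of s); have h2 := open_le_deficit rs.
move: h; rewrite /max_edges => h.
have : (#|opens d s| <= 1)%N by lia.
move: h1; case: #|opens d s| => [|[|m]] //=; lia.
Qed.

(** With [max_edges d n] edges at most one vertex is open, so every branch has
    stopped by then. *)
Lemma tail_mass1 k s : reachable d s -> (max_edges d n <= size s + k)%N ->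
  tail_mass k s (fun=> 1) = 1.
Proof.
elim: k s => [|k IH] s rs h.
  rewrite /tail_mass (big_pred1 (nil_bseq 0 _)) /=; last first.
    by move=> w; rewrite [w]bseq0; apply/esym/eqP/val_inj.
  by rewrite moves_exhausted ?eqxx ?mulr1 // -(addn0 (size s)).
rewrite tail_massS mulr1; case: eqP => ms.
  by rewrite /step_mean ms big_set0 mulr0 addr0.
rewrite add0r (@eq_step_mean _ _ _ _ _ (fun=> 1)); last first.
  by move=> e es; apply: IH; [exact: reach_rcons|rewrite size_rcons addSnnS].
rewrite /step_mean sumr_const mulVf // pnatr_eq0 cards_eq0; exact/eqP.
Qed.

Lemma continuation_ge0 s w : 0 <= continuation s w.
Proof.
elim: w s => [|e w IH] s /=; first exact: ler0n.
by rewrite mulr_ge0 // mulr_ge0 // invr_ge0.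
Qed.

Lemma le_dprocess_prob (E1 E2 : pred (run d n)) : (forall w : run d n, E1 w -> E2 w) ->
  dprocess_prob R E1 <= dprocess_prob R E2.
Proof.
move=> h; rewrite !dprocess_probE; apply: ler_sum => w _.
apply: ler_wpM2l; first exact: continuation_ge0.
by rewrite ler_nat; have := h w; case: (E1 w) => // ->.
Qed.

Lemma dprocess_prob_le1 (E : pred (run d n)) : dprocess_prob R E <= 1.
Proof.
apply: le_trans (_ : dprocess_prob R (fun _ : run d n => true) <= 1).
  exact: le_dprocess_prob.
rewrite dprocess_probE; have := tail_mass1 (reach_nil d n) (leqnn (max_edges d n)).
by move=> h; rewrite -[leRHS]h.
Qed.

Lemma dprocess_prob_ge0 (E : pred (run d n)) : 0 <= dprocess_prob R E.
Proof.
by rewrite dprocess_probE sumr_ge0 // => w _; rewrite mulr_ge0 // continuation_ge0.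
Qed.

(** The bound on [l] rules out that the process stops within [l] steps, so no
    mass is lost by averaging step by step. *)
Lemma dprocess_prob_expect (P : pred (seq {set 'I_n})) l :
  (2 * d ^ 2 + 2 * l <= d * n)%N ->
  dprocess_prob R (fun w : run d n => P (take l w))
  = expect d l (fun s => (P s)%:R).
Proof.
move=> hl; pose N := max_edges d n.
have hlN : (l <= N)%N by rewrite /N /max_edges; lia.
pose F s : R := (P (take l s))%:R.
have -> : dprocess_prob R (fun w : run d n => P (take l w)) = tail_mass N [::] F.
  by rewrite dprocess_probE.
suff main i : (i <= l)%N -> tail_mass N [::] F = expect d i (fun s => tail_mass (N - i) s F).
  rewrite (main l) //; apply: eq_expect => s rs sl.
  transitivity ((P s)%:R * tail_mass (N - l) s (fun=> 1)); last first.
    by rewrite tail_mass1 ?mulr1 // sl subnKC.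
  rewrite /tail_mass big_distrr /=; apply: eq_bigr => w _.
  by rewrite mulr1 mulrC /F take_size_cat.
elim: i => [|i IH] il; first by rewrite subn0.
rewrite IH 1?ltnW // expectS; apply: eq_expect => s rs si.
have -> : (N - i = (N - i.+1).+1)%N by lia.
rewrite tail_massS; case: eqP => [ms|_]; last by rewrite mul0r add0r.
have := moves_gt0 R d_gt0 rs; rewrite ms cards0 si; lia.
Qed.

(** As long as [2 d] vertices are open some pair of them is available, so the
    process has not stopped. *)
Lemma size_complete_run (w : run d n) l :
  (2 * d ^ 2 + 2 * l <= d * n)%N -> complete_run w -> (l <= size w)%N.
Proof.
move=> hl /andP[/forallP h /eqP fin]; rewrite leqNgt; apply/negP => wl.
suff : reachable d w.
  move=> rw; have := moves_gt0 R d_gt0 rw.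
  have -> : moves d w = finset.set0 by rewrite -fin /graph_at take_size.
  rewrite cards0; lia.
have r i : (i <= size w)%N -> reachable d (take i w).
  elim: i => [|i IH] iw; first by rewrite take0; exact: reach_nil.
  rewrite (take_nth finset.set0) //; apply: reach_rcons; first by apply: IH; exact: ltnW.
  exact: (h (Ordinal iw)).
by have := r (size w) (leqnn _); rewrite take_size.
Qed.

End Runs.

(** * The random clock and the balances *)

(** After squaring, a contraction by [1 - 2 h] leaves room to absorb a bias of
    order [h] and still contracts by [1 - 5 h / 2]. *)
Lemma square_bias_le (R : realType) (h x b : R) : 0 <= h -> 3 * h <= 1 ->
  ((1 - 2 * h) * x + h * b) ^+ 2 <= (1 - 5 / 2 * h) * x ^+ 2 + 2 * h * b ^+ 2.
Proof.
move=> h0 h1.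
have e1 : 0 <= h * ((1 - 2 * h) * x - b) ^+ 2 by rewrite mulr_ge0 ?sqr_ge0.
have e2 : 0 <= h * (1 - h) * b ^+ 2.
  by rewrite mulr_ge0 ?sqr_ge0 // mulr_ge0 //; lra.
have e3 : 0 <= h * (1 / 2 - 4 * h ^+ 2) * x ^+ 2.
  by rewrite mulr_ge0 ?sqr_ge0 // mulr_ge0 //; nra.
rewrite -subr_ge0.
have -> : (1 - 5 / 2 * h) * x ^+ 2 + 2 * h * b ^+ 2 - ((1 - 2 * h) * x + h * b) ^+ 2
  = h * ((1 - 2 * h) * x - b) ^+ 2 + h * (1 - h) * b ^+ 2
    + h * (1 / 2 - 4 * h ^+ 2) * x ^+ 2 by field.
by rewrite !addr_ge0.
Qed.

Section Clock.
Variables (R : realType) (d n : nat).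
Hypothesis d_ge2 : (2 <= d)%N.
Implicit Types (s : seq {set 'I_n}) (e : {set 'I_n}) (v : 'I_n).

Local Notation U s := (opens d s).
Local Notation u s := (#|opens d s|%:R : R).

Definition deficit (l : nat) : R := (d * n)%:R - 2 * l%:R.

Lemma deficitS l : deficit l.+1 = deficit l - 2.
Proof. by rewrite /deficit -natr1; ring. Qed.

Let d_gt0 : (0 < d)%N. Proof. by lia. Qed.

(** With [2 d^2] missing edge ends at least [2 d] vertices are open. *)
Definition early (l : nat) : bool := (2 * d ^ 2 + 2 * l <= d * n)%N.

Lemma earlyW l l' : (l' <= l)%N -> early l -> early l'.
Proof. by move=> h; apply: leq_trans; rewrite leq_add2l leq_mul2l. Qed.

Lemma early_size l : early l -> (2 * l <= d * n)%N.
Proof. by apply: leq_trans; rewrite leq_addl. Qed.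

Lemma expect_const l (c : R) : early l -> @expect d n R l (fun=> c) = c.
Proof.
move=> hl; apply: expect_cst => //; rewrite leq_subRL ?early_size //.
by rewrite addnC.
Qed.

Lemma deficit_natr l : (2 * l <= d * n)%N -> deficit l = (d * n - 2 * l)%:R.
Proof. by move=> h; rewrite /deficit natrB // !natrM. Qed.

Lemma early_deficit l : early l -> 2 * d%:R ^+ 2 <= deficit l.
Proof.
by move=> h; rewrite deficit_natr; move: h; rewrite /early -?natrX -?natrM ?ler_nat; lia.
Qed.

Lemma early_deficit_gt0 l : early l -> 0 < deficit l.
Proof.
move=> /early_deficit; apply: lt_le_trans.
by rewrite mulr_gt0 // exprn_gt0 // ltr0n.
Qed.

Lemma open_bounds s l : reachable d s -> size s = l -> early l ->
  [/\ u s <= deficit l, deficit l <= d%:R * u s & 2 * d%:R <= u s].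
Proof.
move=> rs sl hl; have hl' := hl; rewrite /early in hl'.
have h1 := open_le_deficit rs; have h2 := deficit_le_open rs.
have h3 := @open_ge _ _ s d_gt0 rs; rewrite sl in h1 h2 h3.
rewrite deficit_natr; last by lia.
by split; rewrite -?natrM ler_nat // h3 //; lia.
Qed.

Lemma u_gt0 s l : reachable d s -> size s = l -> early l -> 0 < u s.
Proof.
move=> rs sl hl; have [_ _] := open_bounds rs sl hl; apply: lt_le_trans.
by rewrite mulr_gt0 // ltr0n.
Qed.

(** The random clock in which every open vertex is hit at unit rate. *)
Definition clock s : R := \sum_(i < size s) 2 / u (take i s).

Lemma clock_nil : clock [::] = 0.
Proof. by rewrite /clock big_ord0. Qed.

Lemma clock_rcons s e : clock (rcons s e) = clock s + 2 / u s.
Proof.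
rewrite /clock size_rcons big_ord_recr /= -cats1 take_size_cat //; congr (_ + _).
by apply: eq_bigr => i _; rewrite takel_cat // ltnW.
Qed.

Lemma clock_ge0 s : 0 <= clock s.
Proof. by apply: sumr_ge0 => i _; rewrite divr_ge0. Qed.

Lemma ln_step_le (a : R) : 2 < a -> 2 / a <= ln a - ln (a - 2).
Proof.
move=> a2; have a0 : 0 < a by lra.
have : ln ((a - 2) / a) <= - (2 / a).
  have -> : (a - 2) / a = 1 + - (2 / a) by field; rewrite gt_eqF.
  by apply: le_ln1Dx; rewrite ltrN2 ltr_pdivrMr // mul1r.
by rewrite ln_div ?posrE //; lra.
Qed.

Lemma clock_le s l : reachable d s -> size s = l -> early l ->
  clock s <= d%:R * (ln (d * n)%:R - ln (deficit l)).
Proof.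
move=> rs; elim: rs l => [|{}s e rs IH es] l.
  by move=> <- _; rewrite clock_nil /deficit mulr0 subr0 subrr mulr0.
rewrite size_rcons => <- hl; have hs : early (size s) by apply: earlyW hl.
have [h1 h2 h3] := open_bounds rs erefl hs; have up := u_gt0 rs erefl hs.
have h4 := early_deficit hl; rewrite deficitS in h4.
rewrite clock_rcons deficitS; apply: le_trans (lerD (IH _ erefl hs) (lexx _)) _.
set a := deficit (size s) in h1 h2 h4 *.
have d2 : (2 : R) <= d%:R by rewrite ler_nat.
have a2 : 2 < a by nra.
have -> : d%:R * (ln (d * n)%:R - ln (a - 2)) = d%:R * (ln (d * n)%:R - ln a) +
   d%:R * (ln a - ln (a - 2)) by ring.
rewrite lerD2l; apply: le_trans (_ : d%:R * (2 / a) <= _).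
  rewrite ler_pdivrMr // mulrA mulrAC ler_pdivlMr ?(lt_trans _ a2) //.
  by rewrite [d%:R * 2]mulrC -mulrA; apply: ler_wpM2l.
by apply: ler_wpM2l => //; exact: ln_step_le.
Qed.

(** Poisson weights satisfy [T * P (q - 1) = q * P q]; [zeta] tests this
    relation at the degree [i] of one vertex. *)
Definition zeta (T : R) (q i : nat) : R :=
  T * (i.+1 == q)%:R - q%:R * (i == q)%:R.

Definition balance q s : R := statistic (zeta (clock s) q) s.

Definition degree_count q s : R := statistic (fun i => (i == q)%:R) s.
Definition degree_count_pred q s : R := statistic (fun i => (i.+1 == q)%:R) s.

Lemma balance0 s : balance 0 s = 0.
Proof. by rewrite /balance /statistic big1 // => v _; rewrite /zeta mulr0 mul0r subrr. Qed.

Lemma balanceE q s : balance q s = clock s * degree_count_pred q s - q%:R * degree_count q s.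
Proof.
by rewrite /balance /degree_count_pred /degree_count /statistic !big_distrr /= -sumrB.
Qed.

Definition zeta_jump s q v : R :=
  let T' := clock s + 2 / u s in zeta T' q (deg s v).+1 - zeta T' q (deg s v).

Lemma balance_rcons q s e : e \in moves d s ->
  balance q (rcons s e) = (balance q s + 2 / u s * degree_count_pred q s)
    + \sum_(v in e) zeta_jump s q v.
Proof.
move=> es; rewrite /balance clock_rcons (statistic_rcons _ es); congr (_ + _).
rewrite /degree_count_pred /statistic big_distrr -big_split /=.
by apply: eq_bigr => v _; rewrite /zeta; ring.
Qed.

Lemma zeta_jump_norm q s v Theta : clock s + 2 / u s + q%:R <= Theta ->
  `|zeta_jump s q v| <= Theta.
Proof.
move=> h; have T0 : 0 <= clock s + 2 / u s by rewrite addr_ge0 ?clock_ge0 ?divr_ge0.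
have q0 : 0 <= q%:R :> R by [].
rewrite /zeta_jump /zeta /=; set T := clock s + 2 / u s in T0 h *.
set i := deg s v.
have [e1|e1] := eqVneq i.+2 q; have [e2|e2] := eqVneq i.+1 q;
  have [e3|e3] := eqVneq i q; try lia;
  rewrite /= ?mulr0 ?mulr1 ?subr0 ?sub0r ?subrr ?oppr0 ?normr0 ?opprK ?ler_norml;
  try (apply/andP; split); lra.
Qed.

(** The left side adds the effect of the clock on the explicit [T] in [zeta] to
    that of one hit, so under hits at unit rate the balance of [q.+1] relaxes at
    unit rate towards that of [q]. *)
Lemma zeta_drift T q i :
  (i.+1 == q.+1)%:R + (zeta T q.+1 i.+1 - zeta T q.+1 i) = zeta T q i - zeta T q.+1 i.
Proof. by rewrite /zeta !eqSS -[in q.+1%:R]natr1; ring. Qed.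

Lemma sum_open q (f : nat -> R) s : (q < d)%N ->
  (forall i, (q < i)%N -> f i = 0) ->
  \sum_(v in U s) f (deg s v) = statistic f s.
Proof.
move=> qd h; rewrite /statistic big_mkcond /=; apply: eq_bigr => v _.
by rewrite inE; case: ltnP => // dv; rewrite h //; lia.
Qed.

Lemma zeta_eq0 T q i : (q < i)%N -> zeta T q i = 0.
Proof. by move=> h; rewrite /zeta !gtn_eqF ?mulr0 ?subr0 // ltnW. Qed.

Lemma degree_count_pred_open q s : (q <= d)%N ->
  degree_count_pred q s = \sum_(v in U s) ((deg s v).+1 == q)%:R.
Proof.
case: q => [|q] qd; rewrite /degree_count_pred.
  by rewrite /statistic !big1.
rewrite -(@sum_open q (fun i => (i.+1 == q.+1)%:R)) // => i qi.
by rewrite eqSS gtn_eqF.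
Qed.

Lemma degree_count_pred_bounds q s : (q <= d)%N -> 0 <= degree_count_pred q s <= u s.
Proof.
move=> pd; apply/andP; split; first by apply: sumr_ge0.
rewrite degree_count_pred_open // -sumr_const; apply: ler_sum => v _.
by case: eqP => _; rewrite ?ler01.
Qed.

(** The bias [r / u] gathers the pairs that are not available and the second
    order effect of the clock increment [2 / u]. *)
Lemma balance_mean q s l (Theta : R) : (q.+1 < d)%N ->
  reachable d s -> size s = l -> early l -> clock s + d%:R <= Theta ->
  exists2 r : R, `|r| <= (4 * d%:R + 4) * Theta &
  step_mean d (graph_of s) (fun e => balance q.+1 (rcons s e))
  = (1 - 2 / u s) * balance q.+1 s + (2 / u s) * balance q s + r / u s.
Proof.
move=> qd rs sl hl hT.
have [_ _ u2d] := open_bounds rs sl hl; have up := u_gt0 rs sl hl.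
have und : (2 * d <= #|U s|)%N by rewrite -(ler_nat R) natrM.
have d2 : (2 : R) <= d%:R by rewrite ler_nat.
have qdR : q.+2%:R <= d%:R :> R by rewrite ler_nat.
have T0 := clock_ge0 s.
have u21 : 2 / u s <= 1 by rewrite ler_pdivrMr // mul1r; lra.
have u20 : 0 <= 2 / u s by rewrite divr_ge0.
rewrite (eq_step_mean (fun e es => balance_rcons q.+1 es)).
set c := balance q.+1 s + 2 / u s * degree_count_pred q.+1 s.
have -> : step_mean d (graph_of s) (fun e => c + \sum_(v in e) zeta_jump s q.+1 v)
  = c + step_mean d (graph_of s) (fun e => \sum_(v in e) zeta_jump s q.+1 v).
  by rewrite (step_meanD _ _ (fun=> c)) step_mean_cst.
have jn v : `|zeta_jump s q.+1 v| <= Theta.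
  by apply: zeta_jump_norm; move: qdR; rewrite -natr1; lra.
have := step_mean_sum_approx d_gt0 und (zeta_jump s q.+1).
set m := step_mean _ _ _.
have sumj : \sum_(v in U s) `|zeta_jump s q.+1 v| <= Theta * u s.
  by rewrite mulr_natr -sumr_const; apply: ler_sum => v _.
move=> happ.
have {happ}happ : `|m - 2 / u s * \sum_(v in U s) zeta_jump s q.+1 v|
   <= 4 * d%:R * Theta / u s.
  apply: le_trans happ _.
  have -> : 4 * d%:R * Theta / u s = 4 * d%:R / u s ^+ 2 * (Theta * u s).
    by field; rewrite gt_eqF.
  by apply: ler_wpM2l => //; rewrite divr_ge0 ?exprn_ge0 ?mulr_ge0.
set T' := clock s + 2 / u s.
have drift : degree_count_pred q.+1 s + \sum_(v in U s) zeta_jump s q.+1 v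
   = statistic (zeta T' q) s - statistic (zeta T' q.+1) s.
  have -> : statistic (zeta T' q) s - statistic (zeta T' q.+1) s
     = statistic (fun i => zeta T' q i - zeta T' q.+1 i) s by rewrite /statistic -sumrB.
  rewrite -(@sum_open q.+1) //; last first.
    by move=> i qi; rewrite !zeta_eq0 ?subrr // ltnW.
  rewrite (degree_count_pred_open _ (ltnW qd)) -big_split /=; apply: eq_bigr => v _; exact: zeta_drift.
have T'E p : statistic (zeta T' p) s = balance p s + 2 / u s * degree_count_pred p s.
  rewrite /balance /degree_count_pred /statistic big_distrr -big_split /=.
  by apply: eq_bigr => v _; rewrite /zeta /T'; ring.
rewrite !T'E in drift.
have /andP[n1 n2] := degree_count_pred_bounds s (ltnW (ltnW qd)).
have /andP[n3 n4] := degree_count_pred_bounds s (ltnW qd).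
exists (u s * (m - 2 / u s * \sum_(v in U s) zeta_jump s q.+1 v)
   + 4 / u s * (degree_count_pred q s - degree_count_pred q.+1 s)).
  apply: le_trans (ler_normD _ _) _; rewrite normrM (gtr0_norm up).
  rewrite [(4 * d%:R + 4) * Theta]mulrDl; apply: lerD.
    by rewrite mulrC -ler_pdivlMr.
  rewrite normrM ger0_norm ?divr_ge0 //.
  have hn : `|degree_count_pred q s - degree_count_pred q.+1 s| <= u s.
    by rewrite ler_norml; apply/andP; split; lra.
  apply: le_trans (ler_wpM2l _ hn) _; first by rewrite divr_ge0.
  rewrite divfK ?gt_eqF //; lra.
rewrite /c.
have -> : \sum_(v in U s) zeta_jump s q.+1 v =
  (balance q s + 2 / u s * degree_count_pred q s -
        (balance q.+1 s + 2 / u s * degree_count_pred q.+1 s)) - degree_count_pred q.+1 s.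
  by rewrite -drift; ring.
by field; rewrite gt_eqF.
Qed.

Lemma step_mean_square_le s (f : {set 'I_n} -> R) (c B : R) :
  (2 * d <= #|U s|)%N ->
  (forall e, e \in moves d s -> (f e - c) ^+ 2 <= B) ->
  step_mean d (graph_of s) (fun e => f e ^+ 2)
    <= step_mean d (graph_of s) f ^+ 2 + B.
Proof.
move=> und h; set m := step_mean _ _ f.
have : step_mean d (graph_of s) (fun e => (f e - c) ^+ 2) <= B.
  rewrite -(step_mean_cst d_gt0 und B); exact: ler_step_mean.
have -> : step_mean d (graph_of s) (fun e => (f e - c) ^+ 2)
  = step_mean d (graph_of s) (fun e => f e ^+ 2) + (c ^+ 2 - 2 * c * m).
  rewrite (@eq_step_mean _ _ _ _ _ ((fun e => f e ^+ 2) \+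
     ((fun=> c ^+ 2) \+ (fun e => - (2 * c) * f e)))); last by move=> e _ /=; ring.
  by rewrite !step_meanD step_mean_cst // step_meanZ mulNr.
have := sqr_ge0 (m - c); lra.
Qed.

Definition noise : R := 16 * (4 * d%:R + 4) ^+ 2 + 4.

Lemma balance_square_mean q s l (Theta : R) : (q.+1 < d)%N ->
  reachable d s -> size s = l -> early l -> clock s + d%:R <= Theta ->
  step_mean d (graph_of s) (fun e => balance q.+1 (rcons s e) ^+ 2)
  <= (1 - 5 / 2 / deficit l) * balance q.+1 s ^+ 2
     + 16 * d%:R / deficit l * balance q s ^+ 2 + noise * Theta ^+ 2.
Proof.
move=> qd rs sl hl hT.
have [ua au u2d] := open_bounds rs sl hl; have up := u_gt0 rs sl hl.
have ap := early_deficit_gt0 hl.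
have und : (2 * d <= #|U s|)%N by rewrite -(ler_nat R) natrM.
have d2 : (2 : R) <= d%:R by rewrite ler_nat.
have T0 := clock_ge0 s.
have [r hr mean] := balance_mean qd rs sl hl hT.
have qdR : q.+2%:R <= d%:R :> R by rewrite ler_nat.
have u21 : 2 / u s <= 1 by rewrite ler_pdivrMr // mul1r; lra.
set a := deficit l in ua au ap *.
apply: le_trans (@step_mean_square_le _ _ (balance q.+1 s + 2 / u s * degree_count_pred q.+1 s)
   ((2 * Theta) ^+ 2) und _) _.
  move=> e es; rewrite balance_rcons // addrAC subrr add0r.
  rewrite -real_normK ?num_real // ler_sqr ?nnegrE ?normr_ge0 //; last by lra.
  apply: le_trans (ler_norm_sum _ _ _) _.
  have e2 : #|e| = 2%N by move: es; rewrite inE => /andP[/eqP].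
  rewrite mulr_natl -[2%N]e2 -sumr_const; apply: ler_sum => v _.
  by apply: zeta_jump_norm; move: qdR; rewrite -natr1; lra.
rewrite mean; set x := balance q.+1 s; set y := balance q s.
set h := (u s)^-1.
have h0 : 0 < h by rewrite invr_gt0.
have h3 : 3 * h <= 1 by rewrite ler_pdivrMr // mul1r; lra.
have -> : (1 - 2 * h) * x + 2 * h * y + r * h = (1 - 2 * h) * x + h * (2 * y + r).
  by ring.
apply: le_trans (lerD (square_bias_le _ _ (ltW h0) h3) (lexx _)) _.
have hle : h <= d%:R / a.
  by rewrite ler_pdivlMr // mulrC ler_pdivrMr // .
have hge : a^-1 <= h by rewrite lef_pV2 ?posrE.
have r2 : r ^+ 2 <= ((4 * d%:R + 4) * Theta) ^+ 2.
  by rewrite -real_normK ?num_real // ler_sqr ?nnegrE ?normr_ge0 // mulr_ge0 //; lra.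
have yr : (2 * y + r) ^+ 2 <= 8 * y ^+ 2 + 2 * r ^+ 2.
  have := sqr_ge0 (2 * y - r); lra.
have t1 : (1 - 5 / 2 * h) * x ^+ 2 <= (1 - 5 / 2 / a) * x ^+ 2.
  by apply: ler_wpM2r; [exact: sqr_ge0|lra].
have t2 : 2 * h * (2 * y + r) ^+ 2 <= 16 * d%:R / a * y ^+ 2 + 4 * r ^+ 2.
  apply: le_trans (ler_wpM2l _ yr) _; first by rewrite mulr_ge0 ?ltW.
  have := sqr_ge0 y; have := sqr_ge0 r.
  set Y := y ^+ 2; set S := r ^+ 2 => S0 Y0.
  have hY : h * Y <= d%:R / a * Y by apply: ler_wpM2r.
  have hS : h * S <= S by rewrite ler_piMl //; lra.
  have -> : 2 * h * (8 * Y + 2 * S) = 16 * (h * Y) + 4 * (h * S) by ring.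
  have -> : 16 * d%:R / a * Y = 16 * (d%:R / a * Y) by ring.
  lra.
have := sqr_ge0 Theta; move: r2; rewrite /noise exprMn; set S := Theta ^+ 2.
have -> : (2 * Theta) ^+ 2 = 4 * S by rewrite /S; ring.
set D := (4 * d%:R + 4) ^+ 2; have D0 : 0 <= D by exact: sqr_ge0.
move=> r2 S0; have DS : 0 <= D * S by exact: mulr_ge0.
lra.
Qed.

Fixpoint balance_const (q : nat) : R :=
  if q is q'.+1 then 2 * (16 * d%:R * balance_const q' + noise) else 0.

Lemma noise_gt0 : 0 < noise.
Proof. by rewrite /noise ltr_wpDl // mulr_ge0 // sqr_ge0. Qed.

Lemma balance_const_ge0 q : 0 <= balance_const q.
Proof.
elim: q => //= q IH; have := noise_gt0 => h.
by rewrite mulr_ge0 // addr_ge0 ?mulr_ge0 // ltW.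
Qed.

(** The square contracts by [1 - 5 / (2 * deficit)] at each step while the
    deficit only loses a factor [1 - 2 / deficit]; the difference absorbs the
    noise and the influence of the previous balance. *)
Lemma balance_second_moment q l (Theta : R) : (q < d)%N -> early l ->
  (forall s, reachable d s -> (size s <= l)%N -> clock s + d%:R <= Theta) ->
  expect d l (fun s => balance q s ^+ 2)
    <= balance_const q * Theta ^+ 2 * deficit l.
Proof.
elim: q l => [|q IHq] l qd hl hT.
  rewrite (@eq_expect _ _ _ _ _ (fun=> 0)) ?expect0 /= ?mul0r //.
  by move=> s _ _; rewrite balance0 expr0n.
elim: l hl hT => [|l IHl] hl hT.
  rewrite /= balanceE clock_nil mul0r sub0r sqrrN /degree_count /statistic big1; last first.
    by move=> v _; rewrite degree_nil.
  rewrite mulr0 expr0n /= -/(balance_const q.+1).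
  by rewrite mulr_ge0 ?(ltW (early_deficit_gt0 hl)) // mulr_ge0 ?sqr_ge0 // balance_const_ge0.
have hl' : early l by apply: earlyW hl.
have ap := early_deficit_gt0 hl'.
have hT' s : reachable d s -> (size s <= l)%N -> clock s + d%:R <= Theta.
  by move=> rs sl; apply: hT => //; apply: leqW.
have E1 := IHl hl' hT'; have E2 := IHq _ (ltnW qd) hl' hT'.
rewrite expectS.
apply: le_trans (_ : expect d l (fun s => (1 - 5 / 2 / deficit l) * balance q.+1 s ^+ 2
     + 16 * d%:R / deficit l * balance q s ^+ 2 + noise * Theta ^+ 2) <= _).
  apply: ler_expect => s rs sl; apply: balance_square_mean => //.
  by apply: hT'; rewrite ?sl.
rewrite !expectD !expectZ expect_const //.
have a5 : 0 <= 1 - 5 / 2 / deficit l.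
  rewrite subr_ge0 ler_pdivrMr // mul1r.
  have := early_deficit hl'; have : (2 : R) <= d%:R by rewrite ler_nat.
  by move=> ? ?; nra.
apply: le_trans (lerD (lerD (ler_wpM2l a5 E1) (ler_wpM2l _ E2)) (lexx _)) _.
  by rewrite divr_ge0 ?mulr_ge0 // ltW.
rewrite deficitS.
have -> : (1 - 5 / 2 / deficit l) * (balance_const q.+1 * Theta ^+ 2 * deficit l)
  = balance_const q.+1 * Theta ^+ 2 * deficit l - 5 / 2 * balance_const q.+1 * Theta ^+ 2.
  by field; rewrite gt_eqF.
have -> : 16 * d%:R / deficit l * (balance_const q * Theta ^+ 2 * deficit l)
   = 16 * d%:R * balance_const q * Theta ^+ 2 by field; rewrite gt_eqF.
rewrite -subr_ge0.
have -> : balance_const q.+1 * Theta ^+ 2 * (deficit l - 2) -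
   (balance_const q.+1 * Theta ^+ 2 * deficit l -
   5 / 2 * balance_const q.+1 * Theta ^+ 2 +
   16 * d%:R * balance_const q * Theta ^+ 2 + noise * Theta ^+ 2)
   = 0.
  by rewrite /=; field.
by [].
Qed.

End Clock.

(** * The clock follows the logarithm *)

Lemma norm_le_square (R : realType) (w x : R) : 0 < w -> `|x| <= x ^+ 2 / w + w.
Proof.
move=> w0; have : 0 <= (`|x| / w - 1) ^+ 2 * w + `|x|.
  by rewrite addr_ge0 // mulr_ge0 ?sqr_ge0 // ltW.
have -> : (`|x| / w - 1) ^+ 2 * w = `|x| ^+ 2 / w - 2 * `|x| + w.
  by field; rewrite gt_eqF.
rewrite real_normK ?num_real //; lra.
Qed.

Section FirstPhase.
Variables (R : realType) (d n : nat).
Hypothesis d_ge2 : (2 <= d)%N.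
Implicit Types (s : seq {set 'I_n}) (e : {set 'I_n}) (v : 'I_n).

Local Notation u s := (#|opens d s|%:R : R).
Local Notation deficitR := (deficit R d n).
Local Notation earlyN := (early d n).
Local Notation clock := (@clock R d n).
Local Notation balance := (@balance R d n).
Local Notation degree_count := (@degree_count R n).
Local Notation K := (@balance_const R d).
Local Notation belowR q s := ((below q s)%:R : R).

Let d_gt0 : (0 < d)%N. Proof. by apply: leq_trans d_ge2. Qed.
Let d2R : (2 : R) <= d%:R. Proof. by rewrite ler_nat. Qed.

(** What the clock would read if every open vertex lacked exactly one edge. *)
Definition mean_clock (l : nat) : R := \sum_(i < l) 2 / deficitR i.

Lemma mean_clockS l : mean_clock l.+1 = mean_clock l + 2 / deficitR l.
Proof. by rewrite /mean_clock big_ord_recr. Qed.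

Lemma early_ltn l : earlyN l.+1 -> earlyN l.
Proof. exact: earlyW. Qed.

Lemma early_deficit_ge8 l : earlyN l -> 8 <= deficitR l.
Proof. move=> /(early_deficit R d_ge2); have := d2R => ? ?; nra. Qed.

Lemma mean_clock_le l : earlyN l -> mean_clock l <= ln (d * n)%:R - ln (deficitR l).
Proof.
elim: l => [|l IH] hl.
  by rewrite /mean_clock big_ord0 /deficit mulr0 subr0 subrr.
have hl' := early_ltn hl; have := IH hl'; have a8 := early_deficit_ge8 hl'.
have := @ln_step_le R (deficitR l); rewrite mean_clockS deficitS => /(_ _).
have a2 : 2 < deficitR l by lra.
move=> /(_ a2); lra.
Qed.

Lemma mean_clock_ge l : earlyN l ->
  ln (d * n)%:R - ln (deficitR l + 2) <= mean_clock l.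
Proof.
elim: l => [|l IH] hl.
  have := early_deficit_ge8 hl; rewrite /mean_clock big_ord0 /deficit mulr0 subr0 => h.
  rewrite subr_le0 ler_ln ?posrE; lra.
have hl' := early_ltn hl; have := IH hl'; have a8 := early_deficit_ge8 hl'.
rewrite mean_clockS deficitS subrK.
have : ln ((deficitR l + 2) / deficitR l) <= 2 / deficitR l.
  have -> : (deficitR l + 2) / deficitR l = 1 + 2 / deficitR l by field; rewrite gt_eqF //; lra.
  by apply: le_ln1Dx; apply: lt_le_trans (_ : 0 <= _); rewrite ?divr_ge0 //; lra.
rewrite ln_div ?posrE; lra.
Qed.

Definition slack s : R := clock s - mean_clock (size s).

Lemma slack_rcons s e :
  slack (rcons s e) = slack s + (2 / u s - 2 / deficitR (size s)).
Proof. by rewrite /slack clock_rcons size_rcons mean_clockS; ring. Qed.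

Lemma slack_bounds s l : reachable d s -> size s = l -> earlyN l ->
  0 <= slack s <= clock s.
Proof.
move=> rs sl hl; rewrite /slack; apply/andP; split; last first.
  rewrite lerBlDr lerDl; apply: sumr_ge0 => i _; rewrite divr_ge0 //.
  apply/ltW/(early_deficit_gt0 R d_ge2); apply: earlyW hl => //; rewrite -sl.
  exact: ltnW.
elim: rs l sl hl => [|{}s e rs IH es] l.
  by rewrite clock_nil /mean_clock big_ord0 subrr.
rewrite size_rcons => <- hl; have hs := early_ltn hl.
have [h1 _ _] := open_bounds R d_ge2 rs erefl hs.
have := IH _ erefl hs; rewrite clock_rcons mean_clockS.
have : 2 / deficitR (size s) <= 2 / u s.
  by rewrite ler_wpM2l // lef_pV2 ?posrE ?(u_gt0 R d_ge2 rs erefl hs) ?(early_deficit_gt0 R d_ge2 hs).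
lra.
Qed.

Lemma balance_countE q s :
  clock s * degree_count q s = q.+1%:R * degree_count q.+1 s + balance q.+1 s.
Proof.
rewrite balanceE; have -> : degree_count_pred R q.+1 s = degree_count q s by [].
by ring.
Qed.

Lemma degree_count_ge0 q s : 0 <= degree_count q s.
Proof. by apply: sumr_ge0 => v _; rewrite ler0n. Qed.

Lemma degree_count_sum q s : belowR q s = \sum_(i < q) degree_count i s.
Proof.
rewrite exchange_big /= /below -sum1_card natr_sum big_mkcond /=.
apply: eq_bigr => v _; rewrite inE; case: ltnP => h.
  rewrite (bigD1 (Ordinal h)) //= eqxx big1 ?addr0 // => i ih.
  by case: eqP => // e; case/eqP: ih; apply: val_inj.
by rewrite big1 // => i _; rewrite gtn_eqF // (leq_trans (ltn_ord i)).
Qed.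

Lemma degree_count_le_open q s : (q < d)%N -> degree_count q s <= u s.
Proof. by move=> /(degree_count_pred_bounds R d_ge2 (q := q.+1) s)/andP[]. Qed.

(** Sum of the balance equations [balance_countE]: each count times the clock is
    at most [d] times the next count, up to its balance. *)
Lemma clock_below s :
  clock s * belowR d.-1 s <= d%:R * u s + \sum_(q < d.-1) `|balance q.+1 s|.
Proof.
rewrite degree_count_sum big_distrr /=.
under eq_bigr do rewrite balance_countE.
rewrite big_split /=; apply: lerD; last first.
  by apply: ler_sum => q _; exact: ler_norm.
apply: le_trans (_ : \sum_(q < d.-1) d%:R * degree_count q.+1 s <= _).
  apply: ler_sum => q _; rewrite ler_wpM2r ?degree_count_ge0 // ler_nat.
  by rewrite (leq_trans (ltn_ord q)) // leq_pred.
rewrite -big_distrr /= ler_wpM2l //.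
rewrite -(below_full d s) degree_count_sum.
rewrite [leRHS](_ : _ = \sum_(i < d.-1.+1) degree_count i s); last by rewrite prednK.
by rewrite [leRHS]big_ord_recl /= lerDr degree_count_ge0.
Qed.

Lemma balance_mean_norm q l (Theta : R) w : (q < d)%N -> earlyN l ->
  (forall s, reachable d s -> (size s <= l)%N -> clock s + d%:R <= Theta) ->
  0 < w ->
  expect d l (fun s => `|balance q s|) <= K q * Theta ^+ 2 * deficitR l / w + w.
Proof.
move=> qd hl hT w0; have h := balance_second_moment d_ge2 qd hl hT.
apply: le_trans (_ : expect d l (fun s => w^-1 * balance q s ^+ 2 + w) <= _).
  by apply: ler_expect => s _ _; rewrite mulrC norm_le_square.
rewrite expectD expectZ (expect_const d_ge2) //.
by rewrite lerD2r mulrC ler_pM2r // invr_gt0.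
Qed.

Definition balance_total : R := \sum_(q < d.-1) (K q.+1 + 1).

Lemma balance_total_ge0 : 0 <= balance_total.
Proof. by apply: sumr_ge0 => q _; rewrite addr_ge0 // balance_const_ge0. Qed.

Lemma balance_const_le q : (0 < q < d)%N -> K q + 1 <= balance_total.
Proof.
case: q => // q /= qd; have qd' : (q < d.-1)%N by rewrite -ltnS prednK.
rewrite /balance_total (bigD1 (Ordinal qd')) // [nat_of_ord (Ordinal qd')]/= lerDl.
by apply: sumr_ge0 => i _; rewrite addr_ge0 // balance_const_ge0.
Qed.

Lemma deficit_le l l' : (l <= l')%N -> deficitR l' <= deficitR l.
Proof. by move=> h; rewrite /deficit lerD2l lerN2 ler_wpM2l // ler_nat. Qed.

Definition slack_const : R := 8 * d%:R ^+ 2 * (1 + balance_total).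

(** The slack grows in proportion to the number of vertices of degree below
    [d - 1], which is not small in itself; but the growth of its square is at
    most twice that increment times the clock, which [clock_below] controls. *)
Lemma slack_second_moment l (Theta : R) : earlyN l ->
  (forall s, reachable d s -> (size s <= l)%N -> clock s + d%:R <= Theta) ->
  Theta ^+ 2 <= deficitR l ->
  expect d l (fun s => slack s ^+ 2) <= slack_const * mean_clock l.
Proof.
move=> hl hT hTa.
suff main l' : (l' <= l)%N -> expect d l' (fun s => slack s ^+ 2) <= slack_const * mean_clock l'.
  exact: main.
elim: l' => [|l' IH] ll.
  by rewrite /= /slack clock_nil /mean_clock big_ord0 subrr expr0n mulr0.
have e' : earlyN l' := earlyW (ltnW ll) hl.
have hT' s : reachable d s -> (size s <= l')%N -> clock s + d%:R <= Theta.
  by move=> rs sl; apply: hT => //; apply: leq_trans sl _; exact: ltnW ll.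
have ap := early_deficit_gt0 R d_ge2 e'; have a8 := early_deficit_ge8 e'.
have hTa' : Theta ^+ 2 <= deficitR l' by apply: le_trans hTa (deficit_le _); exact: ltnW ll.
rewrite expectS mean_clockS mulrDr; set a := deficitR l' in ap a8 hTa' *.
apply: le_trans (_ : expect d l' (fun s => slack s ^+ 2 +
   (8 * d%:R ^+ 2 / a + 4 * d%:R ^+ 2 / a ^+ 2 * \sum_(q < d.-1) `|balance q.+1 s|)) <= _).
  apply: ler_expect => s rs sl.
  have [ua au u2d] := open_bounds R d_ge2 rs sl e'; have up := u_gt0 R d_ge2 rs sl e'.
  have und : (2 * d <= #|opens d s|)%N by rewrite -(ler_nat R) natrM.
  rewrite -/a in ua au.
  under eq_step_mean do rewrite slack_rcons sl.
  rewrite step_mean_cst // -/a.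
  have /andP[D0 DT] := slack_bounds rs sl e'.
  set x := 2 / u s - 2 / a.
  have x0 : 0 <= x by rewrite subr_ge0 ler_wpM2l // lef_pV2 ?posrE.
  have xa : x <= 2 * d%:R / a.
    apply: le_trans (_ : 2 / u s <= _); first by rewrite gerBl divr_ge0 // ltW.
    by rewrite ler_pdivrMr // mulrAC ler_pdivlMr // -mulrA ler_wpM2l.
  have aub : a - u s <= d%:R * belowR d.-1 s.
    have := deficit_le_below rs; rewrite -(ler_nat R) natrD natrM sl.
    by rewrite -deficit_natr ?early_size // -/a; lra.
  have xN : x <= 2 * d%:R / (u s * a) * belowR d.-1 s.
    have -> : x = 2 / (u s * a) * (a - u s) by rewrite /x; field; rewrite !gt_eqF.
    have -> : 2 * d%:R / (u s * a) * belowR d.-1 s = 2 / (u s * a) * (d%:R * belowR d.-1 s).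
      by ring.
    by rewrite ler_wpM2l // divr_ge0 // mulr_ge0 // ltW.
  have Tx : clock s * x <= 2 * d%:R ^+ 2 / a + 2 * d%:R ^+ 2 / a ^+ 2 * \sum_(q < d.-1) `|balance q.+1 s|.
    have S0 : 0 <= \sum_(q < d.-1) `|balance q.+1 s| by apply: sumr_ge0.
    apply: le_trans (ler_wpM2l (clock_ge0 R d s) xN) _.
    rewrite mulrCA; apply: le_trans (ler_wpM2l _ (clock_below s)) _.
      by rewrite divr_ge0 ?mulr_ge0 // ltW.
    set S := \sum_(q < _) _ in S0 *.
    have -> : 2 * d%:R / (u s * a) * (d%:R * u s + S)
      = 2 * d%:R ^+ 2 / a + 2 * d%:R / a * ((u s)^-1 * S) by field; rewrite !gt_eqF.
    rewrite lerD2l.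
    have -> : 2 * d%:R ^+ 2 / a ^+ 2 * S = 2 * d%:R / a * (d%:R / a * S).
      by field; rewrite gt_eqF.
    apply: ler_wpM2l; first by rewrite divr_ge0 ?mulr_ge0 // ltW.
    apply: ler_wpM2r => //.
    by rewrite ler_pdivlMr // mulrC ler_pdivrMr.
  have x2 : x ^+ 2 <= 4 * d%:R ^+ 2 / a.
    apply: le_trans (_ : (2 * d%:R / a) ^+ 2 <= _).
      by rewrite ler_sqr ?nnegrE // divr_ge0 ?mulr_ge0 // ltW.
    have -> : (2 * d%:R / a) ^+ 2 = 4 * d%:R ^+ 2 / a * a^-1 by field; rewrite gt_eqF.
    rewrite ler_piMr ?divr_ge0 ?mulr_ge0 ?exprn_ge0 // ?ltW //.
    by rewrite invf_lt1 //; lra.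
  have Dx : slack s * x <= clock s * x by exact: ler_wpM2r.
  set S := \sum_(q < _) _ in Tx *.
  have -> : (slack s + x) ^+ 2 = slack s ^+ 2 + (2 * (slack s * x) + x ^+ 2) by ring.
  rewrite lerD2l.
  have -> : 8 * d%:R ^+ 2 / a + 4 * d%:R ^+ 2 / a ^+ 2 * S =
    2 * (2 * d%:R ^+ 2 / a + 2 * d%:R ^+ 2 / a ^+ 2 * S) + 4 * d%:R ^+ 2 / a by ring.
  by apply: lerD => //; rewrite ler_wpM2l // (le_trans Dx).
rewrite !expectD (expectZ d l' (4 * d%:R ^+ 2 / a ^+ 2)) (expect_const d_ge2) //.
have -> : expect d l' (fun s => \sum_(q < d.-1) `|balance q.+1 s|)
  = \sum_(q < d.-1) expect d l' (fun s => `|balance q.+1 s|).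
  exact: (@expect_sum d n R l' _ _ _ (fun (q : 'I_d.-1) s => `|balance q.+1 s|)).
apply: lerD; first exact: IH (ltnW ll).
have S : \sum_(q < d.-1) expect d l' (fun s => `|balance q.+1 s|) <= balance_total * a.
  rewrite /balance_total big_distrl /=; apply: ler_sum => q _.
  have qd : (q.+1 < d)%N by have := ltn_ord q; rewrite -ltnS prednK.
  apply: le_trans (balance_mean_norm qd e' hT' ap) _.
  rewrite -/a -mulrA divff ?gt_eqF // mulr1 mulrDl mul1r lerD2r.
  by rewrite ler_wpM2l // balance_const_ge0.
apply: le_trans (lerD (lexx _) (ler_wpM2l _ S)) _.
  by rewrite divr_ge0 ?mulr_ge0 ?exprn_ge0 // ltW.
rewrite /slack_const.
have -> : 8 * d%:R ^+ 2 * (1 + balance_total) * (2 / a) =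
  8 * d%:R ^+ 2 / a + 4 * d%:R ^+ 2 / a ^+ 2 * (balance_total * a)
  + (8 * d%:R ^+ 2 / a + 12 * d%:R ^+ 2 / a * balance_total).
  by field; rewrite gt_eqF.
have c0 c : 0 <= c -> 0 <= c * d%:R ^+ 2 / a.
  by move=> ?; rewrite divr_ge0 ?mulr_ge0 ?exprn_ge0 // ltW.
rewrite lerDl; apply: addr_ge0; first exact: c0.
by apply: mulr_ge0; [exact: c0|exact: balance_total_ge0].
Qed.

End FirstPhase.

(** * Degrees at the end of the first phase *)

Lemma expr_dist_le (R : realType) (M x y : R) k :
  0 <= x <= M -> 0 <= y <= M ->
  `|x ^+ k.+1 - y ^+ k.+1| <= k.+1%:R * M ^+ k * `|x - y|.
Proof.
move=> /andP[x0 xM] /andP[y0 yM]; have M0 : 0 <= M by exact: le_trans xM.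
elim: k => [|k IH]; first by rewrite !expr1 expr0 !mul1r.
have -> : x ^+ k.+2 - y ^+ k.+2 = x * (x ^+ k.+1 - y ^+ k.+1) + (x - y) * y ^+ k.+1.
  by rewrite !exprS; ring.
apply: le_trans (ler_normD _ _) _; rewrite !normrM (ger0_norm x0).
have -> : k.+2%:R * M ^+ k.+1 * `|x - y|
   = M * (k.+1%:R * M ^+ k * `|x - y|) + `|x - y| * M ^+ k.+1.
  by rewrite -[k.+2%:R]natr1 exprS; ring.
apply: lerD; first by apply: ler_pM.
by rewrite ler_wpM2l // ger0_norm ?exprn_ge0 // lerXn2r ?nnegrE.
Qed.

Lemma mulr_le_squares (R : realType) (w x y : R) : 0 < w ->
  x * y <= w * x ^+ 2 + y ^+ 2 / w.
Proof.
move=> w0; have h : 0 <= w * (x - y / w) ^+ 2 by rewrite mulr_ge0 ?sqr_ge0 // ltW.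
have h2 : 0 <= w * x ^+ 2 + y ^+ 2 / w.
  by apply: addr_ge0; [rewrite mulr_ge0 ?sqr_ge0 // ltW|rewrite divr_ge0 ?sqr_ge0 // ltW].
have : w * (x - y / w) ^+ 2 = w * x ^+ 2 + y ^+ 2 / w - 2 * (x * y).
  by field; rewrite gt_eqF.
lra.
Qed.

Section FirstPhaseEnd.
Variables (R : realType) (d n : nat).
Hypothesis d_ge2 : (2 <= d)%N.
Implicit Types (s : seq {set 'I_n}) (e : {set 'I_n}) (v : 'I_n).

Local Notation u s := (#|opens d s|%:R : R).
Local Notation clock := (@clock R d n).
Local Notation balance := (@balance R d n).
Local Notation count q s := (degree_count R q s).
Local Notation belowR q s := ((below q s)%:R : R).
Local Notation K := (@balance_const R d).
Local Notation total := (balance_total R d).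

Variables (l : nat) (L : R).
Local Notation a := (deficit R d n l).
Local Notation Theta := (3 * d%:R * L).
Local Notation tau := (mean_clock R d n l).

Hypothesis hl : early d n l.
Hypothesis L_ge1 : 1 <= L.
Hypothesis clock_bound :
  forall s, reachable d s -> (size s <= l)%N -> clock s + d%:R <= Theta.
Hypothesis a_large : Theta ^+ (2 * d + 6) <= a.
Hypothesis tau_ge : L / 2 <= tau.
Hypothesis tau_approx : (tau - L) ^+ 2 <= L.

Let d_gt0 : (0 < d)%N. Proof. by apply: leq_trans d_ge2. Qed.
Let d2R : (2 : R) <= d%:R. Proof. by rewrite ler_nat. Qed.
Let L0 : 0 < L. Proof. exact: lt_le_trans L_ge1. Qed.
Let LT : L <= Theta. Proof. by have := d2R; have := L_ge1 => ? ?; nra. Qed.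
Let T1 : 1 <= Theta. Proof. exact: le_trans LT. Qed.
Let T0 : 0 < Theta. Proof. exact: lt_le_trans T1. Qed.
Let a0 : 0 < a. Proof. by apply: lt_le_trans a_large; rewrite exprn_gt0. Qed.

Let pow_le_a m : (m <= 2 * d + 6)%N -> Theta ^+ m <= a.
Proof. by move=> h; apply: le_trans a_large; rewrite ler_weXn2l. Qed.

Lemma clock_ge_half s : reachable d s -> size s = l -> L / 2 <= clock s.
Proof.
move=> rs sl; have := slack_bounds R d_ge2 rs sl hl; rewrite /slack sl => /andP[h _].
by have := tau_ge; lra.
Qed.

Lemma clock_second_moment :
  expect d l (fun s => (clock s - L) ^+ 2) <= (4 * slack_const R d + 2) * L.
Proof.
have T2 : Theta ^+ 2 <= a.
  by apply: pow_le_a; exact: leq_trans (isT : (2 <= 6)%N) (leq_addl _ _).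
have sl := slack_second_moment d_ge2 hl clock_bound T2.
apply: le_trans (_ : expect d l (fun s => 2 * (slack R d s) ^+ 2 + 2 * (tau - L) ^+ 2) <= _).
  apply: ler_expect => s rs <-; rewrite /slack.
  set x := clock s; set y := mean_clock _ _ _ _.
  by have := sqr_ge0 (x - y - (y - L)); lra.
rewrite expectD expectZ (expect_const d_ge2) //.
have t2 : tau <= 2 * L.
  rewrite -subr_ge0; have := tau_approx; have := L_ge1.
  set t := tau => ? h; rewrite leNgt; apply/negP => h'.
  by nra.
have c0 : 0 <= slack_const R d.
  by rewrite /slack_const mulr_ge0 ?mulr_ge0 ?exprn_ge0 // addr_ge0 ?balance_total_ge0.
have := ler_wpM2l c0 t2; have := tau_approx; lra.
Qed.

Fixpoint count_const (i : nat) : R :=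
  if i is i'.+1 then 8 * (d%:R ^+ 2 * count_const i' + total) else 1.

Lemma count_const_ge0 i : 0 <= count_const i.
Proof.
elim: i => //= i IH; rewrite mulr_ge0 // addr_ge0 ?balance_total_ge0 //.
by rewrite mulr_ge0 // exprn_ge0.
Qed.

Lemma balance_second_moment_total q : (q.+1 < d)%N ->
  expect d l (fun s => balance q.+1 s ^+ 2) <= total * Theta ^+ 2 * a.
Proof.
move=> qd; apply: le_trans (balance_second_moment d_ge2 qd hl clock_bound) _.
rewrite ler_wpM2r ?(ltW a0) // ler_wpM2r ?sqr_ge0 //.
have /(balance_const_le R d_ge2) : (0 < q.+1 < d)%N by [].
lra.
Qed.

(** The clock is at least [L / 2], so the balance equation makes each degree
    down cost a factor of order [1 / L]; the balances are negligible because the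
    deficit exceeds a large power of [L]. *)
Lemma count_second_moment i : (i < d)%N ->
  expect d l (fun s => count (d - 1 - i)%N s ^+ 2) <= count_const i * (a / L ^+ i) ^+ 2.
Proof.
elim: i => [|i IH] id.
  rewrite /= expr0 divr1 mul1r -[leRHS](@expect_const R d n d_ge2 l _ hl).
  apply: ler_expect => s rs sl.
  rewrite ler_sqr ?nnegrE ?degree_count_ge0 ?(ltW a0) //.
  have [ua _ _] := open_bounds R d_ge2 rs sl hl.
  by apply: le_trans ua; apply: degree_count_le_open => //; rewrite subn0 subn1 prednK.
have q1 : (d - 1 - i = (d - 1 - i.+1).+1)%N by rewrite -subnSK // !subn1 -ltnS prednK.
have {}IH := IH (ltnW id); rewrite q1 in IH; set q := (d - 1 - i.+1)%N in IH q1 *.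
have qd : (q.+1 < d)%N.
  by rewrite -q1 (leq_ltn_trans (leq_subr _ _)) // subn1 prednK.
apply: le_trans (_ : expect d l (fun s => 8 / L ^+ 2 *
   (d%:R ^+ 2 * count q.+1 s ^+ 2 + balance q.+1 s ^+ 2)) <= _).
  apply: ler_expect => s rs sl; have hc := clock_ge_half rs sl.
  have c0 := degree_count_ge0 R q s; have c1 := degree_count_ge0 R q.+1 s.
  have b := balance_countE R d q s.
  have : count q s <= 2 / L * (d%:R * count q.+1 s + `|balance q.+1 s|).
    rewrite mulrAC ler_pdivlMr // mulrC.
    have : L / 2 * count q s <= clock s * count q s by exact: ler_wpM2r.
    rewrite b; have := ler_norm (balance q.+1 s).
    have : q.+1%:R * count q.+1 s <= d%:R * count q.+1 s.
      by rewrite ler_wpM2r // ler_nat ltnW.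
    lra.
  set X := count q s in c0 *; set Y := count q.+1 s in c1 *; set Z := `|_| => h.
  have -> : balance q.+1 s ^+ 2 = Z ^+ 2 by rewrite /Z real_normK ?num_real.
  apply: le_trans (_ : (2 / L * (d%:R * Y + Z)) ^+ 2 <= _).
    rewrite ler_sqr ?nnegrE ?mulr_ge0 ?invr_ge0 ?(ltW L0) //.
    by rewrite addr_ge0 ?mulr_ge0 ?normr_ge0.
  rewrite exprMn exprMn exprVn -subr_ge0.
  have -> : 8 / L ^+ 2 * (d%:R ^+ 2 * Y ^+ 2 + Z ^+ 2) -
     2 ^+ 2 * (L ^+ 2)^-1 * (d%:R * Y + Z) ^+ 2 = 4 / L ^+ 2 * (d%:R * Y - Z) ^+ 2.
    by field; rewrite gt_eqF.
  by rewrite mulr_ge0 ?sqr_ge0 // divr_ge0 ?sqr_ge0.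
rewrite expectZ expectD expectZ.
have Z := balance_second_moment_total qd.
have TL : Theta ^+ 2 * a <= (a / L ^+ i) ^+ 2.
  rewrite expr_div_n ler_pdivlMr ?exprn_gt0 // mulrAC [leRHS]expr2 ler_wpM2r ?(ltW a0) //.
  apply: le_trans (_ : Theta ^+ 2 * Theta ^+ (i * 2) <= _).
    by rewrite -exprM ler_wpM2l ?sqr_ge0 // lerXn2r ?nnegrE // ltW.
  by rewrite -exprD; apply: pow_le_a; rewrite mulnC addnC leq_add // leq_mul // ltnW // ltnW.
apply: le_trans (_ : 8 / L ^+ 2 * (d%:R ^+ 2 * (count_const i * (a / L ^+ i) ^+ 2)
   + total * (a / L ^+ i) ^+ 2) <= _).
  apply: ler_wpM2l; first by rewrite divr_ge0 ?sqr_ge0.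
  apply: lerD; first by rewrite ler_wpM2l ?exprn_ge0.
  by apply: le_trans Z _; rewrite -mulrA ler_wpM2l // balance_total_ge0.
rewrite /= le_eqVlt; apply/orP; left; apply/eqP.
have : L ^+ i != 0 by rewrite expf_neq0 ?gt_eqF.
rewrite [L ^+ i.+1]exprS; set P := L ^+ i => P0.
by field; rewrite P0 gt_eqF.
Qed.

Fixpoint below_const (q : nat) : R :=
  if q is q'.+1 then 2 * below_const q' + 2 * count_const (d - 1 - q') else 0.

Lemma below_const_ge0 q : 0 <= below_const q.
Proof. by elim: q => //= q IH; rewrite addr_ge0 // mulr_ge0 // count_const_ge0. Qed.

Lemma belowS q s : belowR q.+1 s = belowR q s + count q s.
Proof. by rewrite !degree_count_sum big_ord_recr. Qed.

Lemma pow_div_anti i : a / L ^+ i.+1 <= a / L ^+ i.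
Proof.
rewrite ler_wpM2l ?(ltW a0) // lef_pV2 ?posrE ?exprn_gt0 //.
by rewrite exprS ler_peMl // exprn_ge0 // ltW.
Qed.

Lemma below_second_moment q : (q <= d)%N ->
  expect d l (fun s => belowR q s ^+ 2) <= below_const q * (a / L ^+ (d - q)) ^+ 2.
Proof.
elim: q => [|q IH] qd.
  rewrite (@eq_expect _ _ _ _ _ (fun=> 0)) ?expect0 /= ?mul0r // => s _ _.
  by rewrite below0 expr0n.
have {}IH := IH (ltnW qd).
have C : expect d l (fun s => count q s ^+ 2)
    <= count_const (d - 1 - q) * (a / L ^+ (d - q.+1)) ^+ 2.
  have -> : (d - q.+1 = d - 1 - q)%N by rewrite -subnDA add1n.
  have q1 : (q <= d - 1)%N by rewrite subn1 -ltnS prednK.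
  have := @count_second_moment (d - 1 - q); rewrite subKn //; apply.
  by rewrite (leq_ltn_trans (leq_subr _ _)) // subn1 prednK.
apply: le_trans (_ : expect d l (fun s => 2 * belowR q s ^+ 2 + 2 * count q s ^+ 2) <= _).
  apply: ler_expect => s _ _; rewrite belowS.
  by have := sqr_ge0 (belowR q s - count q s); lra.
rewrite expectD !expectZ [below_const q.+1]/=.
have := pow_div_anti (d - q.+1); rewrite subnSK // => an.
have : (a / L ^+ (d - q)) ^+ 2 <= (a / L ^+ (d - q.+1)) ^+ 2.
  by rewrite ler_sqr // nnegrE divr_ge0 ?exprn_ge0 ?(ltW a0) ?(ltW L0).
move/(ler_wpM2l (below_const_ge0 q)); lra.
Qed.

Lemma below_mean q : (q <= d)%N ->
  expect d l (fun s => belowR q s) <= (below_const q + 1) * (a / L ^+ (d - q)).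
Proof.
move=> qd; set w := a / _; have w0 : 0 < w by rewrite divr_gt0 ?exprn_gt0.
apply: le_trans (_ : expect d l (fun s => w^-1 * belowR q s ^+ 2 + w) <= _).
  apply: ler_expect => s _ _; apply: le_trans (ler_norm _) _.
  by rewrite mulrC norm_le_square.
rewrite expectD expectZ (expect_const d_ge2) // mulrDl mul1r lerD2r mulrC ler_pdivrMr //.
by rewrite -mulrA -expr2 below_second_moment.
Qed.

Fixpoint chain_const (k : nat) : R :=
  if k is k'.+1 then d%:R * chain_const k' + 1 else 0.

Lemma chain_const_ge0 k : 0 <= chain_const k.
Proof. by elim: k => //= k IH; rewrite addr_ge0 // mulr_ge0. Qed.

(** The balance equation iterated from degree [d - 1] downwards. *)
Lemma degree_chain k s : (k < d)%N -> reachable d s -> size s = l ->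
  `|clock s ^+ k * count (d - 1 - k)%N s - ((d - 1) ^_ k)%:R * count (d - 1)%N s|
  <= chain_const k * Theta ^+ k * \sum_(q < d.-1) `|balance q.+1 s|.
Proof.
move=> + rs sl; set S := \sum_(q < _) _.
have S0 : 0 <= S by apply: sumr_ge0.
have c0 := clock_ge0 R d s.
have cT : clock s <= Theta.
  by have := clock_bound rs (eq_leq sl); have := d2R; lra.
elim: k => [|k IH] kd.
  by rewrite subn0 expr0 !mul1r subrr normr0 !mul0r.
have {}IH := IH (ltnW kd).
have q1 : (d - 1 - k = (d - 1 - k.+1).+1)%N by rewrite -subnSK // !subn1 -ltnS prednK.
rewrite ffactnSr exprSr natrM.
rewrite q1 in IH *; set q := (d - 1 - k.+1)%N in IH q1 *.
have qd : (q < d.-1)%N by rewrite -ltnS prednK // -q1 (leq_ltn_trans (leq_subr _ _)) // subn1 prednK.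
rewrite -mulrA balance_countE.
have -> : clock s ^+ k * (q.+1%:R * count q.+1 s + balance q.+1 s) -
     ((d - 1) ^_ k)%:R * q.+1%:R * count (d - 1)%N s =
   q.+1%:R * (clock s ^+ k * count q.+1 s - ((d - 1) ^_ k)%:R * count (d - 1)%N s)
   + clock s ^+ k * balance q.+1 s by ring.
apply: le_trans (ler_normD _ _) _; rewrite !normrM.
rewrite ger0_norm // [`|clock s ^+ k|]ger0_norm ?exprn_ge0 //.
have TkS : Theta ^+ k <= Theta ^+ k.+1 by rewrite ler_weXn2l.
have -> : chain_const k.+1 * Theta ^+ k.+1 * S =
  d%:R * (chain_const k * Theta ^+ k.+1 * S) + Theta ^+ k.+1 * S by rewrite /=; ring.
apply: lerD; apply: ler_pM => //.
- by rewrite ler_nat; apply: leq_trans qd (leq_pred _).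
- by apply: le_trans IH _; rewrite ler_wpM2r // ler_wpM2l // chain_const_ge0.
- exact: exprn_ge0.
- by apply: le_trans TkS; rewrite lerXn2r ?nnegrE // ltW.
- rewrite /S (bigD1 (Ordinal qd)) // lerDl; exact: sumr_ge0.
Qed.

Lemma balance_sum_mean k : (k < d)%N ->
  expect d l (fun s => \sum_(q < d.-1) `|balance q.+1 s|)
  <= total * (a / Theta ^+ k.+1).
Proof.
move=> kd; have w0 : 0 < a / Theta ^+ k.+1 by rewrite divr_gt0 ?exprn_gt0.
rewrite (@expect_sum d n R l _ _ _ (fun (q : 'I_d.-1) s => `|balance q.+1 s|)).
rewrite /balance_total mulr_suml; apply: ler_sum => q _.
have qd : (q.+1 < d)%N by have := ltn_ord q; rewrite -ltnS prednK.
apply: le_trans (balance_mean_norm d_ge2 qd hl clock_bound w0) _.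
rewrite [leRHS]mulrDl mul1r lerD2r.
have Q0 : 0 < Theta ^+ k.+1 by rewrite exprn_gt0.
have key : Theta ^+ 2 * Theta ^+ k.+1 * Theta ^+ k.+1 <= a.
  rewrite -!exprD; apply: pow_le_a.
  by rewrite -addnA addnC mul2n -addnn; apply: leq_add => //; apply: leq_add.
have -> : K q.+1 * Theta ^+ 2 * a / (a / Theta ^+ k.+1)
  = K q.+1 * (Theta ^+ 2 * Theta ^+ k.+1).
  by set Q := Theta ^+ k.+1 in Q0 *; field; rewrite !gt_eqF.
by rewrite ler_wpM2l ?balance_const_ge0 // ler_pdivlMr.
Qed.

Definition fraction_const (k : nat) : R :=
  k%:R * (3 * d%:R) ^+ k.-1 * (4 * slack_const R d + 2 + count_const k)
  + chain_const k * total
  + ((d - 1) ^_ k)%:R * (d%:R + 1) * (below_const (d - 1) + 1).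

(** Replacing the clock by [L] in [degree_chain] costs a relative error of order
    [1 / sqrt L], by [clock_second_moment]; nearly all of the deficit comes from
    vertices of degree [d - 1]. *)
Lemma degree_fraction k : (0 < k < d)%N ->
  expect d l (fun s => `|L ^+ k * count (d - 1 - k)%N s - ((d - 1) ^_ k)%:R * a|)
  <= fraction_const k * a / Num.sqrt L.
Proof.
case: k => // k /= kd; set y := Num.sqrt L.
have yL : y ^+ 2 = L by rewrite sqr_sqrtr // ltW.
have y0 : 0 < y by rewrite sqrtr_gt0.
have yleL : y <= L.
  by rewrite -{1}(mulr1 y) -yL expr2 ler_wpM2l ?(ltW y0) // -sqrtr1 ler_wsqrtr.
set q := (d - 1 - k.+1)%N; set kap := ((d - 1) ^_ k.+1)%:R.
set w := a / (L ^+ k.+1 * y).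
have w0 : 0 < w by rewrite divr_gt0 // mulr_gt0 // exprn_gt0.
apply: le_trans (_ : expect d l (fun s =>
   k.+1%:R * Theta ^+ k * (w * (clock s - L) ^+ 2 + w^-1 * count q s ^+ 2)
   + (chain_const k.+1 * Theta ^+ k.+1 * \sum_(q < d.-1) `|balance q.+1 s|
   + kap * (d%:R + 1) * belowR (d - 1)%N s)) <= _).
  apply: ler_expect => s rs sl.
  have c0 := degree_count_ge0 R q s.
  have T0' := clock_ge0 R d s.
  have cT : clock s <= Theta.
    by have := clock_bound rs (eq_leq sl); have := d2R; lra.
  have -> : L ^+ k.+1 * count q s - kap * a =
    (L ^+ k.+1 - clock s ^+ k.+1) * count q s
    + ((clock s ^+ k.+1 * count q s - kap * count (d - 1)%N s)
    + kap * (count (d - 1)%N s - a)) by ring.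
  apply: le_trans (ler_normD _ _) _; apply: lerD.
    rewrite normrM (ger0_norm c0).
    apply: le_trans (_ : k.+1%:R * Theta ^+ k * `|L - clock s| * count q s <= _).
      by rewrite ler_wpM2r // expr_dist_le ?T0' ?(ltW L0).
    rewrite -mulrA ler_wpM2l ?mulr_ge0 ?exprn_ge0 ?(ltW T0) //.
    rewrite [w^-1 * _]mulrC -[(clock s - L) ^+ 2]real_normK ?num_real // distrC.
    exact: mulr_le_squares.
  apply: le_trans (ler_normD _ _) _; apply: lerD; first exact: degree_chain.
  rewrite normrM ger0_norm // -mulrA ler_wpM2l //.
  have [ua _ _] := open_bounds R d_ge2 rs sl hl.
  have aub : a - u s <= d%:R * belowR d.-1 s.
    have := deficit_le_below rs; rewrite -(ler_nat R) natrD natrM sl.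
    by rewrite -deficit_natr ?early_size //; lra.
  have uE : u s = belowR d.-1 s + count d.-1 s.
    by rewrite -belowS prednK // below_full.
  rewrite subn1 ler_norml; have := degree_count_ge0 R d.-1 s.
  have : 0 <= belowR d.-1 s by [].
  rewrite uE in ua aub; lra.
rewrite !expectD !expectZ expectD !expectZ.
have h1 := clock_second_moment; have h2 := count_second_moment kd.
have h3 := balance_sum_mean kd; have h4 := below_mean (leq_subr 1 d).
rewrite -/q in h2.
have P0 : 0 < L ^+ k.+1 by rewrite exprn_gt0.
have Q0 : 0 < L ^+ k by rewrite exprn_gt0.
have t1 : w * expect d l (fun s => (clock s - L) ^+ 2) <= (4 * slack_const R d + 2) * (a * y / L ^+ k.+1).
  apply: le_trans (ler_wpM2l (ltW w0) h1) _.
  rewrite le_eqVlt; apply/orP; left; apply/eqP.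
  rewrite -[X in w * (_ * X)]yL /w; set P := L ^+ k.+1 in P0 *.
  by field; rewrite !gt_eqF.
have t2 : w^-1 * expect d l (fun s => count q s ^+ 2) <= count_const k.+1 * (a * y / L ^+ k.+1).
  have wi0 : 0 <= w^-1 by rewrite invr_ge0 ltW.
  apply: le_trans (ler_wpM2l wi0 h2) _.
  rewrite le_eqVlt; apply/orP; left; apply/eqP.
  by rewrite /w; set P := L ^+ k.+1 in P0 *; field; rewrite !gt_eqF.
have t12 : k.+1%:R * Theta ^+ k * (w * expect d l (fun s => (clock s - L) ^+ 2)
     + w^-1 * expect d l (fun s => count q s ^+ 2))
  <= k.+1%:R * (3 * d%:R) ^+ k * (4 * slack_const R d + 2 + count_const k.+1) * (a / y).
  apply: le_trans (ler_wpM2l _ (lerD t1 t2)) _.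
    by rewrite mulr_ge0 ?exprn_ge0 // ltW.
  rewrite le_eqVlt; apply/orP; left; apply/eqP.
  rewrite exprMn [L ^+ k.+1]exprS -[X in _ / (X * _)]yL.
  set Q := L ^+ k in Q0 *; set D := (3 * d%:R) ^+ k.
  by field; rewrite !gt_eqF.
have inv : a / L <= a / y by rewrite ler_wpM2l ?(ltW a0) // lef_pV2 ?posrE.
have t3 : chain_const k.+1 * Theta ^+ k.+1 *
    expect d l (fun s => \sum_(q < d.-1) `|balance q.+1 s|)
   <= chain_const k.+1 * total * (a / y).
  apply: le_trans (ler_wpM2l _ h3) _.
    by rewrite mulr_ge0 ?exprn_ge0 ?(ltW T0) ?chain_const_ge0.
  have -> : chain_const k.+1 * Theta ^+ k.+1 * (total * (a / Theta ^+ k.+2))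
    = chain_const k.+1 * total * (a / Theta).
    have R0 : 0 < Theta ^+ k.+1 by rewrite exprn_gt0.
    rewrite (exprS Theta k.+1); set P1 := Theta ^+ k.+1 in R0 *.
    by move: T0; set Th := Theta => Th0; field; rewrite !gt_eqF.
  rewrite ler_wpM2l ?mulr_ge0 ?chain_const_ge0 ?balance_total_ge0 //.
  by apply: le_trans inv; rewrite ler_wpM2l ?(ltW a0) // lef_pV2 ?posrE.
have t4 : kap * (d%:R + 1) * expect d l (fun s => belowR (d - 1)%N s)
  <= kap * (d%:R + 1) * (below_const (d - 1) + 1) * (a / y).
  rewrite -[leRHS]mulrA ler_wpM2l ?mulr_ge0 ?addr_ge0 //.
  apply: le_trans h4 _; rewrite subKn // expr1 ler_wpM2l //.
  by rewrite addr_ge0 ?below_const_ge0.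
rewrite -[leRHS]mulrA /fraction_const [leRHS]mulrDl [X in _ <= X + _]mulrDl -[leRHS]addrA.
by apply: lerD => //; apply: lerD.
Qed.

Lemma below_fraction j : (j < d - 1)%N ->
  expect d l (fun s => `|L ^+ (d - 1 - j) * belowR j.+1 s
     - ((d - 1) ^_ (d - 1 - j))%:R * a|)
  <= (fraction_const (d - 1 - j) + below_const j + 1) * a / Num.sqrt L.
Proof.
move=> jd; set k := (d - 1 - j)%N.
have k0 : (0 < k < d)%N.
  by rewrite subn_gt0 jd (leq_ltn_trans (leq_subr _ _)) // subn1 prednK.
have jE : (d - 1 - k = j)%N by rewrite subKn // ltnW.
have djE : (d - j = k.+1)%N by rewrite -subSn ?(ltnW jd) // subn1 prednK.
set y := Num.sqrt L.
have yL : y ^+ 2 = L by rewrite sqr_sqrtr // ltW.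
have y0 : 0 < y by rewrite sqrtr_gt0.
have yleL : y <= L.
  by rewrite -{1}(mulr1 y) -yL expr2 ler_wpM2l ?(ltW y0) // -sqrtr1 ler_wsqrtr.
have h1 := degree_fraction k0; rewrite jE in h1.
have /below_mean h2 : (j <= d)%N by rewrite ltnW // (leq_trans jd) // leq_subr.
rewrite djE in h2.
apply: le_trans (_ : expect d l (fun s => `|L ^+ k * count j s - ((d - 1) ^_ k)%:R * a|
   + L ^+ k * belowR j s) <= _).
  apply: ler_expect => s rs sl; rewrite belowS.
  have -> : L ^+ k * (belowR j s + count j s) - ((d - 1) ^_ k)%:R * a
   = (L ^+ k * count j s - ((d - 1) ^_ k)%:R * a) + L ^+ k * belowR j s by ring.
  apply: le_trans (ler_normD _ _) _; rewrite lerD2l ger0_norm //.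
  by rewrite mulr_ge0 // exprn_ge0 // ltW.
rewrite expectD expectZ -addrA [X in _ <= X / _]mulrDl [leRHS]mulrDl.
apply: lerD => //.
apply: le_trans (ler_wpM2l _ h2) _; first by rewrite exprn_ge0 // ltW.
have -> : L ^+ k * ((below_const j + 1) * (a / L ^+ k.+1)) = (below_const j + 1) * a * L^-1.
  by rewrite exprS; field; rewrite expf_neq0 ?gt_eqF.
rewrite ler_wpM2l ?lef_pV2 ?posrE //.
by apply: mulr_ge0 (ltW a0); rewrite addr_ge0 ?below_const_ge0.
Qed.

End FirstPhaseEnd.

(** * Decay of the low degrees in the second phase *)

Lemma binomial_tangent (R : realType) (b y : R) (x : nat) :
  0 <= b -> 0 <= y -> b + y <= 1 ->
  0 <= (b + y) ^+ x - (b ^+ x + x%:R * y * b ^+ x.-1) <= (x%:R * y) ^+ 2.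
Proof.
move=> b0 y0 by1; have b1 : b <= 1 by lra.
elim: x => [|x IH]; first by rewrite !expr0 !mul0r addr0 subrr expr0n lexx.
set D := _ - _ in IH *; move: IH => /andP[D0 Dx].
have xE : x%:R * y * b ^+ x = b * (x%:R * y * b ^+ x.-1).
  by case: x {D D0 Dx} => [|x]; [rewrite !mul0r mulr0|rewrite /= exprS; ring].
have -> : (b + y) ^+ x.+1 - (b ^+ x.+1 + x.+1%:R * y * b ^+ x.+1.-1)
   = (b + y) * D + y * (x%:R * y * b ^+ x.-1).
  rewrite /D /= exprS [b ^+ x.+1]exprS -[x.+1%:R]natr1.
  have -> : (x%:R + 1) * y * b ^+ x = b * (x%:R * y * b ^+ x.-1) + y * b ^+ x.
    by rewrite -xE; ring.
  by ring.
have t0 : 0 <= x%:R * y * b ^+ x.-1 by rewrite !mulr_ge0 ?exprn_ge0.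
have t1 : x%:R * y * b ^+ x.-1 <= x%:R * y.
  by rewrite ler_piMr ?exprn_ile1 // mulr_ge0.
apply/andP; split; first by apply: addr_ge0; apply: mulr_ge0 => //; exact: addr_ge0.
apply: le_trans (_ : D + y * (x%:R * y) <= _).
  by apply: lerD; [rewrite ler_piMl|rewrite ler_wpM2l].
apply: le_trans (_ : (x%:R * y) ^+ 2 + y * (x%:R * y) <= _); first by rewrite lerD2r.
rewrite -natr1 -subr_ge0.
have -> : ((x%:R + 1) * y) ^+ 2 - ((x%:R * y) ^+ 2 + y * (x%:R * y)) = (x%:R + 1) * y ^+ 2.
  by ring.
by rewrite mulr_ge0 ?sqr_ge0 // addr_ge0.
Qed.

Section SecondPhase.
Variables (R : realType) (d n : nat).
Hypothesis d_ge2 : (2 <= d)%N.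
Implicit Types (s : seq {set 'I_n}) (e : {set 'I_n}) (v : 'I_n).

Local Notation u s := (#|opens d s|%:R : R).
Local Notation belowR q s := ((below q s)%:R : R).
Local Notation N := (max_edges d n).

Let d_gt0 : (0 < d)%N. Proof. by apply: leq_trans d_ge2. Qed.
Let d2R : (2 : R) <= d%:R. Proof. by rewrite ler_nat. Qed.

Definition remaining (l : nat) : R := (N - l)%:R.
Local Notation M := remaining.

Lemma remainingS l : (l < N)%N -> M l.+1 = M l - 1.
Proof. by move=> h; rewrite /remaining -[in RHS](subnSK h) -natr1 addrK. Qed.

Lemma early_lt l : early d n l -> (l < N)%N.
Proof.
rewrite /early /max_edges => h; have : (2 * d ^ 2 >= 8)%N by rewrite -mulnn; nia.
lia.
Qed.

Lemma deficit_remaining l : early d n l ->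
  2 * M l <= deficit R d n l <= 2 * M l + 1.
Proof.
move=> hl; rewrite deficit_natr ?early_size //.
have hN := early_lt hl; move: hN; rewrite /remaining /max_edges => hN.
have h1 : (2 * (d * n %/ 2 - l) <= d * n - 2 * l)%N by lia.
have h2 : (d * n - 2 * l <= (2 * (d * n %/ 2 - l)).+1)%N by lia.
by rewrite -natrM natr1 !ler_nat h1.
Qed.

Section Weight.
Variable B : R.
Hypothesis B_ge2 : 2 <= B.
Let B0 : 0 < B. Proof. by apply: lt_le_trans B_ge2. Qed.
Let B1 : 1 <= B. Proof. by apply: le_trans B_ge2; rewrite ler1n. Qed.

(** Consecutive weights differ by a factor [B], so a hit costs a vertex all but
    the fraction [1 / B] of its weight, whatever its degree below [q]. *)
Definition weight (q i : nat) : R := if (i < q)%N then B ^+ (q - i.+1) else 0.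

Lemma weight_ge0 q i : 0 <= weight q i.
Proof. by rewrite /weight; case: ifP => // _; rewrite exprn_ge0 // ltW. Qed.

Lemma weight_le q i : weight q i <= B ^+ q.
Proof.
rewrite /weight; case: ifP => _; last by rewrite exprn_ge0 // ltW.
by rewrite ler_weXn2l // leq_subr.
Qed.

Lemma weight_next q i : weight q i.+1 <= weight q i / B.
Proof.
rewrite /weight; case: ltnP => h; last by rewrite divr_ge0 ?weight_ge0 // ltW.
by rewrite (ltnW h) -(subnSK h) exprS mulrC mulKf ?gt_eqF.
Qed.

Definition load (q : nat) s : R := statistic (weight q) s.

Lemma below_statistic q s : belowR q s = statistic (fun i => (i < q)%N%:R) s.
Proof.
rewrite /below -sum1_card natr_sum big_mkcond /statistic /=.
by apply: eq_bigr => v _; rewrite inE; case: ltnP.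
Qed.

Lemma load_ge0 q s : 0 <= load q s.
Proof. by apply: sumr_ge0 => v _; exact: weight_ge0. Qed.

Lemma below_le_load q s : belowR q s <= load q s.
Proof.
rewrite below_statistic; apply: ler_sum => v _; rewrite /weight.
by case: ltnP => // _; rewrite exprn_ege1.
Qed.

Lemma load_le_below q s : load q s <= B ^+ q * belowR q s.
Proof.
rewrite below_statistic big_distrr /=; apply: ler_sum => v _.
have := weight_le q (deg s v); rewrite /weight.
by case: ltnP => _; rewrite ?mulr1 ?mulr0.
Qed.

Definition weight_drop q s v : R := weight q (deg s v) - weight q (deg s v).+1.

Lemma load_rcons q s e : e \in moves d s ->
  load q (rcons s e) = load q s - \sum_(v in e) weight_drop q s v.
Proof.
move=> es; rewrite /load (statistic_rcons _ es) -sumrN.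
by congr (_ + _); apply: eq_bigr => v _; rewrite opprB.
Qed.

Lemma weight_drop_le q s v : weight_drop q s v <= weight q (deg s v).
Proof. by rewrite gerBl weight_ge0. Qed.

Lemma weight_drop_ge q s v : (1 - B^-1) * weight q (deg s v) <= weight_drop q s v.
Proof.
by rewrite mulrBl mul1r lerD2l lerN2 mulrC weight_next.
Qed.

Lemma weight_drop_ge0 q s v : 0 <= weight_drop q s v.
Proof.
apply: le_trans (weight_drop_ge q s v); rewrite mulr_ge0 ?weight_ge0 //.
by rewrite subr_ge0 invf_le1.
Qed.

Lemma load_open q s : (q <= d)%N -> load q s = \sum_(v in opens d s) weight q (deg s v).
Proof.
move=> qd; rewrite /load /statistic [RHS]big_mkcond; apply: eq_bigr => v _.
by rewrite inE /weight; case: ltnP => // h; case: ltnP => // h2; lia.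
Qed.

(** There are at most [2 * remaining + 1] open vertices, so each is hit with
    probability at least nearly [1 / remaining], and a hit costs at least the
    fraction [1 - 1 / B] of its weight; the second [1 / B] in the bound absorbs
    the lower order terms. *)
Lemma drop_mean q s l : (q <= d)%N -> reachable d s -> size s = l -> early d n l ->
  (d%:R ^+ 2 + 1) * B <= M l ->
  (1 - 2 / B) / M l * load q s
   <= step_mean d (graph_of s) (fun e => \sum_(v in e) weight_drop q s v)
   <= 2 * d%:R / M l * load q s.
Proof.
move=> qd rs sl hl hM.
have [ua au u2d] := open_bounds R d_ge2 rs sl hl; have up := u_gt0 R d_ge2 rs sl hl.
have und : (2 * d <= #|opens d s|)%N by rewrite -(ler_nat R) natrM.
have /andP[a1 a2] := deficit_remaining hl.
have M0 : 0 < M l.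
  by apply: lt_le_trans hM; rewrite mulr_gt0 // ltr_wpDl ?exprn_ge0.
rewrite step_mean_sum load_open // !big_distrr /=.
have uM : (u s)^-1 <= d%:R / (2 * M l).
  by rewrite ler_pdivlMr ?mulr_gt0 // mulrC ler_pdivrMr //; lra.
apply/andP; split; apply: ler_sum => v vU; last first.
  apply: ler_pM; [by rewrite divr_ge0|exact: weight_drop_ge0| |exact: weight_drop_le].
  have := choices_over_available R d_gt0 und vU; rewrite ler_norml => /andP[_ h].
  apply: le_trans (_ : 4 / u s <= _).
    have : 4 * d%:R / u s ^+ 2 <= 2 / u s.
      rewrite expr2 invfM mulrA ler_wpM2r ?invr_ge0 //.
      by rewrite ler_pdivrMr //; lra.
    have -> : 4 / u s = 2 / u s + 2 / u s by ring.
    lra.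
  apply: le_trans (ler_wpM2l _ uM) _ => //.
  by rewrite le_eqVlt; apply/orP; left; apply/eqP; field; rewrite gt_eqF.
apply: le_trans (_ : (2 / u s - 4 * d%:R / u s ^+ 2) * ((1 - B^-1) * weight q (deg s v)) <= _); last first.
  apply: ler_pM; last 1 first.
  - exact: weight_drop_ge.
  - rewrite subr_ge0 expr2 invfM mulrA ler_wpM2r ?invr_ge0 //.
    by rewrite ler_pdivrMr //; lra.
  - by rewrite mulr_ge0 ?weight_ge0 // subr_ge0 invf_le1.
  - have := choices_over_available R d_gt0 und vU; rewrite ler_norml => /andP[h _]; lra.
rewrite mulrA ler_wpM2r ?weight_ge0 //.
have Bi : B^-1 <= 1 by rewrite invf_le1.
set h := (u s)^-1 in uM *; have h0 : 0 < h by rewrite invr_gt0.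
have hM' : (M l)^-1 * (1 - (2 * M l)^-1) <= 2 * h.
  have : 2 / (2 * M l + 1) <= 2 * h.
    by rewrite ler_wpM2l // lef_pV2 ?posrE //; lra.
  apply: le_trans; rewrite ler_pdivlMr; last by lra.
  have -> : (M l)^-1 * (1 - (2 * M l)^-1) * (2 * M l + 1) = 2 - 1 / (2 * M l ^+ 2).
    by field; rewrite gt_eqF.
  by rewrite gerBl divr_ge0 // mulr_ge0 // sqr_ge0.
have e1 : 2 * d%:R * h <= d%:R ^+ 2 / M l.
  apply: le_trans (ler_wpM2l _ uM) _; first by rewrite mulr_ge0.
  by rewrite le_eqVlt; apply/orP; left; apply/eqP; field; rewrite gt_eqF.
have e2 : (d%:R ^+ 2 + 1) / M l <= B^-1.
  by rewrite ler_pdivrMr // ler_pdivlMl // mulrC.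
have e3 : (2 * M l)^-1 <= 1 / M l.
  by rewrite invfM mul1r ler_piMl ?invr_ge0 ?(ltW M0) // invf_le1 ?ler1n.
have -> : 2 * h - 4 * d%:R / u s ^+ 2 = 2 * h * (1 - 2 * d%:R * h).
  by rewrite /h; field; rewrite gt_eqF.
have e4 : (d%:R ^+ 2 + 1) / M l = d%:R ^+ 2 / M l + 1 / M l by rewrite mulrDl.
set x := (2 * M l)^-1 in hM' e3 *; set y := 2 * d%:R * h in e1 *.
set z := B^-1 in Bi e2 *.
have x0 : 0 <= x by rewrite invr_ge0 mulr_ge0 // ltW.
have y0 : 0 <= y by rewrite !mulr_ge0 // ltW.
have z0 : 0 <= z by rewrite invr_ge0 ltW.
have xyz : x + y <= z by lra.
have Mi : 0 < (M l)^-1 by rewrite invr_gt0.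
apply: le_trans (_ : (M l)^-1 * (1 - x) * (1 - y) * (1 - z) <= _); last first.
  rewrite ler_wpM2r ?subr_ge0 // ler_wpM2r ?subr_ge0 //; lra.
rewrite [_ / M l]mulrC -!mulrA ler_wpM2l ?(ltW Mi) //.
have xy : 0 <= x * y by exact: mulr_ge0.
have s1 : 1 - z <= (1 - x) * (1 - y).
  have -> : (1 - x) * (1 - y) = 1 - (x + y) + x * y by ring.
  lra.
apply: le_trans (_ : (1 - z) * (1 - z) <= _).
  have := sqr_ge0 z; rewrite expr2; lra.
by rewrite mulrA ler_wpM2r ?subr_ge0.
Qed.

Lemma load_mean q s l : (q <= d)%N -> reachable d s -> size s = l -> early d n l ->
  (d%:R ^+ 2 + 1) * B <= M l ->
  step_mean d (graph_of s) (fun e => load q (rcons s e))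
    <= (1 - (1 - 2 / B) / M l) * load q s.
Proof.
move=> qd rs sl hl hM.
have [_ _ u2d] := open_bounds R d_ge2 rs sl hl.
have und : (2 * d <= #|opens d s|)%N by rewrite -(ler_nat R) natrM.
have /andP[h _] := drop_mean qd rs sl hl hM.
rewrite (@eq_step_mean _ _ _ _ _ ((fun=> load q s) \+
   (fun e => -1 * \sum_(v in e) weight_drop q s v))); last first.
  by move=> e es; rewrite (load_rcons _ es) /= mulN1r.
rewrite step_meanD step_mean_cst // step_meanZ mulrBl mul1r mulN1r.
by rewrite lerD2l lerN2.
Qed.

(** The product of the two drops is at most a constant times the drop of
    [load p], which is why the noise is linear in [load p]. *)
Lemma load_product_mean p q s l : (p <= d)%N -> (q <= d)%N ->
  reachable d s -> size s = l -> early d n l ->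
  (d%:R ^+ 2 + 1) * B <= M l ->
  step_mean d (graph_of s) (fun e => load p (rcons s e) * load q (rcons s e))
    <= (1 - 2 * ((1 - 2 / B) / M l)) * (load p s * load q s)
       + 4 * d%:R * B ^+ q / M l * load p s.
Proof.
move=> pd qd rs sl hl hM.
have [_ _ u2d] := open_bounds R d_ge2 rs sl hl.
have und : (2 * d <= #|opens d s|)%N by rewrite -(ler_nat R) natrM.
have /andP[hp hp'] := drop_mean pd rs sl hl hM.
have /andP[hq _] := drop_mean qd rs sl hl hM.
set D := (1 - 2 / B) / M l in hp hq *.
have p0 := load_ge0 p s; have q0 := load_ge0 q s.
have Bq : 0 <= B ^+ q by rewrite exprn_ge0 // ltW.
apply: le_trans (_ : step_mean d (graph_of s) ((fun=> load p s * load q s) \+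
   ((fun e => - load q s * \sum_(v in e) weight_drop p s v) \+
   ((fun e => - load p s * \sum_(v in e) weight_drop q s v) \+
    (fun e => 2 * B ^+ q * \sum_(v in e) weight_drop p s v)))) <= _).
  apply: ler_step_mean => e es; rewrite !(load_rcons _ es) /=.
  set x := \sum_(v in e) weight_drop p s v; set y := \sum_(v in e) weight_drop q s v.
  have x0 : 0 <= x by apply: sumr_ge0 => v _; exact: weight_drop_ge0.
  have y2 : y <= 2 * B ^+ q.
    have e2 : #|e| = 2%N by move: es; rewrite inE => /andP[/eqP].
    rewrite mulr_natl -[2%N]e2 -sumr_const; apply: ler_sum => v _.
    exact: le_trans (weight_drop_le _ _ _) (weight_le _ _).
  have -> : (load p s - x) * (load q s - y) = load p s * load q s +
     (- load q s * x + (- load p s * y + y * x)) by ring.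
  by rewrite !lerD2l ler_wpM2r.
rewrite !step_meanD step_mean_cst // !step_meanZ.
set X := step_mean _ _ _ in hp hp' *; set Y := step_mean _ _ _ in hq *.
have h1 : load q s * (D * load p s) <= load q s * X by rewrite ler_wpM2l.
have h2 : load p s * (D * load q s) <= load p s * Y by rewrite ler_wpM2l.
have h3 : 2 * B ^+ q * X <= 2 * B ^+ q * (2 * d%:R / M l * load p s).
  by rewrite ler_wpM2l // mulr_ge0.
have -> : 4 * d%:R * B ^+ q / M l * load p s = 2 * B ^+ q * (2 * d%:R / M l * load p s).
  by ring.
lra.
Qed.

End Weight.

End SecondPhase.

(** * One step of the survival probability *)

Lemma card_set_sum (T : finType) (P : pred T) : (#|[set v | P v]| = \sum_v P v)%N.
Proof. by rewrite -sum1dep_card big_mkcond; apply: eq_bigr => v _; case: (P v). Qed.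

Section Hits.
Variables (R : realType) (d n : nat).
Hypothesis d_ge2 : (2 <= d)%N.
Implicit Types (s : seq {set 'I_n}) (e : {set 'I_n}) (v : 'I_n).

Local Notation u s := (#|opens d s|%:R : R).
Local Notation belowR q s := ((below q s)%:R : R).
Local Notation M := (remaining R d n).

Let d_gt0 : (0 < d)%N. Proof. by apply: leq_trans d_ge2. Qed.
Let d2R : (2 : R) <= d%:R. Proof. by rewrite ler_nat. Qed.

Definition hits (j : nat) s e : nat := #|[set v in e | deg s v == j]|.

Lemma below_hits j s e : e \in moves d s ->
  (below j.+1 (rcons s e) + hits j s e = below j.+1 s)%N.
Proof.
move=> es; rewrite /below /hits !card_set_sum -big_split /=.
apply: eq_bigr => v _; rewrite (moves_degree _ es) ltnS.
by case: (v \in e); case: ltngtP; rewrite ?addn1 ?addn0 ?ltnS; case: ltngtP => //; lia.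
Qed.

Lemma hits_le2 j s e : e \in moves d s -> (hits j s e <= 2)%N.
Proof.
rewrite inE => /andP[/eqP e2 _]; rewrite -e2; apply: subset_leq_card.
by apply/subsetP => v; rewrite inE => /andP[].
Qed.

Lemma hits_sum j s e : (hits j s e)%:R = \sum_(v in e) ((deg s v == j)%:R : R).
Proof.
rewrite /hits -sum1dep_card natr_sum big_mkcondr /=.
by apply: eq_bigr => v _; case: eqP.
Qed.

(** At most [x^2 / 2] of the at least [u^2 / 4] available pairs join two vertices
    of degree [j], where [x] counts the vertices of degree at most [j]. *)
Lemma double_hits_mean j s : (2 * d <= #|opens d s|)%N ->
  step_mean d (graph_of s) (fun e => (hits j s e == 2)%:R)
    <= 2 * belowR j.+1 s ^+ 2 / u s ^+ 2.
Proof.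
move=> und; have A0 := card_available_gt0 R d_gt0 und.
have A4 := card_available_quadratic R d_gt0 und.
set Y := [set v | deg s v == j].
have c : (2 * #|[set e in moves d s | hits j s e == 2]| <= below j.+1 s * below j.+1 s)%N.
  apply: leq_trans (_ : 2 * 'C(#|Y|, 2) <= _)%N.
    rewrite leq_mul2l -cards_draws; apply/subset_leq_card/subsetP => e.
    rewrite !inE => /andP[/and3P[/eqP e2 _ _] /eqP h]; rewrite e2 eqxx andbT.
    have : [set v in e | deg s v == j] = e.
      apply/eqP; rewrite eqEcard e2 -[X in (X <= _)%N]h leqnn andbT.
      by apply/subsetP => v; rewrite inE => /andP[].
    by move=> <-; apply/subsetP => v; rewrite !inE => /andP[].
  have yb : (#|Y| <= below j.+1 s)%N.
    by apply/subset_leq_card/subsetP => v; rewrite !inE => /eqP ->.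
  have := bin2 #|Y|; have := odd_double_half (#|Y| * #|Y|.-1).
  move=> h1 h2; apply: leq_trans (_ : #|Y| * #|Y|.-1 <= _)%N.
    by rewrite -h1 h2 mul2n leq_addl.
  by rewrite leq_mul // (leq_trans (leq_pred _)).
have -> : step_mean d (graph_of s) (fun e => (hits j s e == 2)%:R)
  = (#|moves d s|%:R)^-1 * #|[set e in moves d s | hits j s e == 2]|%:R :> R.
  rewrite /step_mean; congr (_ * _).
  rewrite -sum1dep_card natr_sum big_mkcondr /=.
  by apply: eq_bigr => e _; case: eqP.
set A := #|moves d s| in A0 A4 *; set C := #|_| in c *.
set x := below _ _ in c *.
have u0 : 0 < u s by rewrite ltr0n (leq_trans _ und) // muln_gt0.
have A0R : 0 < A%:R :> R by rewrite ltr0n.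
rewrite mulrC ler_pdivrMr // mulrAC ler_pdivlMr ?exprn_gt0 //.
move: c A4; rewrite -!(ler_nat R) !natrM -!expr2 => c A4.
have C0 : 0 <= C%:R :> R by [].
have h1 := ler_wpM2l C0 A4.
have h2 : 2 * A%:R * (2 * C%:R) <= 2 * A%:R * x%:R ^+ 2 :> R.
  by rewrite ler_wpM2l // mulr_ge0 // ltW.
lra.
Qed.

(** A uniform choice among the open vertices hits each with probability [2 / u],
    and [u] is about twice the number of missing edges. *)
Lemma hits_mean j s l : (j < d - 1)%N -> reachable d s -> size s = l -> early d n l ->
  0 < M l ->
  `|step_mean d (graph_of s) (fun e => (hits j s e)%:R) - belowR j.+1 s / M l|
  <= d%:R / M l * belowR j s
     + (d%:R ^+ 3 + d%:R ^+ 2 + d%:R) * (belowR j.+1 s * belowR (d - 1) s) / M l ^+ 2.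
Proof.
move=> jd rs sl hl M0.
have [ua au u2d] := open_bounds R d_ge2 rs sl hl; have up := u_gt0 R d_ge2 rs sl hl.
have und : (2 * d <= #|opens d s|)%N by rewrite -(ler_nat R) natrM.
have /andP[a1 a2] := deficit_remaining R d_ge2 hl.
have := step_mean_sum_approx d_gt0 und (fun v => (deg s v == j)%:R : R).
rewrite -(@eq_step_mean d n R _ (fun e => (hits j s e)%:R)); last first.
  by move=> e _; exact: hits_sum.
set m := step_mean _ _ _.
have jd' : (j < d)%N by rewrite (leq_trans jd) // leq_subr.
have sumU : \sum_(v in opens d s) ((deg s v == j)%:R : R) = degree_count R j s.
  rewrite (@sum_open R d n d_ge2 j (fun i => (i == j)%:R)) // => i ij.
  by rewrite gtn_eqF.
have -> : \sum_(v in opens d s) `|((deg s v == j)%:R : R)| = degree_count R j s.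
  by rewrite -sumU; apply: eq_bigr => v _; rewrite ger0_norm.
rewrite sumU; set Y := degree_count R j s => h.
have xE : belowR j.+1 s = belowR j s + Y by rewrite /Y belowS.
have Y0 : 0 <= Y := degree_count_ge0 R j s.
set x := belowR j.+1 s in xE *; set w := belowR j s in xE *.
set V := belowR (d - 1) s.
have w0 : 0 <= w by [].
have x0 : 0 <= x by [].
have xV : x <= x * V.
  rewrite /x /V -natrM ler_nat.
  have := @leq_below n j.+1 (d - 1) s jd; case: (below j.+1 s) => // k kV.
  by rewrite leq_pmulr // (leq_trans _ kV).
have aub : deficit R d n l - u s <= d%:R * V.
  have := deficit_le_below rs; rewrite -(ler_nat R) natrD natrM sl.
  by rewrite -deficit_natr ?early_size // /V subn1; lra.
have uM : (u s)^-1 <= d%:R / (2 * M l).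
  by rewrite ler_pdivlMr ?mulr_gt0 // mulrC ler_pdivrMr //; lra.
have V0 : 0 <= V by [].
have d0 : 0 <= d%:R :> R by [].
have ui0 : 0 <= (u s)^-1 by rewrite invr_ge0.
(* pairs that are not available *)
have e1 : 4 * d%:R / u s ^+ 2 * Y <= d%:R ^+ 3 / M l ^+ 2 * (x * V).
  apply: ler_pM => //.
    apply: le_trans (_ : 4 * d%:R * (d%:R / (2 * M l)) ^+ 2 <= _).
      rewrite ler_wpM2l ?mulr_ge0 // -exprVn ler_sqr ?nnegrE //.
      exact: le_trans uM.
    by rewrite le_eqVlt; apply/orP; left; apply/eqP; field; rewrite gt_eqF.
  by apply: le_trans xV; rewrite xE lerDr.
(* a hit at a vertex of degree below j leaves it among those counted by x *)
have e2 : 2 / u s * w <= d%:R / M l * w.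
  rewrite ler_wpM2r //; apply: le_trans (ler_wpM2l _ uM) _ => //.
  by rewrite le_eqVlt; apply/orP; left; apply/eqP; field; rewrite gt_eqF.
(* u differs from 2 M by the vertices lacking several edges, and by parity *)
have e3 : `|2 / u s - 1 / M l| * x <= (d%:R ^+ 2 + d%:R) / M l ^+ 2 * (x * V).
  have -> : 2 / u s - 1 / M l = (2 * M l - u s) * ((u s)^-1 * (M l)^-1).
    by field; rewrite !gt_eqF.
  rewrite normrM (ger0_norm (mulr_ge0 ui0 _)) ?invr_ge0 ?(ltW M0) //.
  have n1 : `|2 * M l - u s| <= d%:R * V + 1.
    by rewrite ler_norml; apply/andP; split; lra.
  apply: le_trans (_ : (d%:R * V + 1) * (d%:R / (2 * M l) * (M l)^-1) * x <= _).
    rewrite ler_wpM2r //; apply: ler_pM => //.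
      by rewrite mulr_ge0 // invr_ge0 ltW.
    by rewrite ler_wpM2r // invr_ge0 ltW.
  have -> : (d%:R * V + 1) * (d%:R / (2 * M l) * (M l)^-1) * x
    = (d%:R ^+ 2 / 2 * (x * V) + d%:R / 2 * x) / M l ^+ 2 by field; rewrite gt_eqF.
  rewrite [leRHS]mulrAC ler_wpM2r ?invr_ge0 ?sqr_ge0 //.
  have xV0 : 0 <= x * V by rewrite mulr_ge0.
  have := ler_wpM2l d0 xV; have := mulr_ge0 (sqr_ge0 (d%:R : R)) xV0.
  have := mulr_ge0 d0 xV0.
  by rewrite [X in _ -> _ -> _ -> _ <= X]mulrDl; lra.
have -> : m - x / M l = (m - 2 / u s * Y) + (- (2 / u s * w) + (2 / u s - 1 / M l) * x).
  by rewrite xE; field; rewrite !gt_eqF.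
apply: le_trans (ler_normD _ _) _.
apply: le_trans (lerD h (ler_normD _ _)) _.
rewrite normrN [`|_ * w|]ger0_norm; last by rewrite mulr_ge0 // divr_ge0.
rewrite [`|_ * x|]normrM (ger0_norm x0).
have -> : (d%:R ^+ 3 + d%:R ^+ 2 + d%:R) * (x * V) / M l ^+ 2
  = d%:R ^+ 3 / M l ^+ 2 * (x * V) + (d%:R ^+ 2 + d%:R) / M l ^+ 2 * (x * V) by ring.
lra.
Qed.

(** If a step removed one of [x] marked items among [M] with probability
    [x / M], the mean of the new power would be the tangent of [(b + y)^x] at
    [b = 1 - m / (M - 1)] with [y = m / (M (M - 1))], and [b + y = 1 - m / M]; so
    the old power is recovered up to second order. *)
Lemma survival_step j s l (m : R) : (j < d - 1)%N -> reachable d s -> size s = l ->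
  early d n l -> 2 <= M l -> 0 <= m <= M l - 1 ->
  `|step_mean d (graph_of s)
      (fun e => (1 - m / (M l - 1)) ^+ below j.+1 (rcons s e))
    - (1 - m / M l) ^+ below j.+1 s|
  <= 8 * d%:R ^+ 3 * (m / M l) *
     (belowR j s / M l + belowR j.+1 s * belowR (d - 1) s / M l ^+ 2).
Proof.
move=> jd rs sl hl M2 /andP[m0 mM].
have M0 : 0 < M l by lra. have M1 : 0 < M l - 1 by lra.
have [ua au u2d] := open_bounds R d_ge2 rs sl hl; have up := u_gt0 R d_ge2 rs sl hl.
have und : (2 * d <= #|opens d s|)%N by rewrite -(ler_nat R) natrM.
have /andP[a1 a2] := deficit_remaining R d_ge2 hl.
set p := m / (M l - 1).
have p0 : 0 <= p by rewrite divr_ge0 // ltW.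
have p1 : p <= 1 by rewrite ler_pdivrMr // mul1r.
have pM : p <= 2 * (m / M l).
  rewrite ler_pdivrMr //.
  have -> : 2 * (m / M l) * (M l - 1) = m * (2 * (M l - 1) / M l) by ring.
  by rewrite ler_peMr // ler_pdivlMr // mul1r; lra.
have [x xE] : exists x, x = below j.+1 s by exists (below j.+1 s).
rewrite -xE; set b := 1 - p.
have b0 : 0 <= b by rewrite subr_ge0.
have b1 : b <= 1 by rewrite gerBl.
set w := belowR j s; set V := belowR (d - 1) s.
set dl := b ^+ x.-1 - b ^+ x.
have dl_bound : 0 <= dl <= p.
  rewrite /dl; case: (x) => [|y] /=; first by rewrite subrr lexx.
  have -> : b ^+ y - b ^+ y.+1 = b ^+ y * p by rewrite exprS /b; ring.
  by rewrite mulr_ge0 ?exprn_ge0 // ler_piMl // exprn_ile1.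
have /andP[dl0 dlp] := dl_bound.
have xV : x%:R ^+ 2 <= x%:R * V.
  by rewrite expr2 ler_wpM2l // ler_nat xE; exact: leq_below.
have xR0 : 0 <= x%:R :> R by [].
have V0 : 0 <= V by [].
have w0 : 0 <= w by [].
have xV0 : 0 <= x%:R * V by rewrite mulr_ge0.
have d0 : 0 <= d%:R :> R by [].
(* exact for one hit; two hits cost a second difference of the power *)
have lin e : e \in moves d s ->
  `|b ^+ below j.+1 (rcons s e) - (b ^+ x + dl * (hits j s e)%:R)|
     <= p * (hits j s e == 2)%:R.
  move=> es; have hx := below_hits j es; have h2 := hits_le2 j es.
  rewrite -xE in hx; rewrite /dl -hx; move: (below _ _) => y.
  case: (hits j s e) h2 => [|[|[|//]]] _ /=.
  - by rewrite addn0 mulr0 addr0 subrr normr0 mulr0.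
  - rewrite addn1 /= mulr1 mulr0.
    have -> : b ^+ y - (b ^+ y.+1 + (b ^+ y - b ^+ y.+1)) = 0 by ring.
    by rewrite normr0.
  - rewrite addn2 /= mulr1 !exprS.
    have -> : b ^+ y - (b * (b * b ^+ y) + (b * b ^+ y - b * (b * b ^+ y)) * 2)
      = p * (p * b ^+ y) by rewrite /b; ring.
    have t0 : 0 <= p * b ^+ y by rewrite mulr_ge0 ?exprn_ge0.
    rewrite ger0_norm; last exact: mulr_ge0.
    rewrite ler_piMr //; apply: le_trans p1; rewrite ler_piMr // exprn_ile1 //.
pose c : R := step_mean d (graph_of s) (fun e => (hits j s e)%:R).
have mean1 : `|step_mean d (graph_of s) (fun e => b ^+ below j.+1 (rcons s e))
   - (b ^+ x + dl * c)| <= p * (2 * x%:R ^+ 2 / u s ^+ 2).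
  apply: le_trans (_ : p * step_mean d (graph_of s) (fun e => (hits j s e == 2)%:R) <= _); last first.
    by rewrite ler_wpM2l // xE double_hits_mean.
  have -> : b ^+ x + dl * c = step_mean d (graph_of s) (fun e => b ^+ x + dl * (hits j s e)%:R).
    by rewrite (step_meanD _ _ (fun=> b ^+ x)) step_mean_cst // step_meanZ.
  rewrite -step_meanZ ler_norml.
  have sub (f g : {set 'I_n} -> R) : step_mean d (graph_of s) f - step_mean d (graph_of s) g
     = step_mean d (graph_of s) (fun e => f e - g e).
    rewrite -mulN1r -step_meanZ -step_meanD; apply: eq_step_mean => e _ /=.
    by rewrite mulN1r.
  rewrite sub -mulN1r -step_meanZ; apply/andP; split; apply: ler_step_mean => e es;
    have := lin e es; rewrite ler_norml => /andP[]; rewrite ?mulN1r //.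
have u2 : 2 * x%:R ^+ 2 / u s ^+ 2 <= d%:R ^+ 2 * (x%:R * V / M l ^+ 2).
  have uM : (u s)^-1 <= d%:R / (2 * M l).
    by rewrite ler_pdivlMr ?mulr_gt0 // mulrC ler_pdivrMr //; lra.
  apply: le_trans (_ : 2 * (x%:R * V) * (d%:R / (2 * M l)) ^+ 2 <= _).
    apply: ler_pM; rewrite ?mulr_ge0 ?sqr_ge0 ?invr_ge0 ?sqr_ge0 //.
      by rewrite ler_wpM2l.
    rewrite -exprVn ler_sqr ?nnegrE ?invr_ge0 //.
    by apply: le_trans uM; rewrite invr_ge0.
  have -> : 2 * (x%:R * V) * (d%:R / (2 * M l)) ^+ 2
    = d%:R ^+ 2 * (x%:R * V / M l ^+ 2) * (1 / 2) by field; rewrite gt_eqF.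
  by rewrite ler_piMr ?mulr_ge0 ?sqr_ge0 ?invr_ge0 ?sqr_ge0 //; lra.
have hm := hits_mean jd rs sl hl M0; rewrite -/c -xE -/w -/V in hm.
have mean2 : `|dl * c - dl * (x%:R / M l)| <= p * (d%:R / M l * w
     + (d%:R ^+ 3 + d%:R ^+ 2 + d%:R) * (x%:R * V) / M l ^+ 2).
  by rewrite -mulrBr normrM ger0_norm //; apply: ler_pM.
have mean3 : `|b ^+ x + dl * (x%:R / M l) - (1 - m / M l) ^+ x| <= p * (x%:R * V / M l ^+ 2).
  have pM0 : 0 <= p / M l by rewrite divr_ge0 // ltW.
  have yE : b + p / M l = 1 - m / M l.
    by rewrite /b /p; field; rewrite !gt_eqF.
  have y1 : b + p / M l <= 1 by rewrite yE gerBl divr_ge0 // ltW.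
  have := binomial_tangent x b0 pM0 y1; rewrite yE.
  have -> : b ^+ x + x%:R * (p / M l) * b ^+ x.-1 = b ^+ x + dl * (x%:R / M l).
    congr (_ + _); rewrite /dl; case: (x) => [|y] /=.
      by rewrite !mul0r mulr0.
    by rewrite exprS /b; ring.
  move=> /andP[t0 t1].
  rewrite distrC ger0_norm //; apply: le_trans t1 _.
  have -> : (x%:R * (p / M l)) ^+ 2 = p * (p * (x%:R ^+ 2 / M l ^+ 2)).
    by field; rewrite gt_eqF.
  rewrite ler_wpM2l //; apply: le_trans (_ : x%:R ^+ 2 / M l ^+ 2 <= _).
    by rewrite ler_piMl // divr_ge0 ?sqr_ge0.
  by rewrite ler_wpM2r // invr_ge0 sqr_ge0.
set F := step_mean _ _ _ in mean1 *.
have -> : F - (1 - m / M l) ^+ x = (F - (b ^+ x + dl * c)) + ((dl * c - dl * (x%:R / M l))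
   + (b ^+ x + dl * (x%:R / M l) - (1 - m / M l) ^+ x)) by ring.
apply: le_trans (ler_normD _ _) _; apply: le_trans (lerD (lexx _) (ler_normD _ _)) _.
set Q := x%:R * V / M l ^+ 2 in u2 mean3 *; set W := w / M l.
have Q0 : 0 <= Q by rewrite divr_ge0 ?sqr_ge0.
have W0 : 0 <= W by rewrite divr_ge0 // ltW.
have mean1' := le_trans mean1 (ler_wpM2l p0 u2).
apply: le_trans (_ : p * (4 * d%:R ^+ 3 * (W + Q)) <= _); last first.
  have -> : 8 * d%:R ^+ 3 * (m / M l) * (W + Q) = 2 * (m / M l) * (4 * d%:R ^+ 3 * (W + Q)).
    by ring.
  by rewrite ler_wpM2r // mulr_ge0 ?addr_ge0 // mulr_ge0 // exprn_ge0.
apply: le_trans (_ : p * (d%:R ^+ 2 * Q + (d%:R * W + (d%:R ^+ 3 + d%:R ^+ 2 + d%:R) * Q) + Q) <= _).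
  apply: le_trans (lerD mean1' (lerD mean2 mean3)) _.
  by rewrite le_eqVlt; apply/orP; left; apply/eqP; rewrite /Q /W; ring.
rewrite ler_wpM2l // mulrDr.
have d1 : 1 <= d%:R :> R by apply: le_trans d2R; rewrite ler1n.
have d23 : d%:R ^+ 2 * 2 <= d%:R ^+ 3 :> R.
  by rewrite [_ ^+ 3]exprSr ler_wpM2l // sqr_ge0.
have d12 : d%:R * 2 <= d%:R ^+ 2 :> R by rewrite expr2 ler_wpM2l.
have c1 : d%:R * W <= 4 * d%:R ^+ 3 * W by rewrite ler_wpM2r //; lra.
have c2 : (d%:R ^+ 2 + (d%:R ^+ 3 + d%:R ^+ 2 + d%:R) + 1) * Q <= 4 * d%:R ^+ 3 * Q.
  by rewrite ler_wpM2r //; lra.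
lra.
Qed.

End Hits.

(** * The second phase *)

Lemma ln_gap (R : realType) (x : R) : 1 < x -> x^-1 <= ln x - ln (x - 1).
Proof.
move=> x1; have x0 : 0 < x by lra.
have : ln ((x - 1) / x) <= - x^-1.
  have -> : (x - 1) / x = 1 + - x^-1 by field; rewrite gt_eqF.
  by apply: le_ln1Dx; rewrite ltrN2 invf_lt1.
by rewrite ln_div ?posrE //; lra.
Qed.

Lemma interval_ind (l0 l1 : nat) (P : nat -> Prop) : P l0 ->
  (forall l, (l0 <= l)%N -> (l < l1)%N -> P l -> P l.+1) ->
  forall l, (l0 <= l <= l1)%N -> P l.
Proof.
move=> P0 PS l /andP[/subnK <-]; elim: (l - l0)%N => // k IH kl.
by apply: PS; rewrite ?leq_addl //; apply: IH; exact: ltnW.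
Qed.

Section SecondPhaseRecursion.
Variables (R : realType) (d n l0 l1 : nat) (theta : R).
Hypothesis d_ge2 : (2 <= d)%N.
Hypothesis l01 : (l0 <= l1)%N.
Hypothesis early1 : early d n l1.
Hypothesis theta_gt0 : 0 < theta.
Hypothesis theta_le1 : theta <= 1.
Implicit Types (s : seq {set 'I_n}) (e : {set 'I_n}) (v : 'I_n).

Local Notation belowR q s := ((below q s)%:R : R).
Local Notation M := (remaining R d n).
Local Notation B := (16 / theta).
Local Notation m := (M l1).

Hypothesis m_large : (d%:R ^+ 2 + 1) * B <= m.

Let d_gt0 : (0 < d)%N. Proof. by apply: leq_trans d_ge2. Qed.
Let B16 : 16 <= B. Proof. by rewrite ler_pdivlMr // ler_piMr. Qed.
Let B2 : 2 <= B. Proof. by apply: le_trans B16; rewrite ler_nat. Qed.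
Let B0 : 0 < B. Proof. by apply: lt_le_trans B16. Qed.

Lemma early_before l : (l <= l1)%N -> early d n l.
Proof. by move=> h; apply: earlyW early1. Qed.

Lemma remaining_anti l l' : (l <= l')%N -> M l' <= M l.
Proof. by move=> h; rewrite ler_nat leq_sub2l. Qed.

Lemma remaining_ge l : (l <= l1)%N -> (d%:R ^+ 2 + 1) * B <= M l.
Proof. by move=> h; apply: le_trans m_large (remaining_anti h). Qed.

Lemma remaining_ge16 l : (l <= l1)%N -> 16 <= M l.
Proof.
move=> h; apply: le_trans (remaining_ge h); apply: le_trans B16 _.
by rewrite ler_peMl ?(ltW B0) // lerDr exprn_ge0.
Qed.

Lemma remaining_next l : (l < l1)%N -> M l.+1 = M l - 1.
Proof. by move=> h; apply: remainingS; apply: early_lt => //; apply: early_before; exact: ltnW. Qed.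

(** The power [theta] of the ratio of the missing edges at [l0] and at [l]: the
    loss tolerated in the decay of the loads. *)
Definition grow (l : nat) : R := expR (theta * (ln (M l0) - ln (M l))).

Definition growth : R := expR (theta * ln (M l0)).

Lemma grow_start : grow l0 = 1.
Proof. by rewrite /grow subrr mulr0 expR0. Qed.

Lemma grow_gt0 l : 0 < grow l.
Proof. exact: expR_gt0. Qed.

Lemma grow_le l : (l <= l1)%N -> grow l <= growth.
Proof.
move=> h; rewrite ler_expR ler_wpM2l ?(ltW theta_gt0) // gerBl ln_ge0 //.
by apply: le_trans (remaining_ge16 h); rewrite ler1n.
Qed.

Lemma grow_ge1 l : (l0 <= l <= l1)%N -> 1 <= grow l.
Proof.
move=> /andP[h h1]; have := remaining_ge16 h1; have := remaining_ge16 l01 => h2 h3.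
rewrite -expR0 ler_expR mulr_ge0 ?(ltW theta_gt0) // subr_ge0 ler_ln ?posrE; try lra.
exact: remaining_anti.
Qed.

Lemma grow_step l : (l < l1)%N -> grow l * (1 + theta / M l) <= grow l.+1.
Proof.
move=> h; have M16 := remaining_ge16 (ltnW h).
have -> : grow l.+1 = grow l * expR (theta * (ln (M l) - ln (M l - 1))).
  by rewrite /grow -expRD remaining_next //; congr expR; ring.
rewrite ler_wpM2l ?(ltW (grow_gt0 _)) //; apply: le_trans (expR_ge1Dx _).
by rewrite lerD2l ler_wpM2l ?(ltW theta_gt0) // ln_gap //; lra.
Qed.

(** [grow] gains a factor [1 + theta / M] at each step, which pays for the loss
    [2 / B = theta / 8] in the rate of [load_mean]. *)
Lemma load_decay q H l : (q <= d)%N -> 0 <= H ->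
  expect d l0 (load B q (n := n)) <= H * M l0 -> (l0 <= l <= l1)%N ->
  expect d l (load B q (n := n)) <= H * M l * grow l.
Proof.
move=> qd H0 h0; have {h0} : expect d l0 (load B q (n := n)) <= H * M l0 * grow l0.
  by rewrite grow_start mulr1.
move=> h0; move: l; apply: interval_ind => // l ll0 ll1 IH.
have el := early_before (ltnW ll1); have M16 := remaining_ge16 (ltnW ll1).
rewrite expectS.
apply: le_trans (_ : (1 - (1 - 2 / B) / M l) * expect d l (load B q (n := n)) <= _).
  rewrite -expectZ; apply: ler_expect => s rs sl.
  by apply: load_mean; rewrite ?remaining_ge // ltnW.
have c0 : 0 <= 1 - (1 - 2 / B) / M l.
  rewrite subr_ge0 ler_pdivrMr; last by lra.
  by rewrite mul1r; apply: le_trans (_ : 1 <= _); [rewrite gerBl divr_ge0 // ltW|lra].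
apply: le_trans (ler_wpM2l c0 IH) _.
have := grow_step ll1; rewrite remaining_next // => gs.
have M1 : 0 <= H * (M l - 1) by rewrite mulr_ge0 //; lra.
apply: le_trans (ler_wpM2l M1 gs).
have g0 := grow_gt0 l; set g := grow l in g0 *; set x := M l in M16 *.
have x0 : 0 < x by lra.
have Hg : 0 <= H * g by rewrite mulr_ge0 // ltW.
have -> : (1 - (1 - 2 / B) / x) * (H * x * g) = H * g * (x - 1 + theta / 8).
  by field; rewrite !gt_eqF.
have -> : H * (x - 1) * (g * (1 + theta / x)) = H * g * (x - 1 + theta * (1 - x^-1)).
  by field; rewrite gt_eqF.
rewrite ler_wpM2l // lerD2l ler_wpM2l ?(ltW theta_gt0) //.
have : x^-1 <= 16^-1 by rewrite lef_pV2 ?posrE //.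
by lra.
Qed.

(** The noise of [load_product_mean], divided by [M^2], sums like [1 / M^2]. *)
Lemma load_product_decay p q H f l : (p <= d)%N -> (q <= d)%N -> 0 <= H -> 0 <= f ->
  expect d l0 (load B p (n := n)) <= H * M l0 ->
  expect d l0 (fun s => load B p s * load B q s) <= f * M l0 ^+ 2 ->
  (l0 <= l <= l1)%N ->
  expect d l (fun s => load B p s * load B q s)
    <= M l ^+ 2 * grow l * (f + 2 * (4 * d%:R * B ^+ q * H * growth) * ((M l)^-1 - (M l0)^-1)).
Proof.
move=> pd qd H0 f0 hp hpq; set nu := 4 * d%:R * B ^+ q * H * growth.
have Bq : 0 <= B ^+ q by rewrite exprn_ge0 // ltW.
have gr0 : 0 <= growth by exact: expR_ge0.
have nu0 : 0 <= nu by rewrite /nu !mulr_ge0.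
move: l; apply: interval_ind => [|l ll0 ll1 IH].
  by rewrite grow_start subrr mulr0 addr0 mulr1 [leRHS]mulrC.
have el := early_before (ltnW ll1); have M16 := remaining_ge16 (ltnW ll1).
have lb : (l0 <= l <= l1)%N by rewrite ll0 ltnW.
have M0 : 0 < M l by lra.
rewrite expectS.
apply: le_trans (_ : (1 - 2 * ((1 - 2 / B) / M l)) * expect d l (fun s => load B p s * load B q s)
   + nu <= _).
  apply: le_trans (_ : expect d l (fun s =>
     (1 - 2 * ((1 - 2 / B) / M l)) * (load B p s * load B q s)
       + 4 * d%:R * B ^+ q / M l * load B p s) <= _).
    apply: ler_expect => s rs sl.
    by apply: load_product_mean; rewrite ?remaining_ge // ltnW.
  rewrite expectD !expectZ lerD2l.
  have hpl := load_decay pd H0 hp lb.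
  apply: le_trans (ler_wpM2l _ hpl) _; first by rewrite divr_ge0 ?mulr_ge0 // ltW.
  have -> : 4 * d%:R * B ^+ q / M l * (H * M l * grow l) = 4 * d%:R * B ^+ q * H * grow l.
    by field; rewrite !gt_eqF.
  by rewrite /nu ler_wpM2l ?grow_le ?(ltnW ll1) // !mulr_ge0.
have c0 : 0 <= 1 - 2 * ((1 - 2 / B) / M l).
  rewrite subr_ge0 mulrA ler_pdivrMr // mul1r.
  apply: le_trans (_ : 2 <= _); last by lra.
  by rewrite ler_piMr // gerBl divr_ge0 // ltW.
apply: le_trans (lerD (ler_wpM2l c0 IH) (lexx nu)) _.
have gs := grow_step ll1; have g1 := grow_ge1 lb.
rewrite remaining_next //.
set X := f + 2 * nu * ((M l)^-1 - (M l0)^-1).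
have X0 : 0 <= X.
  rewrite addr_ge0 // mulr_ge0 ?mulr_ge0 // subr_ge0 lef_pV2 ?posrE //.
    exact: remaining_anti.
  by have := remaining_ge16 l01; lra.
set g' := grow l.+1 in gs *; set g := grow l in g1 gs *; set x := M l in M16 M0 gs X c0 X0 *.
have -> : f + 2 * nu * ((x - 1)^-1 - (M l0)^-1) = X + 2 * nu / (x * (x - 1)).
  have a1 : (M l0)^-1 + ((x - 1)^-1 - (M l0)^-1) = (x - 1)^-1 by ring.
  rewrite /X.
  have -> : 2 * nu / (x * (x - 1)) = 2 * nu * ((x - 1)^-1 - x^-1).
    by field; rewrite !gt_eqF //; lra.
  by ring.
have n0 : 0 <= 2 * nu / (x * (x - 1)).
  by rewrite divr_ge0 ?mulr_ge0 //; lra.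
have x10 : 0 <= (x - 1) ^+ 2 by exact: sqr_ge0.
apply: le_trans (_ : (x - 1) ^+ 2 * (g * (1 + theta / x)) * (X + 2 * nu / (x * (x - 1))) <= _); last first.
  by apply: ler_wpM2r; [exact: addr_ge0|exact: ler_wpM2l].
rewrite [leRHS]mulrDr; apply: lerD.
  rewrite [leLHS]mulrA ler_wpM2r //.
  have -> : (1 - 2 * ((1 - 2 / B) / x)) * (x ^+ 2 * g) = g * (x ^+ 2 - 2 * x + theta * (x / 4)).
    by field; rewrite !gt_eqF.
  have -> : (x - 1) ^+ 2 * (g * (1 + theta / x))
    = g * ((x - 1) ^+ 2 + theta * ((x - 1) ^+ 2 / x)) by field; rewrite gt_eqF.
  rewrite ler_wpM2l //; first by lra.
  have e1 : x ^+ 2 - 2 * x <= (x - 1) ^+ 2 by rewrite -subr_ge0 (_ : _ - _ = 1) //; ring.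
  apply: lerD => //; rewrite ler_wpM2l ?(ltW theta_gt0) // ler_pdivlMr //.
  by nra.
have h1 : 1 <= g * (1 + theta / x).
  rewrite -[leLHS]mul1r ler_pM //.
  by rewrite lerDl divr_ge0 ?ltW.
apply: le_trans (_ : (x - 1) ^+ 2 * 1 * (2 * nu / (x * (x - 1))) <= _); last first.
  by rewrite ler_wpM2r // ler_wpM2l.
have -> : (x - 1) ^+ 2 * 1 * (2 * nu / (x * (x - 1))) = nu * (2 * (x - 1) / x).
  by field; rewrite !gt_eqF //; lra.
by rewrite ler_peMr // ler_pdivlMr //; lra.
Qed.

Variable j : nat.
Hypothesis jd : (j < d - 1)%N.
Variables (h1 h2 f : R).
Hypothesis h1_ge0 : 0 <= h1.
Hypothesis h2_ge0 : 0 <= h2.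
Hypothesis f_ge0 : 0 <= f.
Hypothesis below_start1 : expect d l0 (fun s => belowR j s) <= h1 * M l0.
Hypothesis below_start2 : expect d l0 (fun s => belowR j.+1 s) <= h2 * M l0.
Hypothesis below_start3 :
  expect d l0 (fun s => belowR j.+1 s * belowR (d - 1) s) <= f * M l0 ^+ 2.

Definition second_phase_rate : R :=
  growth * B ^+ (2 * d) * (h1 + f + 8 * d%:R * growth * h2 / m).

Let jd' : (j.+1 <= d)%N. Proof. by rewrite (leq_trans jd) // leq_subr. Qed.
Let Bpow q : (q <= d)%N -> B ^+ q <= B ^+ d.
Proof. by move=> h; rewrite ler_weXn2l // (le_trans _ B16) // ler1n. Qed.
Let B1 : 1 <= B ^+ d.
Proof. by rewrite exprn_ege1 // (le_trans _ B16) // ler1n. Qed.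

Lemma second_phase_terms l : (l0 <= l <= l1)%N ->
  expect d l (fun s => belowR j s / M l + belowR j.+1 s * belowR (d - 1) s / M l ^+ 2)
  <= second_phase_rate.
Proof.
move=> lb; have /andP[ll0 ll1] := lb; have M16 := remaining_ge16 ll1.
have M0 : 0 < M l by lra.
have Mm : (M l)^-1 <= m^-1.
  by rewrite lef_pV2 ?posrE ?remaining_anti //; have := remaining_ge16 (leqnn l1); lra.
have Bd0 : 0 <= B ^+ d by rewrite exprn_ge0 // ltW.
have gr0 : 0 <= growth by exact: expR_ge0.
have gl := grow_le ll1; have g0 := grow_gt0 l.
have start q h : (q <= d)%N -> 0 <= h ->
    expect d l0 (fun s => belowR q s) <= h * M l0 ->
    expect d l0 (load B q (n := n)) <= (B ^+ d * h) * M l0.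
  move=> qd hq hs; apply: le_trans (_ : expect d l0 (fun s => B ^+ d * belowR q s) <= _).
    apply: ler_expect => s _ _; apply: le_trans (load_le_below B2 _ _) _.
    by rewrite ler_wpM2r // Bpow.
  by rewrite expectZ -mulrA ler_wpM2l.
have s1 := start _ _ (ltnW jd') h1_ge0 below_start1.
have s2 := start _ _ jd' h2_ge0 below_start2.
have H1 : 0 <= B ^+ d * h1 by rewrite mulr_ge0.
have H2 : 0 <= B ^+ d * h2 by rewrite mulr_ge0.
have t1 := load_decay (ltnW jd') H1 s1 lb.
have F0 : 0 <= B ^+ d * B ^+ d * f by rewrite !mulr_ge0.
have s3 : expect d l0 (fun s => load B j.+1 s * load B (d - 1) s)
    <= B ^+ d * B ^+ d * f * M l0 ^+ 2.
  apply: le_trans (_ : expect d l0 (fun s =>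
     B ^+ d * B ^+ d * (belowR j.+1 s * belowR (d - 1) s)) <= _).
    apply: ler_expect => s _ _; rewrite mulrACA.
    apply: ler_pM; rewrite ?load_ge0 //; apply: le_trans (load_le_below B2 _ _) _;
      by rewrite ler_wpM2r // Bpow // leq_subr.
  by rewrite expectZ -mulrA ler_wpM2l // mulr_ge0.
have t2 := load_product_decay jd' (leq_subr 1 d) H2 F0 s2 s3 lb.
apply: le_trans (_ : expect d l (fun s => (M l)^-1 * load B j s
   + (M l ^+ 2)^-1 * (load B j.+1 s * load B (d - 1) s)) <= _).
  apply: ler_expect => s _ _; apply: lerD; rewrite mulrC.
    by rewrite ler_wpM2l ?invr_ge0 ?(ltW M0) // below_le_load.
  rewrite ler_wpM2l ?invr_ge0 ?sqr_ge0 //.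
  by apply: ler_pM; rewrite ?below_le_load.
rewrite expectD !expectZ.
have u1 : (M l)^-1 * expect d l (load B j (n := n)) <= growth * (B ^+ (2 * d) * h1).
  rewrite ler_pdivrMl //; apply: le_trans t1 _.
  have -> : B ^+ d * h1 * M l * grow l = M l * (grow l * (B ^+ d * h1)) by ring.
  rewrite ler_wpM2l ?(ltW M0) //; apply: ler_pM => //; first exact: ltW.
  by rewrite ler_wpM2r // mul2n -addnn exprD ler_peMr.
have u2 : (M l ^+ 2)^-1 * expect d l (fun s => load B j.+1 s * load B (d - 1) s)
   <= growth * (B ^+ (2 * d) * (f + 8 * d%:R * growth * h2 / m)).
  rewrite ler_pdivrMl ?exprn_gt0 //; apply: le_trans t2 _.
  rewrite -mulrA ler_wpM2l ?sqr_ge0 //.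
  have E : B ^+ (2 * d) * (f + 8 * d%:R * growth * h2 / m)
    = B ^+ d * B ^+ d * f + 2 * (4 * d%:R * B ^+ d * (B ^+ d * h2) * growth) * m^-1.
    by rewrite mul2n -addnn exprD; ring.
  have P0 q : 0 <= 2 * (4 * d%:R * B ^+ q * (B ^+ d * h2) * growth).
    by rewrite !mulr_ge0 // exprn_ge0 // ltW.
  have M00 : 0 < M l0 by have := remaining_ge16 l01; lra.
  apply: ler_pM => //; first exact: ltW.
    rewrite addr_ge0 // mulr_ge0 // subr_ge0 lef_pV2 ?posrE // remaining_anti //.
  rewrite E lerD2l; apply: ler_pM => //.
  - by rewrite subr_ge0 lef_pV2 ?posrE // remaining_anti.
  - rewrite ler_wpM2l // ler_wpM2r // ler_wpM2r // ler_wpM2l ?mulr_ge0 //.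
    by apply: Bpow; exact: leq_subr.
  - by apply: le_trans Mm; rewrite gerBl invr_ge0 ltW.
rewrite /second_phase_rate.
have -> : growth * B ^+ (2 * d) * (h1 + f + 8 * d%:R * growth * h2 / m) =
  growth * (B ^+ (2 * d) * h1) + growth * (B ^+ (2 * d) * (f + 8 * d%:R * growth * h2 / m)).
  by ring.
exact: lerD.
Qed.

(** The power is the indicator of [below j.+1 = 0] when [M = m], its base being
    [0]; in mean, the errors of [survival_step] are at most a constant times
    [second_phase_rate * m / M], and the sum of [1 / M] is a logarithm. *)
Lemma second_phase :
  `|expect d l1 (fun s => (below j.+1 s == 0%N)%:R)
    - expect d l0 (fun s => (1 - m / M l0) ^+ below j.+1 s)|
  <= 8 * d%:R ^+ 3 * m * second_phase_rate * ln (M l0).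
Proof.
have m16 := remaining_ge16 (leqnn l1).
have lhsE : expect d l1 (fun s => (below j.+1 s == 0%N)%:R)
   = expect d l1 (fun s => (1 - m / M l1) ^+ below j.+1 s).
  apply: eq_expect => s _ _; rewrite divff ?subrr ?expr0n //.
  by rewrite gt_eqF //; lra.
have c0 : 0 <= 8 * d%:R ^+ 3 * m * second_phase_rate.
  have gr0 : 0 <= growth by exact: expR_ge0.
  have m0 : 0 <= m by lra.
  have rate0 : 0 <= second_phase_rate.
    apply: mulr_ge0; first by rewrite mulr_ge0 // exprn_ge0 // ltW.
    by apply: addr_ge0; [exact: addr_ge0|rewrite divr_ge0 // !mulr_ge0].
  by apply: mulr_ge0 rate0; rewrite mulr_ge0 // mulr_ge0 // exprn_ge0.
suff main l : (l0 <= l <= l1)%N ->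
  `|expect d l (fun s => (1 - m / M l) ^+ below j.+1 s)
    - expect d l0 (fun s => (1 - m / M l0) ^+ below j.+1 s)|
  <= 8 * d%:R ^+ 3 * m * second_phase_rate * (ln (M l0) - ln (M l)).
  have l11 : (l0 <= l1 <= l1)%N by rewrite l01 leqnn.
  rewrite lhsE; apply: le_trans (main _ l11) _.
  by rewrite ler_wpM2l // gerBl ln_ge0 //; lra.
move: l; apply: interval_ind => [|l ll0 ll1 IH].
  by rewrite !subrr normr0 mulr0.
have el := early_before (ltnW ll1); have M16 := remaining_ge16 (ltnW ll1).
have lb : (l0 <= l <= l1)%N by rewrite ll0 ltnW.
set E0 := expect d l0 _ in IH *; set F := expect d l _ in IH.
rewrite expectS.
have -> : ln (M l0) - ln (M l.+1) = (ln (M l) - ln (M l.+1)) + (ln (M l0) - ln (M l)) by ring.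
set G := expect d l _.
have -> : G - E0 = (G - F) + (F - E0) by ring.
rewrite mulrDr; apply: le_trans (ler_normD _ _) _; apply: lerD => //.
rewrite /G /F -expectB.
apply: le_trans (expect_norm _ _ _) _.
apply: le_trans (_ : expect d l (fun s => 8 * d%:R ^+ 3 * (m / M l) *
   (belowR j s / M l + belowR j.+1 s * belowR (d - 1) s / M l ^+ 2)) <= _).
  apply: ler_expect => s rs sl; rewrite remaining_next //.
  apply: survival_step => //; first by lra.
  by rewrite -remaining_next // remaining_anti // andbT; lra.
rewrite expectZ.
have t := second_phase_terms lb.
apply: le_trans (ler_wpM2l _ t) _.
  by rewrite mulr_ge0 ?divr_ge0 // mulr_ge0 // exprn_ge0.
have -> : 8 * d%:R ^+ 3 * (m / M l) * second_phase_rate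
  = 8 * d%:R ^+ 3 * m * second_phase_rate * (M l)^-1 by ring.
rewrite ler_wpM2l // remaining_next // ln_gap //; lra.
Qed.

End SecondPhaseRecursion.

(** * Asymptotics with an explicit error *)

Lemma expR_dist_le (R : realType) (a b : R) : 0 <= a -> 0 <= b ->
  `|expR (- a) - expR (- b)| <= `|a - b|.
Proof.
wlog ab : a b / a <= b.
  move=> h a0 b0; case/orP: (le_total a b) => ab; first exact: h.
  by rewrite distrC [leRHS]distrC; apply: h.
move=> a0 b0; rewrite ger0_norm; last by rewrite subr_ge0 ler_expR lerN2.
rewrite distrC ger0_norm ?subr_ge0 //.
have -> : expR (- b) = expR (- a) * expR (- (b - a)) by rewrite -expRD; congr expR; ring.
have h := expR_ge1Dx (- (b - a)).
have e1 : expR (- a) <= 1 by rewrite -expR0 ler_expR oppr_le0.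
have e0 := expR_ge0 (- a).
have -> : expR (- a) - expR (- a) * expR (- (b - a)) = expR (- a) * (1 - expR (- (b - a))).
  by ring.
have d0 : 0 <= 1 - expR (- (b - a)).
  by rewrite subr_ge0 -expR0 ler_expR; lra.
by apply: le_trans (_ : 1 - expR (- (b - a)) <= _); [rewrite ler_piMl|lra].
Qed.

Lemma power_exp_dist (R : realType) (p : R) (x : nat) : 0 <= p <= 1 ->
  `|(1 - p) ^+ x - expR (- (p * x%:R))| <= x%:R * p ^+ 2.
Proof.
move=> /andP[p0 p1].
have -> : expR (- (p * x%:R)) = expR (- p) ^+ x by rewrite -mulNr expRM_natr.
case: x => [|x]; first by rewrite !expr0 subrr normr0 mul0r.
have e0 := expR_ge0 (- p).
have e1 : expR (- p) <= 1 by rewrite -expR0 ler_expR oppr_le0.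
apply: le_trans (@expr_dist_le R 1 _ _ x _ _) _; [by lra|by rewrite e0 e1|].
rewrite expr1n mulr1 ler_wpM2l //.
have lo := expR_ge1Dx (- p); have hi := expR_ge1Dx p.
have up : expR (- p) <= 1 - p + p ^+ 2.
  rewrite expRN -[leLHS]mul1r ler_pdivrMr ?expR_gt0 //.
  apply: le_trans (_ : (1 - p + p ^+ 2) * (1 + p) <= _).
    have -> : (1 - p + p ^+ 2) * (1 + p) = 1 + p ^+ 3 by ring.
    by rewrite lerDl exprn_ge0.
  by rewrite ler_wpM2l // addr_ge0 ?sqr_ge0 ?subr_ge0.
by rewrite ler_norml; apply/andP; split; have := sqr_ge0 p; lra.
Qed.

Section Uniform.
Variables (R : realType) (d j : nat) (c C : R).
Hypothesis d_ge2 : (2 <= d)%N.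
Hypothesis jd : (j < d - 1)%N.
Hypothesis c_gt0 : 0 < c.
Hypothesis C_gt0 : 0 < C.

Local Notation k := (d - 1 - j)%N.
Local Notation kap := (((d - 1) ^_ k)%:R : R).
Local Notation K := (2 * d + 7)%N.
Local Notation theta := ((4 * K%:R)^-1 : R).
Local Notation B := (16 / theta).
Local Notation bc := (@below_const R d).

Definition threshold : R :=
  4 * K%:R + 6 + d%:R + (3 * d%:R) ^+ (2 * d + 6) + (d%:R ^+ 2 + 1) * B / c + 2 * C.

Definition error_const : R :=
  8 * d%:R ^+ 3 * C * (4 * K%:R) * B ^+ (2 * d)
    * (3 * (bc j + 1) + 9 * (bc j.+1 + bc (d - 1)) + 8 * d%:R * (3 * (bc j.+1 + 1)) / c)
  + (C ^+ 2 * (6 * (bc j.+1 + 1))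
  + (3 * C * (fraction_const R d k + bc j + 1) + 2 * C * kap)).

Let d_gt0 : (0 < d)%N. Proof. by apply: leq_trans d_ge2. Qed.
Let d2R : (2 : R) <= d%:R. Proof. by rewrite ler_nat. Qed.
Let k_gt0 : (0 < k)%N. Proof. by rewrite subn_gt0. Qed.
Let k_lt : (k < d)%N.
Proof. by rewrite (leq_ltn_trans (leq_subr _ _)) // subn1 prednK. Qed.
Let Kr7 : (7 : R) <= K%:R. Proof. by rewrite ler_nat leq_addl. Qed.
Let theta_gt0 : 0 < theta. Proof. by rewrite invr_gt0 mulr_gt0 // ltr0n addn_gt0 orbT. Qed.

(** With [z] the fourth root of [log n], all errors become powers of [z]: the
    losses [growth] and [ln m0] are [O(z)], a factor [1 / log n] is [z^-4], and
    [mean_clock] deviates from [log n] by at most [z^2]. *)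
Section AtN.
Variables (n m : nat) (z : R).
Local Notation L := (ln n%:R : R).
Hypothesis LE : L = z ^+ 4.
Hypothesis z_large : threshold <= z.
Hypothesis m_ge : c * L ^+ k <= m%:R.
Hypothesis m_le : m%:R <= C * L ^+ k.

Let B_gt0 : 0 < B. Proof. by rewrite divr_gt0. Qed.

Let threshold_terms : [/\ 4 * K%:R + 6 + d%:R <= z, (3 * d%:R) ^+ (2 * d + 6) <= z,
  (d%:R ^+ 2 + 1) * B / c <= z & 2 * C <= z].
Proof.
have t1 : 0 <= 4 * K%:R + 6 + d%:R :> R by rewrite !addr_ge0 // mulr_ge0.
have t2 : 0 <= (3 * d%:R) ^+ (2 * d + 6) :> R by rewrite exprn_ge0 // mulr_ge0.
have t3 : 0 <= (d%:R ^+ 2 + 1) * B / c.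
  by rewrite divr_ge0 ?(ltW c_gt0) // mulr_ge0 ?(ltW B_gt0) // addr_ge0 ?exprn_ge0.
have t4 : 0 <= 2 * C by rewrite mulr_ge0 // ltW.
move: z_large; rewrite /threshold.
move: (4 * K%:R + 6 + d%:R) ((3 * d%:R) ^+ (2 * d + 6)) ((d%:R ^+ 2 + 1) * B / c) (2 * C) t1 t2 t3 t4.
move=> x1 x2 x3 x4 *; split; lra.
Qed.

Let z_ge : 34 <= z.
Proof. by case: threshold_terms => h _ _ _; have := Kr7; have := d2R => ? ?; lra. Qed.
Let z_gt0 : 0 < z. Proof. by apply: lt_le_trans z_ge. Qed.
Let z_ge1 : 1 <= z. Proof. by apply: le_trans z_ge; rewrite ler1n. Qed.
Let L_gt0 : 0 < L. Proof. by rewrite LE exprn_gt0. Qed.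
Let yE : Num.sqrt L = z ^+ 2.
Proof. by rewrite LE (exprM z 2 2) sqrtr_sqr ger0_norm // sqr_ge0. Qed.
Let zL : z <= L. Proof. by rewrite LE exprS ler_peMr ?(ltW z_gt0) // exprn_ege1. Qed.
Let L_ge1 : 1 <= L. Proof. exact: le_trans zL. Qed.
Let n_gt0 : (0 < n)%N.
Proof. by case: (n) L_gt0 => //; rewrite ln0 // ltxx. Qed.
Let nE : n%:R = expR L :> R. Proof. by rewrite lnK // posrE ltr0n. Qed.

Let z_pow q : z ^+ q = expR (q%:R * ln z).
Proof. by rewrite expRM_natl lnK // posrE. Qed.

Let L_pow_le : L ^+ K <= n%:R.
Proof.
rewrite [leRHS]nE LE -exprM z_pow ler_expR natrM.
apply: le_trans (_ : 4 * K%:R * z <= _).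
  by rewrite ler_wpM2l ?mulr_ge0 // ltW // ln_sublinear.
rewrite (exprSr z 3) ler_wpM2r ?(ltW z_gt0) //.
case: threshold_terms => h _ _ _; apply: le_trans (_ : z <= _); first by have := d2R; lra.
by rewrite ler_eXnr.
Qed.

(* missing edges at the end of the first phase: few enough that their logarithm
   is O(ln (log n)), many enough to exceed the powers of L in below_fraction *)
Let m0 := Num.truncn (L ^+ K).
Let LK1 : 1 <= L ^+ K. Proof. exact: exprn_ege1. Qed.
Let m0_bounds : L ^+ K / 2 <= m0%:R <= L ^+ K.
Proof.
have /andP[h1 h2] := truncn_itv (ltW (lt_le_trans ltr01 LK1)).
rewrite h1 andbT; have m1 : (1 <= m0)%N by rewrite /m0 truncn_gt0.
have : (1 : R) <= m0%:R by rewrite ler1n.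
move: h2; rewrite -/m0 -natr1; lra.
Qed.

Let N_ge : (n <= max_edges d n)%N.
Proof. by rewrite /max_edges leq_divRL // mulnC leq_mul. Qed.

Let m0_le : (m0 <= max_edges d n)%N.
Proof.
apply: leq_trans N_ge; rewrite -(ler_nat R).
by have /andP[_ h] := m0_bounds; apply: le_trans L_pow_le.
Qed.

Let m_m0 : (m <= m0)%N.
Proof.
rewrite -(ler_nat R); have /andP[h _] := m0_bounds; apply: le_trans h.
apply: le_trans m_le _; rewrite ler_pdivlMr // mulrAC.
case: threshold_terms => _ _ _ C2.
apply: le_trans (_ : L * L ^+ k <= _).
  by rewrite ler_wpM2r ?exprn_ge0 ?(ltW L_gt0) // mulrC (le_trans C2).
rewrite -exprS ler_weXn2l //; apply: leq_trans k_lt _.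
by rewrite mul2n -addnn -addnA leq_addr.
Qed.

Let l0 := (max_edges d n - m0)%N.
Let l1 := (max_edges d n - m)%N.
Let M0E : remaining R d n l0 = m0%:R.
Proof. by rewrite /remaining /l0 subKn. Qed.
Let m_le_N : (m <= max_edges d n)%N. Proof. exact: leq_trans m0_le. Qed.
Lemma m_le_max : (m <= max_edges d n)%N.
Proof. exact: m_le_N. Qed.

Let M1E : remaining R d n l1 = m%:R.
Proof. by rewrite /remaining /l1 subKn. Qed.
Let l01 : (l0 <= l1)%N. Proof. by rewrite /l0 /l1 leq_sub2l. Qed.

Let m_large : (d%:R ^+ 2 + 1) * B <= m%:R.
Proof.
case: threshold_terms => _ _ h _; apply: le_trans m_ge; move: h; rewrite ler_pdivrMr // mulrC => h.
apply: le_trans h _; rewrite mulrC ler_wpM2l ?(ltW c_gt0) //.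
by apply: le_trans zL _; rewrite ler_eXnr.
Qed.

Lemma early_end : early d n l1.
Proof.
have B1 : 1 <= B.
  rewrite invrK; have := Kr7; lra.
have dm : (d ^ 2 <= m)%N.
  rewrite -(ler_nat R) natrX; apply: le_trans m_large.
  by apply: le_trans (_ : d%:R ^+ 2 + 1 <= _); [lra|rewrite ler_peMr // addr_ge0 ?exprn_ge0].
have := leq_trunc_div (d * n) 2; rewrite -/(max_edges d n) mulnC => h.
apply: leq_trans h; rewrite -mulnDr leq_mul2l /=.
by rewrite /l1 addnC -leq_subRL ?leq_subr // subKn.
Qed.

Let early0 : early d n l0. Proof. exact: earlyW early_end. Qed.

Let ln_z4 : ln L = 4 * ln z.
Proof. by rewrite LE lnXn // [RHS]mulr_natl. Qed.

Let ln_d : ln d%:R <= d%:R :> R.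
Proof. by rewrite ltW // ln_sublinear // ltr0n. Qed.
Let ln_d0 : 0 <= ln d%:R :> R. Proof. by rewrite ln_ge0 // ler1n. Qed.
Let ln_dn : ln (d * n)%:R = ln d%:R + L.
Proof. by rewrite natrM lnM // posrE ltr0n. Qed.

Let clock_bound s : reachable d s -> (size s <= l0)%N ->
  clock R d (s : seq {set 'I_n}) + d%:R <= 3 * d%:R * L.
Proof.
move=> rs sl; have es : early d n (size s) by apply: earlyW early0.
apply: le_trans (lerD (clock_le R d_ge2 rs erefl es) (lexx _)) _.
have a8 := early_deficit_ge8 R d_ge2 es.
have la : 0 <= ln (deficit R d n (size s)) by rewrite ln_ge0 //; lra.
have -> : 3 * d%:R * L = d%:R * (3 * L - 1) + d%:R by ring.
rewrite lerD2r ler_wpM2l // ln_dn.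
case: threshold_terms => h _ _ _; have := zL; have := ln_d; have := Kr7; lra.
Qed.

Let def_bounds : 2 * m0%:R <= deficit R d n l0 <= 3 * m0%:R.
Proof.
have := deficit_remaining R d_ge2 early0; rewrite M0E => /andP[-> h] /=.
apply: le_trans h _.
have : (1 : R) <= m0%:R by rewrite ler1n /m0 truncn_gt0.
lra.
Qed.

Let deficit_large : (3 * d%:R * L) ^+ (2 * d + 6) <= deficit R d n l0.
Proof.
have /andP[h _] := def_bounds; apply: le_trans h.
have /andP[h _] := m0_bounds; apply: le_trans (_ : L ^+ K <= _); last by lra.
have -> : L ^+ K = L * L ^+ (2 * d + 6) by rewrite -exprS -addnS.
rewrite exprMn ler_wpM2r ?exprn_ge0 ?(ltW L_gt0) //.
by case: threshold_terms => _ h' _ _; apply: le_trans h' zL.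
Qed.

Let mean_clock_near : L - z ^+ 2 <= mean_clock R d n l0 <= L + z ^+ 2.
Proof.
have /andP[a1 a2] := def_bounds; have /andP[b1 b2] := m0_bounds.
have lo := mean_clock_ge R d_ge2 early0; have hi := mean_clock_le R d_ge2 early0.
have a8 := early_deficit_ge8 R d_ge2 early0.
set a := deficit R d n l0 in a1 a2 lo hi a8.
have la : 0 <= ln a by rewrite ln_ge0 //; lra.
have lz : ln z <= z by rewrite ltW // ln_sublinear.
have lz0 : 0 <= ln z by rewrite ln_ge0.
have la2 : ln (a + 2) <= 5 + 4 * K%:R * z.
  apply: le_trans (_ : ln (5 * L ^+ K) <= _).
    by rewrite ler_ln ?posrE ?mulr_gt0 ?exprn_gt0 //; lra.
  rewrite lnM ?posrE ?exprn_gt0 // lnXn // -[ln L *+ _]mulr_natl ln_z4.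
  apply: lerD; first by rewrite ltW // ln_sublinear.
  by rewrite mulrA [K%:R * 4]mulrC ler_wpM2l // mulr_ge0.
have big : 5 + 4 * K%:R * z + d%:R <= z ^+ 2.
  case: threshold_terms => h _ _ _; apply: le_trans (_ : (4 * K%:R + 6 + d%:R) * z <= _); last first.
    by rewrite expr2 ler_wpM2r // ltW.
  have : d%:R <= d%:R * z by rewrite ler_peMr.
  have -> : (4 * K%:R + 6 + d%:R) * z = 6 * z + 4 * K%:R * z + d%:R * z by ring.
  by have := z_ge1; lra.
have kz : 0 <= 4 * K%:R * z by rewrite !mulr_ge0 // ltW.
by move: lo hi; rewrite ln_dn => lo hi; have := ln_d; have := ln_d0; lra.
Qed.

Let mean_clock_half : L / 2 <= mean_clock R d n l0.
Proof.
have /andP[h _] := mean_clock_near; apply: le_trans h.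
have : 2 * z ^+ 2 <= L.
  rewrite LE (exprD z 2 2) ler_wpM2r ?sqr_ge0 //.
  have : z <= z ^+ 2 by rewrite ler_eXnr.
  by have := z_ge; lra.
lra.
Qed.

Let mean_clock_square : (mean_clock R d n l0 - L) ^+ 2 <= L.
Proof.
have /andP[h1 h2] := mean_clock_near.
rewrite [leRHS]LE (exprM z 2 2) -real_normK ?num_real //.
rewrite ler_sqr ?nnegrE ?normr_ge0 ?sqr_ge0 //.
by rewrite ler_norml; apply/andP; split; lra.
Qed.

Local Notation a := (deficit R d n l0).
Local Notation x s := ((below j.+1 s)%:R : R).

Let a_gt0 : 0 < a.
Proof. by apply: lt_le_trans (early_deficit_ge8 R d_ge2 early0). Qed.
Let Lk q : 0 < L ^+ q. Proof. by rewrite exprn_gt0. Qed.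
Let m0_gt0 : 0 < m0%:R :> R.
Proof. by have /andP[h _] := m0_bounds; apply: lt_le_trans h; rewrite divr_gt0. Qed.
Let a3 : a <= 3 * m0%:R. Proof. by case/andP: def_bounds. Qed.
Let djE : (d - j = k.+1)%N.
Proof. by rewrite -subSn ?(ltnW jd) // subn1 prednK. Qed.
Let dj1E : (d - j.+1 = k)%N. Proof. by rewrite -subnDA add1n. Qed.
Let jd1 : (j.+1 <= d)%N. Proof. by rewrite (leq_trans jd) // leq_subr. Qed.
Let bc0 q : 0 <= bc q. Proof. exact: below_const_ge0. Qed.

Let start_below : expect d l0 (fun s : seq {set 'I_n} => (below j s)%:R)
  <= 3 * (bc j + 1) / L ^+ k.+1 * remaining R d n l0.
Proof.
have := below_mean d_ge2 early0 L_ge1 clock_bound deficit_large mean_clock_half (ltnW jd1).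
rewrite djE M0E => h; apply: le_trans h _.
have -> : 3 * (bc j + 1) / L ^+ k.+1 * m0%:R = (bc j + 1) * (3 * m0%:R / L ^+ k.+1) by ring.
by rewrite ler_wpM2l ?(addr_ge0 (bc0 _) ler01) // ler_wpM2r // invr_ge0 ltW.
Qed.

Let start_upto : expect d l0 (fun s : seq {set 'I_n} => x s)
  <= 3 * (bc j.+1 + 1) / L ^+ k * remaining R d n l0.
Proof.
have := below_mean d_ge2 early0 L_ge1 clock_bound deficit_large mean_clock_half jd1.
rewrite dj1E M0E => h; apply: le_trans h _.
have -> : 3 * (bc j.+1 + 1) / L ^+ k * m0%:R = (bc j.+1 + 1) * (3 * m0%:R / L ^+ k) by ring.
by rewrite ler_wpM2l ?(addr_ge0 (bc0 _) ler01) // ler_wpM2r // invr_ge0 ltW.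
Qed.

Let start_product : expect d l0 (fun s : seq {set 'I_n} => x s * (below (d - 1) s)%:R)
  <= 9 * (bc j.+1 + bc (d - 1)) / L ^+ k.+1 * remaining R d n l0 ^+ 2.
Proof.
have e1 := below_second_moment d_ge2 early0 L_ge1 clock_bound deficit_large mean_clock_half jd1.
have e2 := below_second_moment d_ge2 early0 L_ge1 clock_bound deficit_large mean_clock_half (leq_subr 1 d).
rewrite dj1E in e1; rewrite subKn // expr1 in e2.
set w := L ^+ k.-1; have w0 : 0 < w by exact: Lk.
apply: le_trans (_ : expect d l0 (fun s : seq {set 'I_n} =>
   w * x s ^+ 2 + w^-1 * (below (d - 1) s)%:R ^+ 2) <= _).
  by apply: ler_expect => s _ _; rewrite [w^-1 * _]mulrC mulr_le_squares.
rewrite expectD !expectZ M0E.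
have wk : L ^+ k = L * w by rewrite -exprS prednK.
have wk1 : L ^+ k.+1 = L * (L * w) by rewrite exprS wk.
have wi0 : 0 <= w^-1 by rewrite invr_ge0 ltW.
apply: le_trans (lerD (ler_wpM2l (ltW w0) e1) (ler_wpM2l wi0 e2)) _.
have -> : w * (bc j.+1 * (a / L ^+ k) ^+ 2) + w^-1 * (bc (d - 1) * (a / L) ^+ 2)
   = (bc j.+1 + bc (d - 1)) / L ^+ k.+1 * a ^+ 2.
  by rewrite wk1 wk; move: (w) w0 => w1 w10; field; rewrite !gt_eqF.
have -> : 9 * (bc j.+1 + bc (d - 1)) / L ^+ k.+1 * m0%:R ^+ 2
  = (bc j.+1 + bc (d - 1)) / L ^+ k.+1 * (3 * m0%:R) ^+ 2 by ring.
apply: ler_wpM2l.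
  by apply: mulr_ge0; [exact: addr_ge0|rewrite invr_ge0 ltW].
by rewrite ler_sqr ?nnegrE ?(ltW a_gt0) // mulr_ge0.
Qed.

Let growth_le : growth d n l0 theta <= z.
Proof.
have zE : z = expR (ln z) by rewrite lnK // posrE.
rewrite /growth M0E [leRHS]zE ler_expR.
have /andP[_ h] := m0_bounds.
have : ln m0%:R <= 4 * K%:R * ln z.
  apply: le_trans (_ : ln (L ^+ K) <= _); first by rewrite ler_ln ?posrE.
  by rewrite lnXn // -[ln L *+ _]mulr_natl ln_z4 mulrA [_ * 4]mulrC.
have K0 : 0 < 4 * K%:R :> R by have := Kr7; lra.
by rewrite ler_pdivrMl.
Qed.

Let ln_m0 : 0 <= ln (m0%:R : R) <= 4 * K%:R * z.
Proof.
have /andP[_ h] := m0_bounds.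
rewrite ln_ge0 /=; last by rewrite ler1n /m0 truncn_gt0.
apply: le_trans (_ : ln (L ^+ K) <= _); first by rewrite ler_ln ?posrE.
rewrite lnXn // -[ln L *+ _]mulr_natl ln_z4 mulrA [_ * 4]mulrC.
by rewrite ler_wpM2l ?mulr_ge0 // ltW // ln_sublinear.
Qed.

Let m_gt0 : 0 < m%:R :> R.
Proof. by apply: lt_le_trans m_ge; rewrite mulr_gt0. Qed.

Let Lk1 : L ^+ k.+1 = z ^+ 4 * L ^+ k.
Proof. by rewrite exprS -LE. Qed.

Let rate_const_ge0 : 0 <= 3 * (bc j + 1) + 9 * (bc j.+1 + bc (d - 1)) + 8 * d%:R * (3 * (bc j.+1 + 1)) / c.
Proof.
have h1 : 0 <= bc j + 1 by apply: addr_ge0.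
have h2 : 0 <= bc j.+1 + bc (d - 1) by apply: addr_ge0.
have h3 : 0 <= bc j.+1 + 1 by apply: addr_ge0.
apply: addr_ge0; first by apply: addr_ge0; apply: mulr_ge0.
apply: mulr_ge0; last by rewrite invr_ge0 ltW.
by apply: mulr_ge0; [apply: mulr_ge0|apply: mulr_ge0].
Qed.

Let second_phase_error :
  `|expect d l1 (fun s : seq {set 'I_n} => (below j.+1 s == 0%N)%:R)
    - expect d l0 (fun s : seq {set 'I_n} => (1 - m%:R / m0%:R) ^+ below j.+1 s)|
  <= 8 * d%:R ^+ 3 * C * (4 * K%:R) * B ^+ (2 * d)
    * (3 * (bc j + 1) + 9 * (bc j.+1 + bc (d - 1)) + 8 * d%:R * (3 * (bc j.+1 + 1)) / c) / z.
Proof.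
have h1 : 0 <= 3 * (bc j + 1) / L ^+ k.+1.
  by rewrite divr_ge0 ?(ltW (Lk _)) // mulr_ge0 // (addr_ge0 (bc0 _)).
have h2 : 0 <= 3 * (bc j.+1 + 1) / L ^+ k.
  by rewrite divr_ge0 ?(ltW (Lk _)) // mulr_ge0 // (addr_ge0 (bc0 _)).
have h3 : 0 <= 9 * (bc j.+1 + bc (d - 1)) / L ^+ k.+1.
  by rewrite divr_ge0 ?(ltW (Lk _)) // mulr_ge0 // (addr_ge0 (bc0 _)).
have theta1 : theta <= 1 by rewrite invf_le1; have := Kr7; lra.
have ml : (d%:R ^+ 2 + 1) * B <= remaining R d n l1 by rewrite M1E.
have := second_phase d_ge2 l01 early_end theta_gt0 theta1 ml jd h1 h2 h3 start_below start_upto start_product.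
rewrite M1E M0E => h; apply: le_trans h _.
rewrite /second_phase_rate M1E.
set G := growth _ _ _ _; have G0 : 0 <= G by exact: expR_ge0.
have Gz : G <= z by exact: growth_le.
set b1 := 3 * (bc j + 1); set b2 := 9 * _; set b3 := 3 * (bc j.+1 + 1).
have b1_ge0 : 0 <= b1 by apply: mulr_ge0 => //; apply: addr_ge0.
have b2_ge0 : 0 <= b2 by apply: mulr_ge0 => //; apply: addr_ge0.
have b3_ge0 : 0 <= b3 by apply: mulr_ge0 => //; apply: addr_ge0.
have BB : 0 <= B ^+ (2 * d) by rewrite exprn_ge0 // ltW.
move: (B ^+ (2 * d)) BB => b BB.
have /andP[lm0 lm] := ln_m0.
have P0 := Lk k; set P := L ^+ k in P0 *.
have Pz : z ^+ 4 <= P.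
  by rewrite -LE -[leLHS]expr1 ler_weXn2l.
have i3 : 8 * d%:R * G * (b3 / P) / m%:R <= z * (8 * d%:R * b3 / c) / (z ^+ 4 * P).
  have -> : 8 * d%:R * G * (b3 / P) / m%:R = (8 * d%:R * b3) * (G * (P * m%:R)^-1).
    by field; rewrite !gt_eqF.
  have -> : z * (8 * d%:R * b3 / c) / (z ^+ 4 * P) = (8 * d%:R * b3) * (z * (c * (z ^+ 4 * P))^-1).
    by field; rewrite !gt_eqF.
  apply: ler_wpM2l; first by rewrite mulr_ge0 // mulr_ge0.
  apply: ler_pM => //; first by rewrite invr_ge0 mulr_ge0 // ltW.
  rewrite lef_pV2 ?posrE ?mulr_gt0 ?exprn_gt0 //.
  apply: le_trans (_ : P * (c * P) <= _); last by rewrite ler_wpM2l // ltW.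
  by rewrite [leRHS]mulrCA ler_wpM2l ?(ltW c_gt0) // ler_wpM2r // ltW.
have i12 : b1 / L ^+ k.+1 + b2 / L ^+ k.+1 + 8 * d%:R * G * (b3 / P) / m%:R
   <= z * (b1 + b2 + 8 * d%:R * b3 / c) / (z ^+ 4 * P).
  have -> : z * (b1 + b2 + 8 * d%:R * b3 / c) / (z ^+ 4 * P) =
    z * (b1 + b2) / (z ^+ 4 * P) + z * (8 * d%:R * b3 / c) / (z ^+ 4 * P) by ring.
  apply: lerD => //; rewrite Lk1 -/P -mulrDl.
  apply: ler_wpM2r; first by rewrite invr_ge0 mulr_ge0 ?exprn_ge0 // ltW.
  by rewrite ler_peMl // addr_ge0.
move: rate_const_ge0; rewrite -/b1 -/b2 -/b3.
move: (b1 + b2 + _) i12 => S i12 S0.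
set D := 8 * d%:R ^+ 3; have D0 : 0 <= D by rewrite /D mulr_ge0 // exprn_ge0.
apply: le_trans (_ : D * (C * P) * (z * b * (z * S / (z ^+ 4 * P))) * (4 * K%:R * z) <= _).
  have zS : 0 <= z * S / (z ^+ 4 * P).
    by rewrite divr_ge0 ?mulr_ge0 ?exprn_ge0 // ltW.
  have Q0 : 0 <= b1 / L ^+ k.+1 + b2 / L ^+ k.+1 + 8 * d%:R * G * (b3 / P) / m%:R.
    apply: addr_ge0; first exact: addr_ge0.
    by rewrite divr_ge0 // mulr_ge0 // mulr_ge0 // mulr_ge0.
  have mle := m_le; rewrite -/P in mle.
  apply: ler_pM => //.
    by apply: mulr_ge0; apply: mulr_ge0 => //; apply: mulr_ge0.
  apply: ler_pM => //.
  - exact: mulr_ge0.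
  - by apply: mulr_ge0 => //; apply: mulr_ge0.
  - by rewrite ler_wpM2l.
  - apply: ler_pM => //; first exact: mulr_ge0.
    by rewrite ler_wpM2r.
rewrite le_eqVlt; apply/orP; left; apply/eqP.
by field; rewrite !gt_eqF.
Qed.

Let p := m%:R / m0%:R : R.
Let ratio_bounds : 0 <= p <= 1.
Proof.
by rewrite /p divr_ge0 //= ler_pdivrMr // mul1r ler_nat m_m0.
Qed.

Let square_error : p ^+ 2 * expect d l0 (fun s : seq {set 'I_n} => x s)
  <= C ^+ 2 * (6 * (bc j.+1 + 1)) / z.
Proof.
have b0 : 0 <= bc j.+1 + 1 by apply: addr_ge0.
apply: le_trans (ler_wpM2l (sqr_ge0 p) start_upto) _.
rewrite M0E.
have -> : p ^+ 2 * (3 * (bc j.+1 + 1) / L ^+ k * m0%:R)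
  = (bc j.+1 + 1) * (3 * (m%:R ^+ 2 / (L ^+ k * m0%:R))).
  by rewrite /p; have := Lk k; move: (L ^+ k) => P P0; field; rewrite !gt_eqF.
have -> : C ^+ 2 * (6 * (bc j.+1 + 1)) / z = (bc j.+1 + 1) * (3 * (2 * C ^+ 2 / z)).
  by field; rewrite gt_eqF.
apply: ler_wpM2l => //; apply: ler_wpM2l => //.
have P0 := Lk k.
apply: le_trans (_ : C ^+ 2 * L ^+ k / m0%:R <= _).
  rewrite ler_pdivrMr ?mulr_gt0 //.
  have -> : C ^+ 2 * L ^+ k / m0%:R * (L ^+ k * m0%:R) = (C * L ^+ k) ^+ 2.
    by move: (L ^+ k) => P; field; rewrite gt_eqF.
  by rewrite ler_sqr ?nnegrE ?mulr_ge0 ?(ltW P0) ?(ltW C_gt0).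
have m0L : L ^+ k * z <= 2 * m0%:R.
  have /andP[h _] := m0_bounds.
  apply: le_trans (_ : L ^+ K <= _); last by lra.
  apply: le_trans (_ : L ^+ k * L <= _); first by rewrite ler_wpM2l // ltW.
  rewrite -exprSr ler_weXn2l //; apply: leq_trans k_lt _.
  by rewrite mul2n -addnn -addnA leq_addr.
rewrite ler_pdivrMr //.
have -> : 2 * C ^+ 2 / z * m0%:R = C ^+ 2 * (2 * m0%:R / z) by ring.
rewrite -subr_ge0 -mulrBr mulr_ge0 ?sqr_ge0 // subr_ge0 ler_pdivlMr //.
Qed.

Let linear_error :
  expect d l0 (fun s : seq {set 'I_n} => `|p * x s - 2 * kap * m%:R / L ^+ k|)
  <= (3 * C * (fraction_const R d k + bc j + 1) + 2 * C * kap) / z.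
Proof.
have P0 := Lk k; set P := L ^+ k in P0 *.
have fr := below_fraction d_ge2 early0 L_ge1 clock_bound deficit_large mean_clock_half mean_clock_square jd.
rewrite -/P yE in fr.
set w := m%:R / (m0%:R * P).
have w0 : 0 <= w by rewrite divr_ge0 // mulr_ge0 // ltW.
have wC : w * m0%:R <= C.
  have -> : w * m0%:R = m%:R / P by rewrite /w; field; rewrite !gt_eqF.
  by rewrite ler_pdivrMr.
have kap0 : 0 <= kap by [].
have /andP[a2 _] := def_bounds.
have /andP[_ a21] := deficit_remaining R d_ge2 early0; rewrite M0E in a21.
apply: le_trans (_ : expect d l0 (fun s : seq {set 'I_n} => w * `|P * x s - kap * a| + w * kap) <= _).
  apply: ler_expect => s _ _.
  have -> : p * x s - 2 * kap * m%:R / P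
    = w * (P * x s - kap * a) + w * (kap * (a - 2 * m0%:R)).
    by rewrite /p /w; field; rewrite !gt_eqF.
  apply: le_trans (ler_normD _ _) _.
  rewrite (normrM w) (normrM w) (normrM kap) (ger0_norm w0) (ger0_norm kap0).
  rewrite lerD2l ler_wpM2l // ler_piMr // ler_norml; apply/andP; split; lra.
rewrite expectD expectZ (expect_const d_ge2) //.
have fc : 0 <= fraction_const R d k + bc j + 1.
  have : 0 <= (fraction_const R d k + bc j + 1) * a / z ^+ 2.
    apply: le_trans fr; apply: expect_ge0 => s _ _; exact: normr_ge0.
  by rewrite -mulrA pmulr_lge0 // divr_gt0 // exprn_gt0.
move: (fraction_const R d k + bc j + 1) fc fr => F F0 fr.
have -> : (3 * C * F + 2 * C * kap) / z = 3 * C * F / z + 2 * C * kap / z by ring.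
have zz : (z ^+ 2)^-1 <= z^-1.
  by rewrite lef_pV2 ?posrE ?exprn_gt0 // ler_eXnr.
apply: lerD.
  apply: le_trans (ler_wpM2l w0 fr) _.
  apply: le_trans (_ : w * (F * (3 * m0%:R) / z ^+ 2) <= _).
    rewrite ler_wpM2l // ler_wpM2r ?invr_ge0 ?sqr_ge0 //.
    by rewrite ler_wpM2l.
  have -> : w * (F * (3 * m0%:R) / z ^+ 2) = 3 * (w * m0%:R) * F * (z ^+ 2)^-1 by ring.
  apply: ler_pM => //.
  - by apply: mulr_ge0 F0; apply: mulr_ge0 => //; apply: mulr_ge0.
  - by rewrite invr_ge0 sqr_ge0.
  - by rewrite ler_wpM2r // ler_wpM2l.
have m0z : z <= 2 * m0%:R.
  have /andP[h _] := m0_bounds.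
  have : z <= L ^+ K by apply: le_trans zL _; rewrite ler_eXnr // addn_gt0 orbT.
  lra.
rewrite ler_pdivlMr //.
apply: le_trans (_ : w * kap * (2 * m0%:R) <= _).
  by rewrite ler_wpM2l // mulr_ge0.
have -> : w * kap * (2 * m0%:R) = 2 * (w * m0%:R) * kap by ring.
by rewrite ler_wpM2r // ler_wpM2l.
Qed.

(** The second phase replaces the probability by the mean of the power
    [(1 - m / m0)^x], which is [exp (- x m / m0)] up to second order, and [x m / m0]
    is close to [lambda] by [below_fraction]. *)
Lemma low_degree_asymptotic :
  `|expect d l1 (fun s : seq {set 'I_n} => (below j.+1 s == 0%N)%:R)
     - expR (- (2 * kap * m%:R / L ^+ k))| <= error_const / z.
Proof.
set P1 := expect d l1 _; set lam := 2 * kap * m%:R / L ^+ k.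
have lam0 : 0 <= lam by rewrite /lam divr_ge0 ?(ltW (Lk _)) // !mulr_ge0.
pose E0 : R := expect d l0 (fun s : seq {set 'I_n} => (1 - m%:R / m0%:R) ^+ below j.+1 s).
have -> : P1 - expR (- lam) = (P1 - E0) + (E0 - expR (- lam)) by ring.
apply: le_trans (ler_normD _ _) _; rewrite /error_const [leRHS]mulrDl.
apply: lerD; first exact: second_phase_error.
rewrite [leRHS]mulrDl; apply: le_trans (lerD square_error linear_error).
rewrite -expectZ -expectD -[expR _](@expect_const R d n d_ge2 l0 _ early0) -expectB.
apply: le_trans (expect_norm _ _ _) _; apply: ler_expect => s _ _.
have -> : (1 - m%:R / m0%:R) ^+ below j.+1 s - expR (- lam) =
  ((1 - p) ^+ below j.+1 s - expR (- (p * x s))) + (expR (- (p * x s)) - expR (- lam)).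
  by rewrite /p addrA subrK.
apply: le_trans (ler_normD _ _) _; apply: lerD.
  by rewrite [leRHS]mulrC; exact: power_exp_dist.
apply: expR_dist_le => //; rewrite mulr_ge0 //; by case/andP: ratio_bounds.
Qed.

End AtN.
End Uniform.

(** * The last time of a low degree *)

Section LastTime.
Variables (R : realType) (d n j : nat).
Hypothesis d_ge2 : (2 <= d)%N.
Hypothesis jn : (j < n)%N.

Lemma min_degree_gt (G : graph n) :
  (j < min_degree G)%N = [forall v, (j < degree G v)%N].
Proof.
apply/idP/forallP => [h v|h].
  apply: leq_trans h _; rewrite /min_degree; have := mem_index_enum v.
  elim: (index_enum _) => // w r IH; rewrite in_cons big_cons => /orP[/eqP <-|/IH].
    exact: geq_minl.
  exact: leq_trans (geq_minr _ _).
by apply: (big_ind (fun x => (j < x)%N)) => // x y hx hy; rewrite leq_min hx.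
Qed.

Lemma min_degree_below (s : seq {set 'I_n}) :
  (j < min_degree (graph_of s))%N = (below j.+1 s == 0%N).
Proof.
rewrite min_degree_gt cards_eq0; apply/forallP/eqP => [h|/setP h v].
  by apply/setP => v; rewrite !inE ltnS leqNgt h.
by have := h v; rewrite !inE ltnS ltnNge => ->.
Qed.

Lemma degree_sub (G G' : graph n) v : G \subset G' -> (degree G v <= degree G' v)%N.
Proof.
move=> /subsetP sub; apply/subset_leq_card/subsetP => e.
by rewrite !inE => /andP[/sub -> ->].
Qed.

Lemma min_degree_take (w : seq {set 'I_n}) l s : (l <= s)%N ->
  (j < min_degree (graph_of (take l w)))%N -> (j < min_degree (graph_of (take s w)))%N.
Proof.
move=> ls; rewrite !min_degree_gt => /forallP h; apply/forallP => v.
apply: leq_trans (h v) (degree_sub _ _); apply/subsetP => e.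
by rewrite !inE -(take_takel w ls); exact: mem_take.
Qed.

(** Degrees only grow, so the last time with a vertex of degree at most [j] is
    before [l] as soon as no such vertex is left at time [l]. *)
Lemma last_time_lt (w : run d n) l : (l <= size w)%N ->
  (last_time_le j w < l)%N = (below j.+1 (take l w) == 0%N).
Proof.
move=> lw; rewrite -min_degree_below; apply/idP/idP => h.
  rewrite ltnNge; apply/negP => h2; move: h; rewrite ltnNge => /negP; apply.
  by rewrite /last_time_le (bigD1 (Ordinal (lw : (l < (size w).+1)%N))) //= leq_maxl.
have l0 : (0 < l)%N.
  case: l h {lw} => // h; move: h; rewrite take0 min_degree_gt => /forallP/(_ (Ordinal jn)).
  by rewrite degree_nil.
rewrite -(prednK l0) ltnS; apply/bigmax_leqP => s hs; rewrite -ltnS prednK // ltnNge.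
by apply/negP => ls; move: hs; rewrite leqNgt (min_degree_take ls h).
Qed.

Lemma last_time_prob (t : R) : 0 <= t -> (Num.truncn t <= max_edges d n)%N ->
  early d n (max_edges d n - Num.truncn t) ->
  dprocess_prob R (fun w : run d n => (last_time_le j w)%:R < (max_edges d n)%:R - t)
  = expect d (max_edges d n - Num.truncn t) (fun s : seq {set 'I_n} => (below j.+1 s == 0%N)%:R).
Proof.
move=> t0; have /andP[tm tm1] := truncn_itv t0; set m := Num.truncn t in tm tm1 * => mN he.
rewrite -(dprocess_prob_expect R (ltnW d_ge2) (fun s => below j.+1 s == 0%N) he).
rewrite /dprocess_prob; apply: eq_bigl => w; apply: andb_id2l => cw.
have lw := size_complete_run R (ltnW d_ge2) he cw.
rewrite -(last_time_lt lw) ltn_subRL; apply/idP/idP => h.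
  by rewrite -(ltr_nat R) natrD; lra.
have : (m + last_time_le j w).+1%:R <= (max_edges d n)%:R :> R by rewrite ler_nat.
by rewrite -natr1 natrD; move: tm1; rewrite -natr1; lra.
Qed.

End LastTime.

Section Limit.
Variables (R : realType) (d j : nat).
Hypothesis hd : (2 <= d)%N.
Hypothesis hj : (j < d - 1)%N.

Local Notation k := (d - 1 - j)%N.
Local Notation kap := (((d - 1) ^_ k)%:R : R).
Local Notation prob n t := (dprocess_prob R (fun w : run d n =>
       (last_time_le j w)%:R < (max_edges d n)%:R - t)).

Lemma prob_anti n (t1 t2 : R) : t1 <= t2 -> prob n t2 <= prob n t1.
Proof. by move=> h; apply: le_dprocess_prob => w; lra. Qed.

(** The factor [2] below leaves room for rounding [t] down to an integer number
    of missing edges. *)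
Lemma last_time_asymptotic (c C z : R) n (t : R) : 0 < c -> 0 < C ->
  (j < n)%N -> ln n%:R = z ^+ 4 -> threshold d c C <= z -> 1 / c <= z ->
  2 * c * ln n%:R ^+ k <= t -> t <= C * ln n%:R ^+ k ->
  `|prob n t - expR (- rate d j t n)| <= (error_const d j c C + 2 * kap) / z.
Proof.
move=> c0 C0 jn LE hz cz t1 t2.
have z0 : 0 < z by apply: lt_le_trans cz; rewrite divr_gt0.
have z1 : 1 <= z.
  apply: le_trans hz; rewrite /threshold.
  have d0 : 0 <= d%:R :> R by [].
  have : 0 <= 4 * (2 * d + 7)%N%:R :> R by rewrite mulr_ge0.
  have : 0 <= (3 * d%:R) ^+ (2 * d + 6) :> R by rewrite exprn_ge0 // mulr_ge0.
  have : 0 <= (d%:R ^+ 2 + 1) * (16 / (4 * (2 * d + 7)%N%:R)^-1) / c.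
    by rewrite divr_ge0 ?(ltW c0) // mulr_ge0 ?addr_ge0 ?exprn_ge0 // invrK !mulr_ge0.
  lra.
have L1 : 1 <= ln n%:R :> R by rewrite LE exprn_ege1.
set L := ln n%:R in LE L1 t1 t2 *.
have P1 : 1 <= L ^+ k by rewrite exprn_ege1.
have zP : z <= L ^+ k.
  apply: le_trans (_ : L <= _); first by rewrite LE ler_eXnr.
  by rewrite ler_eXnr // subn_gt0.
have P0 : 0 < L ^+ k by lra.
have t0 : 0 <= t by apply: le_trans t1; rewrite !mulr_ge0 ?ltW.
have /andP[tm tm1] := truncn_itv t0; set m := Num.truncn t in tm tm1.
have m_le : m%:R <= C * L ^+ k by apply: le_trans t2.
have m_ge : c * L ^+ k <= m%:R.
  have : 1 <= c * L ^+ k.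
    by rewrite mulrC -ler_pdivrMr // (le_trans cz).
  move: tm1; rewrite -natr1; lra.
have mN := m_le_max hd c0 C0 LE hz m_le.
have he := early_end hd hj c0 C0 LE hz m_ge m_le.
have asym := low_degree_asymptotic hd hj c0 C0 LE hz m_ge m_le.
rewrite last_time_prob // -/m.
set X := expect _ _ _ in asym *.
have -> : X - expR (- rate d j t n) = (X - expR (- (2 * kap * m%:R / L ^+ k)))
   + (expR (- (2 * kap * m%:R / L ^+ k)) - expR (- rate d j t n)) by ring.
apply: le_trans (ler_normD _ _) _; rewrite [leRHS]mulrDl; apply: lerD => //.
have r0 x : 0 <= x -> 0 <= 2 * kap * x / L ^+ k.
  by move=> hx; rewrite divr_ge0 ?(ltW P0) // mulr_ge0.
apply: le_trans (expR_dist_le _ _) _; rewrite ?r0 //.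
have kap2 : 0 <= 2 * kap by rewrite mulr_ge0.
rewrite /rate -/L -mulrBl -mulrBr -mulrA (normrM (2 * kap)) (ger0_norm kap2).
rewrite ler_wpM2l // normrM.
rewrite normfV (ger0_norm (ltW P0)) ler_pdivrMr //.
apply: le_trans (_ : 1 <= _).
  by rewrite ler_norml; move: tm1; rewrite -natr1 => ?; apply/andP; split; lra.
by rewrite ler_pdivlMl // mulr1.
Qed.

End Limit.

Local Open Scope classical_set_scope.
Local Open Scope ring_scope.

Theorem corollary1p7 (R : realType) (d j : nat) (hd : (2 <= d)%N)
    (hj : (j < d - 1)%N) (t : nat -> R) (ht : forall n : nat, 0 < t n) :
  (fun n : nat =>
     dprocess_prob R (fun w : run d n =>
       (last_time_le j w)%:R < (max_edges d n)%:R - t n)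
     - expR (- rate d j (t n) n)) @ \oo --> (0 : R).
Proof.
apply/cvgrPdist_le => eps eps0.
set k := (d - 1 - j)%N; set kap : R := ((d - 1) ^_ k)%:R.
have a0 : 0 < 2 * kap :> R.
  by rewrite mulr_gt0 // ltr0n ffact_gt0 leq_subr.
set a := 2 * kap in a0.
(* below c0 log^k n the limit exceeds 1 - eps / 4, above C log^k n it is at most
   eps / 4 *)
pose c0 : R := eps / (4 * a); pose C0 : R := 4 / (a * eps).
have c00 : 0 < c0 by rewrite divr_gt0 // mulr_gt0.
have C00 : 0 < C0 by rewrite divr_gt0 // mulr_gt0.
pose c := c0 / 2; pose C := C0 + c0.
have cp : 0 < c by rewrite divr_gt0.
have Cp : 0 < C by rewrite addr_gt0.
have lowE : 1 - eps / 4 <= expR (- (a * c0)).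
  apply: le_trans (expR_ge1Dx _); rewrite lerD2l lerN2 /c0.
  by rewrite le_eqVlt; apply/orP; left; apply/eqP; field; rewrite gt_eqF.
have highE : expR (- (a * C)) <= eps / 4.
  rewrite expRN -[leLHS]mul1r ler_pdivrMr ?expR_gt0 //.
  have h1 := expR_ge1Dx (a * C).
  have h2 : 1 <= eps / 4 * (a * C).
    have -> : eps / 4 * (a * C) = 1 + eps / 4 * (a * c0).
      by rewrite /C /C0; field; rewrite !gt_eqF.
    rewrite lerDl; apply: mulr_ge0; first by rewrite divr_ge0 // ltW.
    by apply: mulr_ge0; exact: ltW.
  apply: le_trans h2 _; rewrite ler_wpM2l ?divr_ge0 ?(ltW eps0) //; lra.
pose err := error_const d j c C + 2 * kap.
pose A : R := `|threshold d c C| + `|1 / c| + `|4 * err / eps|.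
have A0 : 0 <= A by rewrite !addr_ge0.
near=> n.
have nA : expR (A ^+ 4) <= n%:R.
  apply: le_trans (_ : (Num.truncn (expR (A ^+ 4))).+1%:R <= _).
    exact/ltW/truncnS_gt.
  by rewrite ler_nat; near: n; exact: nbhs_infty_ge.
have jn : (j < n)%N by near: n; exact: nbhs_infty_ge.
have n0 : 0 < n%:R :> R by apply: lt_le_trans nA; exact: expR_gt0.
have LA : A ^+ 4 <= ln n%:R by rewrite -ler_expR lnK.
set z := Num.sqrt (Num.sqrt (ln n%:R : R)).
have L0 : 0 <= ln n%:R :> R by apply: le_trans LA; rewrite exprn_ge0.
have LE : ln n%:R = z ^+ 4 by rewrite (exprM z 2 2) !sqr_sqrtr // sqrtr_ge0.
have Az : A <= z.
  rewrite leNgt; apply/negP => zA; move: LA; rewrite LE leNgt => /negP; apply.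
  by rewrite ltrXn2r ?sqrtr_ge0.
have th : threshold d c C <= z.
  apply: le_trans Az; apply: le_trans (ler_norm _) _.
  by rewrite /A -addrA lerDl addr_ge0.
have cz : 1 / c <= z.
  apply: le_trans Az; apply: le_trans (ler_norm _) _.
  by rewrite /A addrAC lerDr addr_ge0.
have ez : 4 * err / eps <= z.
  apply: le_trans Az; apply: le_trans (ler_norm _) _.
  by rewrite /A lerDr addr_ge0.
have z0 : 0 < z by apply: lt_le_trans cz; rewrite divr_gt0.
have errz : err / z <= eps / 4.
  rewrite ler_pdivrMr // mulrC mulrA ler_pdivlMr // [leLHS]mulrC.
  by move: ez; rewrite ler_pdivrMr.
pose P : R := ln n%:R ^+ k.
have P0 : 0 < P by rewrite /P LE !exprn_gt0.
pose q (x : R) : R := dprocess_prob R (fun w : run d n =>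
       (last_time_le j w)%:R < (max_edges d n)%:R - x).
have rateE (x : R) : rate d j x n = a * (x / P) by rewrite /rate -/k -/kap -/a mulrA.
have main (x : R) : c0 * P <= x -> x <= C * P -> `|q x - expR (- rate d j x n)| <= eps / 4.
  move=> h1 h2; apply: le_trans errz.
  apply: (last_time_asymptotic hd hj cp Cp jn LE th cz) => //.
  by have -> : 2 * c = c0 by rewrite /c mulrC divfK // pnatr_eq0.
have q1 x : q x <= 1 by apply: dprocess_prob_le1; exact: ltnW hd.
have q0 x : 0 <= q x by exact: dprocess_prob_ge0.
have anti (x y : R) : x <= y -> q y <= q x by exact: prob_anti.
rewrite sub0r normrN -/(q (t n)).
have e0 := expR_ge0 (- rate d j (t n) n).
have e1 : expR (- rate d j (t n) n) <= 1.
  rewrite -expR0 ler_expR oppr_le0 rateE mulr_ge0 ?(ltW a0) // divr_ge0 ?ltW //.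
have cC : c0 * P <= C * P by rewrite ler_wpM2r ?(ltW P0) // /C lerDr ltW.
case: (leP (c0 * P) (t n)) => h1; last first.
  have := main _ (lexx _) cC; rewrite rateE mulfK ?gt_eqF // ler_norml => /andP[m1 _].
  have := anti _ _ (ltW h1); have := q1 (t n).
  have : expR (- (a * c0)) <= expR (- rate d j (t n) n).
    by rewrite ler_expR lerN2 rateE ler_wpM2l ?(ltW a0) // ler_pdivrMr // ltW.
  by rewrite ler_norml => ? ? ?; apply/andP; split; lra.
case: (leP (t n) (C * P)) => h2.
  by apply: le_trans (main _ h1 h2) _; lra.
have := main _ cC (lexx _); rewrite rateE mulfK ?gt_eqF // ler_norml => /andP[_ m2].
have := anti _ _ (ltW h2); have := q0 (t n).
have : expR (- rate d j (t n) n) <= expR (- (a * C)).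
  by rewrite ler_expR lerN2 rateE ler_wpM2l ?(ltW a0) // ler_pdivlMr // ltW.
by rewrite ler_norml => ? ? ?; apply/andP; split; lra.
Unshelve. all: by end_near.
Qed.
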